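(* Suppose that $(X_n,\eta_n)$ is a time-homogeneous, irreducible Markov chain on the half strip $\Sigma$ and that all of the following hold. (1) For some $p>2$ there is a constant $C_p<\infty$ such that $\mathbb{E}_{x,i}[|X_{n+1}-X_n|^p]\le C_p$ for all $(x,i)\in\Sigma$ and all $n$. (2) For $i,j\in S$ there exist $\gamma_{ij}\in\mathbb{R}$ such that $q_{ij}(x)=q_{ij}+\frac{\gamma_{ij}}{x}+o(x^{-1})$ as $x\to\infty$, where $(q_{ij})_{i,j\in S}$ is an irreducible stochastic matrix; let $(\pi_i)_{i\in S}$ be its unique stationary distribution. (3) For $i,j\in S$ there exist $d_i,e_i,d_{ij}\in\mathbb{R}$ and $t_i^2\in[0,\infty)$, with at least one $t_i^2$ non-zero, such that, as $x\to\infty$, $\mu_i(x)=d_i+\frac{e_i}{x}+o(x^{-1})$, $\sigma_i^2(x)=t_i^2+o(1)$ and $\mu_{ij}(x)=d_{ij}+o(1)$; and moreover $\sum_{i\in S}\pi_id_i=0$. Let $(a_i)_{i\in S}$ be a solution of the system $$d_i+\sum_{j\in S}(a_j-a_i)q_{ij}=0\quad\text{for all } i\in S$$ (a solution exists and is unique up to adding a common constant to all $a_i$). Define $$U=\sum_{i\in S}\Big(2e_i+2\sum_{j\in S}a_j\gamma_{ij}\Big)\pi_i,\qquad V=\sum_{i\in S}\Big(t_i^2+2\sum_{j\in S}a_jd_{ij}\Big)\pi_i.$$ Then: - If $U>V$ then $(X_n,\eta_n)$ is transient. - If $|U|<V$ then $(X_n,\eta_n)$ is null recurrent. - If $U<-V$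 then $(X_n,\eta_n)$ is positive recurrent. If, in addition, there exist $\delta_2,\delta_3\in(0,1)$ such that for all $i,j\in S$, as $x\to\infty$, $q_{ij}(x)=q_{ij}+\frac{\gamma_{ij}}{x}+o(x^{-1-\delta_3})$, $\mu_i(x)=d_i+\frac{e_i}{x}+o(x^{-1-\delta_2})$, $\sigma_i^2(x)=t_i^2+o(x^{-\delta_2})$ and $\mu_{ij}(x)=d_{ij}+o(x^{-\delta_2})$, then also: - If $|U|=V$ then $(X_n,\eta_n)$ is null recurrent.
   Context: $S$ is a finite non-empty set, and $\Sigma\subset[0,\infty)\times S$ is locally finite, meaning that $\Sigma\cap([0,c]\times S)$ is finite for every $c\ge 0$. For each $k\in S$ the line $\Lambda_k=\{x\ge 0:(x,k)\in\Sigma\}$ is unbounded. The chain is $(X_n,\eta_n)$, $n\in\{0,1,2,\dots\}$, with $X_n\in[0,\infty)$ and $\eta_n\in S$; recurrence, null recurrence, positive recurrence and transience are in the usual sense for irreducible countable Markov chains. Notation: for $(x,i)\in\Sigma$, $\mathbb{E}_{x,i}[\,\cdot\,]=\mathbb{E}[\,\cdot\mid X_n=x,\eta_n=i]$; $\mu_i(x)=\mathbb{E}_{x,i}[X_{n+1}-X_n]$; $\sigma_i^2(x)=\mathbb{E}_{x,i}[(X_{n+1}-X_n)^2]$; $\mu_{ij}(x)=\mathbb{E}_{x,i}[(X_{n+1}-X_n)\mathbf{1}\{\eta_{n+1}=j\}]$; $q_{ij}(x)=\mathbb{P}[\eta_{n+1}=j\mid X_n=x,\eta_n=i]$. All asymptotics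 as $x\to\infty$ for quantities on line $i$ are along $x\in\Lambda_i$.
   Formalization: In the last bullet (|U| = V implies null recurrent) the formal theorem additionally assumes V > 0; the claim as stated fails in the degenerate case U = V = 0, where the chain can be transient. *)

(* Defs.v *)
From HB Require Import structures.
From mathcomp Require Export all_boot all_order all_algebra.
From mathcomp Require Export all_classical all_reals all_analysis.
Export Order.TTheory GRing.Theory Num.Theory.
Export numFieldNormedType.Exports.

Set Implicit Arguments.
Unset Strict Implicit.
Unset Printing Implicit Defensive.

Local Open Scope classical_set_scope.
Local Open Scope ring_scope.

Section HalfStrip.
Context {R : realType} {S : finType}.
Implicit Type Sigma : set (R * S).

Definition line Sigma (k : S) : set R := [set x | Sigma (x, k)].

Definition half_strip Sigma : Prop :=
  [/\ forall s, Sigma s -> 0 <= s.1,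
      forall c : R, 0 <= c -> finite_set (Sigma `&` [set s | s.1 <= c])
    & forall (k : S) (c : R), exists2 x, line Sigma k x & c < x].

Definition line_infty Sigma (i : S) : filter_on R :=
  FilterType (within (line Sigma i) (pinfty_nbhs R)) _.

Definition littleo_line Sigma (i : S) (f g : R -> R) : Prop :=
  let F := line_infty Sigma i in f =o_F g.

Definition stochastic (q : S -> S -> R) : Prop :=
  (forall i j, 0 <= q i j) /\ (forall i, \sum_j q i j = 1).

(* Every state leads to every other one by transitions of positive weight. *)
Definition irreducible_matrix (q : S -> S -> R) : Prop :=
  forall i j, connect (fun k l => 0 < q k l) i j.

Definition stationary_distribution (q : S -> S -> R) (pi_ : S -> R) : Prop :=
  [/\ forall i, 0 <= pi_ i,
      \sum_i pi_ i = 1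
    & forall j, \sum_i pi_ i * q i j = pi_ j].
End HalfStrip.

Section Conditioning.
Context {d : measure_display} {T : measurableType d} {R : realType}.
Variable P : probability T R.

(* Both are used only for conditioning events [B] of positive probability. *)
Definition condP (A B : set T) : R := fine (P (A `&` B)) / fine (P B).

Definition condE (Y : T -> \bar R) (B : set T) : \bar R :=
  ((\int[P]_(w in B) Y w) * (fine (P B))^-1%:E)%E.
End Conditioning.

Section Chain.
Context {d : measure_display} {T : measurableType d} {R : realType}.
Context {S : finType}.
Variable P : probability T R.
Variable X : nat -> {RV P >-> R}.
Variable eta : nat -> T -> S.
Variable Sigma : set (R * S).

Definition at_state (n : nat) (s : R * S) : set T :=
  [set w | (X n w, eta n w) = s].

Definition history (n : nat) (s : nat -> R * S) : set T :=
  \bigcap_(k in [set k | (k <= n)%N]) at_state k (s k).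

Definition markov_property : Prop :=
  forall (n : nat) (s : nat -> R * S) (t : R * S),
    (0 < P (history n s))%E ->
    condP P (at_state n.+1 t) (history n s) =
    condP P (at_state n.+1 t) (at_state n (s n)).

Definition time_homogeneous : Prop :=
  forall (m n : nat) (s t : R * S),
    (0 < P (at_state m s))%E -> (0 < P (at_state n s))%E ->
    condP P (at_state m.+1 t) (at_state m s) =
    condP P (at_state n.+1 t) (at_state n s).

(* The law of the initial state is arbitrary.  The clause
   [0 < P (at_state m s)] costs nothing: from wherever the chain starts,
   irreducibility makes it visit every state with positive probability. *)
Definition irreducible_chain : Prop :=
  forall s t, Sigma s -> Sigma t ->
    exists m n : nat, (0 < P (at_state m s))%E /\
      0 < condP P (at_state (m + n) t) (at_state m s).

Definition homogeneous_irreducible_chain : Prop :=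
  [/\ forall n j, measurable (eta n @^-1` [set j]),
      forall n w, Sigma (X n w, eta n w),
      markov_property, time_homogeneous & irreducible_chain].

(* [f x] is the value of E[Y_n | X_n = x, eta_n = i], for every time [n] at
   which the conditioning is meaningful. *)
Definition is_condE (Y : nat -> T -> R) (i : S) (f : R -> R) : Prop :=
  forall n x, (0 < P (at_state n (x, i)))%E ->
    condE P (fun w => (Y n w)%:E) (at_state n (x, i)) = (f x)%:E.

Definition is_condP (A : nat -> set T) (i : S) (f : R -> R) : Prop :=
  forall n x, (0 < P (at_state n (x, i)))%E ->
    condP P (A n) (at_state n (x, i)) = f x.

Definition incr (n : nat) (w : T) : R := X n.+1 w - X n w.

Definition returns (m : nat) (s : R * S) : set T :=
  [set w | exists2 k, (0 < k)%N & at_state (m + k) s w].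

(* First return time to [s] counted from time [m], equal to [+oo] when there is
   no return (the infimum of the empty set). *)
Definition return_time (m : nat) (s : R * S) (w : T) : \bar R :=
  ereal_inf [set k%:R%:E | k in
    [set k | (0 < k)%N /\ at_state (m + k) s w]].

(* For a homogeneous Markov chain the conditional laws below do not depend on
   [m]; irreducibility provides at least one admissible [m] for every [s]. *)
Definition transient : Prop :=
  forall s, Sigma s -> forall m, (0 < P (at_state m s))%E ->
    condP P (returns m s) (at_state m s) < 1.

Definition recurrent : Prop :=
  forall s, Sigma s -> forall m, (0 < P (at_state m s))%E ->
    condP P (returns m s) (at_state m s) = 1.

Definition positive_recurrent : Prop :=
  recurrent /\
  forall s, Sigma s -> forall m, (0 < P (at_state m s))%E ->
    (condE P (return_time m s) (at_state m s) < +oo)%E.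

Definition null_recurrent : Prop :=
  recurrent /\
  forall s, Sigma s -> forall m, (0 < P (at_state m s))%E ->
    condE P (return_time m s) (at_state m s) = +oo%E.
End Chain.

(* Main.v *)
Require Import Defs.
From mathcomp Require Import measurable_realfun ring lra.

Set Implicit Arguments.
Unset Strict Implicit.
Unset Printing Implicit Defensive.

Local Open Scope classical_set_scope.
Local Open Scope ring_scope.

(** The proof reduces the half strip to a one-dimensional process of Lamperti
    type. Put [Y = X + a_eta], up to a constant that keeps [Y] away from [0].
    The system solved by [a] says that the constant part of the drift of [Y]
    vanishes on every line. Thus, on line [i], the increment of [Y] has mean
    [u_i / (2 Y) + o(1 / Y)] and second moment [v_i + o(1)], and the averages of
    [u] and [v] under the stationary law [pi] are [U] and [V]
    ([sum_drift_coef], [sum_var_coef], [moments_close_far]).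

    By Taylor's formula, [G(Y)] has one-step drift close to
    [(G'(Y) u_i / Y + G''(Y) v_i) / 2], which still depends on the line. Adding
    [b_i W(Y)], with [W] of the order of [G''], changes this by
    [W(Y) * sum_j (b_j - b_i) q_ij]. The Poisson equation for the matrix [q] is
    solvable as soon as the right-hand side has mean zero under [pi]
    ([poisson_solvable]), so [b] can be chosen to replace [u_i] and [v_i] by [U]
    and [V] ([drift_combine]). In particular [Y ^ r], so corrected, has drift
    [(r / 2) (U + (r - 1) V) Y ^ (r - 2)] to leading order ([drift_power]), and
    everything follows from a choice of [r].
    - If [U > V], a small negative [r] gives a positive function that vanishes
      at infinity and decreases in mean: the chain is transient.
    - If [U < V], a small positive [r] gives a function that tends to infinity
      and decreases in mean: the chain is recurrent.
    - If [U < - V], then [Y ^ 2] decreases in mean by a fixed amount: the chain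
      is positive recurrent.
    - If [U > - V], then [Y ^ 2] has bounded drift while [Y ^ r] increases in
      mean for [r] slightly below [2]: the mean return time is infinite.
    - In the critical cases the leading term vanishes, and the polynomial rates
      leave room for a perturbation: [ln Y - Y ^ (- eps)] shows recurrence when
      [U = V], and [Y ^ 2 - Y ^ (2 - eps)], compared with [Y ^ 2 ln Y], shows
      nullity when [U = - V].

    The Foster criteria that turn these functions into statements on the chain
    ([foster_recurrent], [foster_transient], [foster_positive], [foster_null])
    are proved without martingales. For a target state [z], the hitting
    probability and the mean hitting time of [z] are Green functions of the
    chain stopped at [z], which satisfy exact one-step equations
    ([green_step]). Combined with a test function they become superharmonic off
    a finite set and tend to infinity, so the minimum principle
    ([min_principle]), a consequence of irreducibility, controls them by their
    values on a finite set. The Markov property enters in one place: the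
    identification of the return probability and of the mean return time with
    these Green functions ([returns_green], [return_time_green]). *)

(** * The Poisson equation of an irreducible stochastic matrix *)

Section Poisson.
Context {R : realType} {S : finType}.
Variables (q : S -> S -> R) (pi_ : S -> R).
Hypothesis q_stoch : stochastic q.
Hypothesis q_irr : irreducible_matrix q.
Hypothesis pi_stat : stationary_distribution q pi_.

Let gen (b : S -> R) i := \sum_j (b j - b i) * q i j.

Lemma gen_eq b i : gen b i = \sum_j b j * q i j - b i.
Proof.
rewrite /gen; under eq_bigr do rewrite mulrBl.
by rewrite sumrB -mulr_sumr (q_stoch.2 i) mulr1.
Qed.

Lemma stationary_gen b : \sum_i pi_ i * gen b i = 0.
Proof.
have [_ _ pq] := pi_stat.
under eq_bigr do rewrite gen_eq mulrBr mulr_sumr.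
rewrite sumrB exchange_big /= [X in _ - X](_ : _ = \sum_j \sum_i pi_ i * (b j *
  q i j)) ?subrr//.
apply: eq_bigr => j _; rewrite -{1}pq mulr_suml.
by apply: eq_bigr => i _; rewrite mulrAC -mulrA.
Qed.

(** Where a harmonic function is maximal, its average over the successors can
    only equal the maximum if it is maximal at all of them; irreducibility
    carries this to every state. *)
Lemma harmonic_const b : (forall i, gen b i = 0) -> forall i j, b i = b j.
Proof.
move=> hb i0 j0.
have [m _ mP] := @Order.TotalTheory.arg_maxP _ _ _ i0 xpredT b isT.
suff h k : b k = b m by rewrite !h.
have /connectP [s + ->] := q_irr m k.
elim/last_ind: s => //= s k' IH.
rewrite rcons_path last_rcons => /andP[/IH {}IH ql].
set l := last m s in IH ql *.
have : \sum_j (b m - b j) * q l j = 0.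
  have /eqP := hb l; rewrite -oppr_eq0 -sumrN => /eqP; rewrite IH => h0.
  by rewrite -[RHS]h0; apply: eq_bigr => j _; rewrite -mulNr opprB.
move=> /eqP; rewrite psumr_eq0; last first.
  by move=> j _; rewrite mulr_ge0 ?(q_stoch.1) // subr_ge0; exact: mP.
move=> /allP /(_ k' (mem_index_enum _)) /=.
rewrite mulf_eq0 (gt_eqF ql) orbF subr_eq0 => /eqP -> //.
Qed.

(** The operator [gen] misses only one dimension; subtracting the constant
    function [\sum_i pi_ i * b i] makes it injective, hence onto. *)
Lemma poisson_solvable (k : S -> R) : \sum_i pi_ i * k i = 0 ->
  exists b : S -> R, forall i, gen b i = k i.
Proof.
move=> k0.
pose A : 'M[R]_#|S| := \matrix_(i, j)
  (q (enum_val j) (enum_val i) - (i == j)%:R - pi_ (enum_val i)).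
pose fn (v : 'rV[R]_#|S|) (s : S) := v 0 (enum_rank s).
have sumS (F : S -> R) : \sum_s F s = \sum_(i < #|S|) F (enum_val i).
  by rewrite -(big_enum_val F).
have AE v j : (v *m A) 0 j =
    gen (fn v) (enum_val j) - \sum_i pi_ i * fn v i.
  rewrite mxE gen_eq.
  under eq_bigr do rewrite mxE mulrBr mulrBr.
  rewrite !sumrB; congr (_ - _ - _).
  - by rewrite sumS; apply: eq_bigr => i _; rewrite /fn enum_valK.
  - rewrite /fn enum_valK (bigD1 j) //= eqxx mulr1 big1 ?addr0//.
    by move=> i /negbTE ->; rewrite mulr0.
  - by rewrite sumS; apply: eq_bigr => i _; rewrite /fn enum_valK mulrC.
have avg v (f : S -> R) : (forall i, gen v i - \sum_i pi_ i * v i = f i) ->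
    - (\sum_i pi_ i * v i) = \sum_i pi_ i * f i.
  move=> h; under [RHS]eq_bigr do rewrite -h mulrBr.
  rewrite sumrB stationary_gen sub0r -mulr_suml.
  by have [_ -> _] := pi_stat; rewrite mul1r.
have Afree : row_free A.
  apply/inj_row_free => v vA.
  have hv i : gen (fn v) i - \sum_i pi_ i * fn v i = 0.
    by have := AE v (enum_rank i); rewrite enum_rankK vA mxE => <-.
  have := avg _ (fun=> 0) hv.
  rewrite [RHS]big1 => [/eqP|i _]; last by rewrite mulr0.
  rewrite oppr_eq0 => /eqP p0.
  have hc i j : fn v i = fn v j.
    by apply: harmonic_const => l; have := hv l; rewrite p0 subr0.
  apply/rowP => j; rewrite mxE.
  have -> : v 0 j = fn v (enum_val j) by rewrite /fn enum_valK.
  rewrite -p0 -[LHS]mul1r; have [_ <- _] := pi_stat.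
  by rewrite mulr_suml; apply: eq_bigr => i _; rewrite (hc i (enum_val j)).
have Au : A \in unitmx by rewrite -row_free_unit.
pose v := (\row_j k (enum_val j)) *m invmx A.
exists (fn v) => i.
have hv i' : gen (fn v) i' - \sum_i pi_ i * fn v i = k i'.
  have := AE v (enum_rank i'); rewrite enum_rankK => <-.
  by rewrite /v mulmxKV // mxE enum_rankK.
have := avg _ _ hv; rewrite k0 => /eqP; rewrite oppr_eq0 => /eqP p0.
by have := hv i; rewrite p0 subr0.
Qed.

End Poisson.

(** * Asymptotic relations along a line *)

Section LittleO.
Context {R : realType} {S : finType}.
Variable Sigma : set (R * S).

Lemma littleo_lineP i (f g : R -> R) : littleo_line Sigma i f g ->
  forall eps, 0 < eps -> exists x0 : R, forall x, Sigma (x, i) -> x0 <= x ->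
    `|f x| <= eps * `|g x|.
Proof.
move=> /eqoP h eps e0; have := h _ e0; rewrite /= => -[M [Mr hM]].
exists (M + 1) => x sx Mx; apply: hM => //=.
by apply: lt_le_trans Mx; rewrite ltrDl.
Qed.

End LittleO.

(** * Global Taylor estimates for powers and logarithms *)

Section Taylor.
Context {R : realType}.
Implicit Types (r s y z : R).

Lemma powRDp y r s : 0 < y -> y `^ (r + s) = y `^ r * y `^ s.
Proof. by move=> y0; rewrite powRD // (gt_eqF y0) implybT. Qed.

Lemma ge0_ler_powRp r y z : 0 <= r -> 0 <= y -> y <= z -> y `^ r <= z `^ r.
Proof.
by move=> r0 y0 yz; apply: ge0_ler_powR; rewrite ?nnegrE // (le_trans y0).
Qed.

Lemma powR_mulV y r : 0 < y -> y `^ (- r) * y `^ r = 1.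
Proof. by move=> y0; rewrite -powRDp // addNr powRr0. Qed.

Lemma le0_ler_powRp r y z : r <= 0 -> 0 < y -> y <= z -> z `^ r <= y `^ r.
Proof.
move=> r0 y0 yz; rewrite -[r]opprK !(powRN _ (- r)).
have z0 : 0 < z by apply: lt_le_trans yz.
by rewrite lef_pV2 ?posrE ?powR_gt0 // ge0_ler_powRp // ?oppr_ge0 // ltW.
Qed.

Lemma le1_powR y r : 1 <= y -> r <= 0 -> y `^ r <= 1.
Proof. by move=> y1 r0; rewrite -(powRr0 y) ler_powR. Qed.

Lemma powR_comparable r y c : 0 < y -> y / 2 <= c -> c <= 2 * y ->
  c `^ r <= 2 `^ `|r| * y `^ r.
Proof.
move=> y0 yc cy; have c0 : 0 < c by apply: lt_le_trans yc; rewrite divr_gt0.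
have [r0|r0] := leP 0 r.
  by rewrite ger0_norm // -powRM ?(ltW y0) // ge0_ler_powRp // ltW.
rewrite ltr0_norm //.
have -> : 2 `^ (- r) = (2^-1 : R) `^ r.
  by rewrite -[2^-1]powR_inv1 // -powRrM mulN1r.
rewrite -powRM ?invr_ge0 ?(ltW y0) //.
by apply: le0_ler_powRp; rewrite ?(ltW r0) ?mulr_gt0 ?invr_gt0 // mulrC.
Qed.

Lemma mvt_bound (f df : R -> R) (M y z : R) :
  (forall c, Num.min y z <= c <= Num.max y z ->
     is_derive c 1 f (df c) /\ `|df c| <= M) ->
  `|f z - f y| <= M * `|z - y|.
Proof.
wlog yz : y z / y <= z.
  move=> H hM; have [/H->//|/ltW zy] := leP y z.
  rewrite distrC [`|z - y|]distrC; apply: H => // c.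
  by rewrite minC maxC; apply: hM.
rewrite min_l // max_r // => hM.
have [||c] := @MVT_segment R f df y z yz.
- by move=> x; rewrite in_itv /= => /andP[yx xz]; apply: (hM x _).1; rewrite !ltW.
- apply: derivable_within_continuous => x; rewrite in_itv /= => xyz.
  by have [[]] := hM x xyz.
rewrite in_itv /= => cyz ->; rewrite normrM ler_wpM2r //.
by have [] := hM c cyz.
Qed.

Lemma between_dist (y z c : R) : Num.min y z <= c <= Num.max y z ->
  `|c - y| <= `|z - y|.
Proof.
have [yz|zy] := leP y z => /andP[h1 h2].
  by rewrite !ger0_norm ?subr_ge0 // lerB.
by rewrite !ler0_norm ?subr_le0 ?lerN2 ?lerB // ltW.
Qed.

Lemma between_sub (y z c c' : R) : Num.min y z <= c <= Num.max y z ->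
  Num.min y c <= c' <= Num.max y c -> Num.min y z <= c' <= Num.max y z.
Proof.
move=> /andP[h1 h2] /andP[h3 h4]; apply/andP; split.
  by apply: le_trans h3; rewrite le_min h1 ge_min lexx.
by apply: le_trans h4 _; rewrite ge_max h2 le_max lexx.
Qed.

(** The mean value inequality, used for [G2], then for [G1], then for [G]; this
    gives the constant [1] instead of [1 / 6], which is enough. *)
Lemma taylor3 (G G1 G2 G3 : R -> R) (M y z : R) :
  (forall c, Num.min y z <= c <= Num.max y z ->
     [/\ is_derive c 1 G (G1 c), is_derive c 1 G1 (G2 c),
         is_derive c 1 G2 (G3 c) & `|G3 c| <= M]) ->
  `|G z - G y - G1 y * (z - y) - G2 y / 2 * (z - y) ^+ 2| <= M * `|z - y| ^+ 3.
Proof.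
move=> hG.
have M0 : 0 <= M.
  have [|_ _ _] := hG y; last by apply: le_trans.
  by rewrite ge_min le_max lexx.
have b2 c : Num.min y z <= c <= Num.max y z -> `|G2 c - G2 y| <= M * `|z - y|.
  move=> cyz; apply: le_trans (_ : M * `|c - y| <= _); last first.
    by rewrite ler_wpM2l // between_dist.
  by apply: (@mvt_bound G2 G3) => c1 hc1; have [] := hG c1 (between_sub cyz hc1).
have b1 c : Num.min y z <= c <= Num.max y z ->
    `|(G1 c - G2 y * (c - y)) - (G1 y - G2 y * (y - y))| <= M * `|z - y| ^+ 2.
  move=> cyz; apply: le_trans (_ : M * `|z - y| * `|c - y| <= _); last first.
    by rewrite expr2 mulrA ler_wpM2l ?mulr_ge0 // between_dist.
  apply: (@mvt_bound (fun c => G1 c - G2 y * (c - y)) (fun c => G2 c - G2 y)).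
  move=> c' /(between_sub cyz) c'yz; split; last exact: b2.
  have [_ d1 _ _] := hG _ c'yz.
  have -> : (fun c => G1 c - G2 y * (c - y)) = G1 - G2 y *: (id - cst y) by [].
  by apply: is_derive_eq; rewrite subr0 /GRing.scale /= mulr1.
have := @mvt_bound (fun c => G c - G1 y * (c - y) - G2 y / 2 * (c - y) ^+ 2)
   (fun c => G1 c - G2 y * (c - y) - (G1 y - G2 y * (y - y)))
   (M * `|z - y| ^+ 2) y z.
move=> /(_ _)/le_trans h.
have -> : G z - G y - G1 y * (z - y) - G2 y / 2 * (z - y) ^+ 2 =
  G z - G1 y * (z - y) - G2 y / 2 * (z - y) ^+ 2 -
  (G y - G1 y * (y - y) - G2 y / 2 * (y - y) ^+ 2) by ring.
apply: h; last by rewrite -mulrA -exprSr.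
move=> c cyz; split; last exact: b1.
have [d0 _ _ _] := hG _ cyz.
have -> : (fun c => G c - G1 y * (c - y) - G2 y / 2 * (c - y) ^+ 2) =
  G - G1 y *: (id - cst y) - (G2 y / 2) *: (id - cst y) ^+ 2 by [].
apply: is_derive_eq; rewrite /GRing.scale /= !subr0.
have -> : (id - cst y) c = c - y by [].
by field.
Qed.

(** Near [y] this is Lagrange's remainder, the third derivative being of size
    [y `^ (rho - 3)]; if instead [h] exceeds [y / 2], every
    term separately is at most a multiple of [y `^ (rho - q) * h `^ q], where
    [h = |z - y|]. *)
Lemma taylor_powR (q rho K : R) (G G1 G2 G3 : R -> R) :
  2 < q -> q <= 3 -> 0 <= rho -> rho < q ->
  (forall y, 1 <= y ->
     [/\ is_derive y 1 G (G1 y), is_derive y 1 G1 (G2 y) &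
         is_derive y 1 G2 (G3 y)]) ->
  (forall y, 1 <= y ->
     [/\ `|G y| <= K * y `^ rho, `|G1 y| <= K * y `^ (rho - 1),
         `|G2 y| <= K * y `^ (rho - 2) & `|G3 y| <= K * y `^ (rho - 3)]) ->
  exists2 K', 0 <= K' & forall y z, 1 <= y -> 1 <= z ->
    `|G z - G y - G1 y * (z - y) - G2 y / 2 * (z - y) ^+ 2|
      <= K' * (y `^ (rho - q) * `|z - y| `^ q).
Proof.
move=> q2 q3 rho0 rhoq dG bG.
have K0 : 0 <= K.
  have [h _ _ _] := bG 1 (lexx 1).
  by rewrite (le_trans _ (le_trans h _)) // powR1 mulr1.
pose C1 := K * 2 `^ `|rho - 3|.
pose C2 := K * (3 `^ rho * 2 `^ (q - rho)) + K * 2 `^ q + K * 2 `^ (q - 1) +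
  K * 2 `^ (q - 2).
have C10 : 0 <= C1 by rewrite mulr_ge0 ?powR_ge0.
have C20 : 0 <= C2.
  by rewrite !addr_ge0 // !mulr_ge0 // ?powR_ge0.
exists (C1 + C2); first by rewrite addr_ge0.
move=> y z y1 z1.
have y0 : 0 < y by apply: lt_le_trans y1.
set h := `|z - y|.
have h0 : 0 <= h by rewrite /h.
have P0 : 0 <= y `^ (rho - q) * h `^ q by rewrite mulr_ge0 ?powR_ge0.
rewrite mulrDl; have [near|far] := leP h (y / 2).
  apply: le_trans (_ : C1 * (y `^ (rho - q) * h `^ q) <= _); last first.
    by rewrite lerDl mulr_ge0.
  apply: (@le_trans _ _ (C1 * y `^ (rho - 3) * h ^+ 3)).
    apply: (@taylor3 _ _ _ G3) => c cyz.
    have cy := between_dist cyz.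
    have c1 : 1 <= c.
      by move: cyz => /andP[+ _]; apply: le_trans; rewrite le_min y1.
    have [d0 d1 d2] := dG _ c1; split => //.
    have [_ _ _ h3] := bG _ c1; apply: (le_trans h3).
    rewrite /C1 -mulrA ler_wpM2l //.
    have := le_trans cy near; rewrite ler_norml => /andP[l1 l2].
    by apply: powR_comparable => //; lra.
  rewrite -mulrA ler_wpM2l //.
  have [->|hn0] := eqVneq h 0; first by rewrite expr0n /= mulr0 mulr_ge0 ?powR_ge0.
  have hp : 0 < h by rewrite lt_neqAle eq_sym hn0.
  rewrite -powR_mulrn // [X in h `^ X](_ : _ = q + (3 - q)); last by rewrite addrC subrK.
  rewrite (powRDp q (3 - q) hp) mulrCA [leRHS]mulrC ler_wpM2l ?powR_ge0 //.
  rewrite (_ : rho - q = rho - 3 + (3 - q)); last by ring.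
  rewrite (powRDp (rho - 3) (3 - q) y0) ler_wpM2l ?powR_ge0 // ge0_ler_powRp ?subr_ge0 //.
  by lra.
apply: le_trans (_ : C2 * (y `^ (rho - q) * h `^ q) <= _); last first.
  by rewrite lerDr mulr_ge0.
have hp : 0 < h by apply: lt_trans far; rewrite divr_gt0.
have y2h : y <= 2 * h by move: far; rewrite ltr_pdivrMr // mulrC => /ltW.
have z3h : z <= 3 * h.
  have : z - y <= h by rewrite /h ler_norm.
  by move: far; rewrite ltr_pdivrMr // => *; lra.
(* every power of [y] below the exponent [q] is absorbed by [h] *)
have absorb t : 0 <= t -> y `^ (rho - (q - t)) * h `^ (q - t)
    <= 2 `^ t * (y `^ (rho - q) * h `^ q).
  move=> t0; rewrite (_ : rho - (q - t) = rho - q + t); last by ring.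
  rewrite (powRDp (rho - q) t y0) -mulrA [leRHS]mulrCA ler_wpM2l ?powR_ge0 //.
  have -> : h `^ q = h `^ (q - t) * h `^ t by rewrite -powRDp // subrK.
  rewrite mulrC mulrCA ler_wpM2l ?powR_ge0 //.
  by rewrite -powRM // ge0_ler_powRp // ltW.
have [b0 b1 b2 _] := bG _ y1; have [bz _ _ _] := bG _ z1.
rewrite !mulrDl.
apply: le_trans (ler_normB _ _) _; apply: lerD; last first.
  rewrite normrM normrM normrX -/h [`|2^-1|]ger0_norm ?invr_ge0 //.
  apply: (@le_trans _ _ (K * y `^ (rho - 2) * h ^+ 2)).
    rewrite ler_wpM2r ?exprn_ge0 // (le_trans _ b2) //.
    by rewrite ler_piMr // invf_le1 // ler1n.
  rewrite -!mulrA ler_wpM2l // -powR_mulrn //.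
  have := absorb (q - 2); rewrite subKr; apply; lra.
apply: le_trans (ler_normB _ _) _; apply: lerD; last first.
  rewrite normrM -/h; apply: (@le_trans _ _ (K * y `^ (rho - 1) * h)).
    by rewrite ler_wpM2r.
  rewrite -!mulrA ler_wpM2l //.
  have := absorb (q - 1); rewrite subKr powRr1 //; apply; lra.
apply: le_trans (ler_normB _ _) _; apply: lerD.
  apply: (le_trans bz); rewrite -!mulrA ler_wpM2l //.
  apply: (@le_trans _ _ (3 `^ rho * h `^ rho)).
    by rewrite -powRM // ge0_ler_powRp // (le_trans _ z1).
  rewrite ler_wpM2l ?powR_ge0 //.
  have := absorb (q - rho); rewrite subKr subrr powRr0 mul1r; apply; lra.
apply: (le_trans b0); rewrite -!mulrA ler_wpM2l //.
have := absorb q; rewrite subrr powRr0 mulr1 subr0; apply; lra.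
Qed.

Lemma le_powR_exp y r s : 1 <= y -> r <= s -> y `^ r <= y `^ s.
Proof. by move=> y1 rs; apply: ler_powR. Qed.

Lemma ln_le_powR y (s : R) : 0 < s -> 1 <= y -> `|ln y| <= s^-1 * y `^ s.
Proof.
move=> s0 y1; have y0 : 0 < y by apply: lt_le_trans y1.
rewrite ger0_norm ?ln_ge0 // -(ler_pM2l s0) mulrA divff ?gt_eqF // mul1r.
by rewrite -ln_powR ltW // ln_sublinear // powR_gt0.
Qed.

(** A negative power does not decay uniformly in the target point [z], which may
    be close to [1]; it is treated as a bounded function, and the loss is
    compensated by using only [kappa] of the [2 * kappa] moments available
    above the second one. *)
Lemma taylor_power (kappa r : R) : 0 < kappa -> kappa <= 2^-1 ->
  - kappa <= r -> r <= 2 -> exists2 K, 0 <= K & forall y z, 1 <= y -> 1 <= z ->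
  `|z `^ r - y `^ r - (r * y `^ (r - 1)) * (z - y)
     - (r * (r - 1) * y `^ (r - 2)) / 2 * (z - y) ^+ 2|
   <= K * (y `^ (r - 2 - kappa) * `|z - y| `^ (2 + 2 * kappa)).
Proof.
move=> k0 k1 kr r2.
pose rho := Num.max r 0.
pose K0 := 1 + `|r| + `|r * (r - 1)| + `|r * (r - 1) * (r - 2)|.
have rho0 : 0 <= rho by rewrite /rho le_max lexx orbT.
have rrho : r <= rho by rewrite /rho le_max lexx.
have rhor : rho <= r + kappa by rewrite /rho ge_max; apply/andP; split; lra.
have [||||y|y|K Kp hK] := @taylor_powR (2 + 2 * kappa) rho K0
   (fun y => y `^ r) (fun y => r * y `^ (r - 1))
   (fun y => r * (r - 1) * y `^ (r - 2))
   (fun y => r * (r - 1) * (r - 2) * y `^ (r - 3)).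
- lra.
- lra.
- by [].
- lra.
- move=> y1; have y0 : 0 < y by apply: lt_le_trans y1.
  split; first exact: is_derive1_powR.
  + have -> : (fun y => r * y `^ (r - 1)) = r *: (fun y => y `^ (r - 1)) by [].
    have d := is_derive1_powR (r - 1) y0.
    apply: is_derive_eq; rewrite /GRing.scale /= mulrA; congr (_ * _ `^ _); lra.
  + have -> : (fun y => r * (r - 1) * y `^ (r - 2)) =
      (r * (r - 1)) *: (fun y => y `^ (r - 2)) by [].
    have d := is_derive1_powR (r - 2) y0.
    apply: is_derive_eq; rewrite /GRing.scale /= mulrA; congr (_ * _ `^ _); lra.
- move=> y1; have hb (c t u : R) : `|c| <= K0 -> t <= u ->
      `|c * y `^ t| <= K0 * y `^ u.
    move=> cK tu; rewrite normrM [X in _ * X]ger0_norm ?powR_ge0 //.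
    by rewrite ler_pM ?powR_ge0 // le_powR_exp.
  have n1 := normr_ge0 r; have n2 := normr_ge0 (r * (r - 1)).
  have n3 := normr_ge0 (r * (r - 1) * (r - 2)).
  split; try (apply: hb; rewrite /K0; lra).
  by rewrite -[y `^ r]mul1r; apply: hb => //; rewrite normr1 /K0; lra.
- exists K => // y z y1 z1; apply: le_trans (hK y z y1 z1) _.
  rewrite ler_wpM2l // ler_wpM2r ?powR_ge0 // le_powR_exp //; lra.
Qed.

(** The functions needed at the critical exponents [r = 0] and [r = 2]. The
    logarithm costs a factor [y `^ kappa], again taken from the spare
    moments. *)
Lemma taylor_power_ln (kappa r : R) : 0 < kappa -> kappa <= 2^-1 ->
  0 <= r -> r <= 2 -> exists2 K, 0 <= K & forall y z, 1 <= y -> 1 <= z ->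
  `|z `^ r * ln z - y `^ r * ln y
     - (r * (y `^ (r - 1) * ln y) + y `^ (r - 1)) * (z - y)
     - (r * (r - 1) * (y `^ (r - 2) * ln y) + (2 * r - 1) * y `^ (r - 2)) / 2
         * (z - y) ^+ 2|
   <= K * (y `^ (r - 2 - kappa) * `|z - y| `^ (2 + 2 * kappa)).
Proof.
move=> k0 k1 r0 r2.
pose M := 1 + `|r| + `|r * (r - 1)| + `|r * (r - 1) * (r - 2)| +
  `|2 * r - 1| + `|3 * r ^+ 2 - 6 * r + 2|.
pose K0 := M * kappa^-1 + M.
have dG (c d t y : R) : 0 < y ->
   is_derive y 1 (fun y => c * (y `^ t * ln y) + d * y `^ t)
     (c * t * (y `^ (t - 1) * ln y) + (c + d * t) * y `^ (t - 1)).
  move=> y0; have d1 := is_derive1_powR t y0; have d2 := is_derive1_ln y0.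
  have -> : (fun y => c * (y `^ t * ln y) + d * y `^ t) =
     c *: ((fun y => y `^ t) * @ln R) + d *: (fun y => y `^ t) by [].
  apply: (is_derive_eq (is_deriveD (is_deriveZ c (is_deriveM d1 d2))
    (is_deriveZ d d1))).
  rewrite /GRing.scale /=.
  have -> : y `^ t = y * y `^ (t - 1).
    by rewrite -{2}[y]powRr1 ?ltW // -powRDp //; congr (_ `^ _); lra.
  field; lra.
have [||||y|y|K Kp hK] := @taylor_powR (2 + 2 * kappa) (r + kappa) K0
   (fun y => y `^ r * ln y)
   (fun y => r * (y `^ (r - 1) * ln y) + y `^ (r - 1))
   (fun y => r * (r - 1) * (y `^ (r - 2) * ln y) + (2 * r - 1) * y `^ (r - 2))
   (fun y => r * (r - 1) * (r - 2) * (y `^ (r - 3) * ln y) +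
      (3 * r ^+ 2 - 6 * r + 2) * y `^ (r - 3)).
- lra.
- lra.
- lra.
- lra.
- move=> y1; have y0 : 0 < y by apply: lt_le_trans y1.
  have e2 : r - 1 - 1 = r - 2 by lra.
  have e3 : r - 2 - 1 = r - 3 by lra.
  split.
  + have := dG 1 0 r y y0; rewrite !mul1r !mul0r !addr0 mul1r.
    congr is_derive; apply/funext => z; lra.
  + have := dG r 1 (r - 1) y y0; rewrite !mul1r e2.
    have -> : r + (r - 1) = 2 * r - 1 by lra.
    by congr is_derive; apply/funext => z; rewrite mul1r.
  + have := dG (r * (r - 1)) (2 * r - 1) (r - 2) y y0; rewrite e3.
    have -> : r * (r - 1) + (2 * r - 1) * (r - 2) = 3 * r ^+ 2 - 6 * r + 2.
      by ring.
    by [].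
- move=> y1; have y0 : 0 < y by apply: lt_le_trans y1.
  have hb (c d t : R) : `|c| <= M -> `|d| <= M ->
      `|c * (y `^ t * ln y) + d * y `^ t| <= K0 * y `^ (t + kappa).
    move=> cM dM; apply: le_trans (ler_normD _ _) _; rewrite mulrDl lerD //.
      rewrite normrM normrM [X in _ * (X * _)]ger0_norm ?powR_ge0 //.
      rewrite -mulrA ler_pM ?mulr_ge0 ?powR_ge0 //.
      by rewrite powRDp // mulrCA ler_wpM2l ?powR_ge0 // ln_le_powR.
    rewrite normrM [X in _ * X]ger0_norm ?powR_ge0 //.
    by rewrite ler_pM ?powR_ge0 // le_powR_exp // lerDl ltW.
  have n1 := normr_ge0 r; have n2 := normr_ge0 (r * (r - 1)).
  have n3 := normr_ge0 (r * (r - 1) * (r - 2)).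
  have n4 := normr_ge0 (2 * r - 1).
  have n5 := normr_ge0 (3 * r ^+ 2 - 6 * r + 2).
  have ek t : r + kappa - t = r - t + kappa by lra.
  rewrite !ek; split.
  + have := hb 1 0 r; rewrite mul1r mul0r addr0 normr1 normr0; apply; rewrite /M; lra.
  + have := hb r 1 (r - 1); rewrite mul1r normr1; apply; rewrite /M; lra.
  + by apply: hb; rewrite /M; lra.
  + by apply: hb; rewrite /M; lra.
- exists K => // y z y1 z1; apply: le_trans (hK y z y1 z1) _.
  rewrite ler_wpM2l // ler_wpM2r ?powR_ge0 // le_powR_exp //; lra.
Qed.

Lemma le_1DpowR (q h t : R) : 0 <= t -> t <= q -> 0 <= h -> h `^ t <= 1 + h `^ q.
Proof.
move=> t0 tq h0; have [h1|h1] := leP h 1.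
  rewrite (@le_trans _ _ 1) ?lerDl ?powR_ge0 //.
  by have := ge0_ler_powRp t0 h0 h1; rewrite powR1.
by rewrite (@le_trans _ _ (h `^ q)) ?lerDr // le_powR_exp // ltW.
Qed.

(** First order version for the correctors, of exponent [r - 2]. Far from [y]
    the function is at most [1], which is paid for by the power
    [|z - y| `^ (2 + 2 * kappa)]. *)
Lemma lipschitz_power (kappa r : R) : 0 < kappa -> kappa <= 2^-1 ->
  - kappa <= r -> r <= 2 -> exists2 K, 0 <= K & forall y z, 1 <= y -> 1 <= z ->
  `|z `^ (r - 2) - y `^ (r - 2)|
   <= K * (y `^ (r - 2 - kappa) * (1 + `|z - y| `^ (2 + 2 * kappa))).
Proof.
move=> k0 k1 kr r2.
pose q := 2 + 2 * kappa.
pose C1 := `|r - 2| * 2 `^ `|r - 3|.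
have C10 : 0 <= C1 by rewrite mulr_ge0 ?powR_ge0.
exists (C1 + 2 `^ q); first by rewrite addr_ge0 ?powR_ge0.
move=> y z y1 z1; have y0 : 0 < y by apply: lt_le_trans y1.
set h := `|z - y|; have h0 : 0 <= h by rewrite /h.
have hq : 0 <= 1 + h `^ q by rewrite addr_ge0 ?powR_ge0.
rewrite mulrDl; have [near|far] := leP h (y / 2).
  apply: le_trans (_ : C1 * (y `^ (r - 2 - kappa) * (1 + h `^ q)) <= _); last first.
    by rewrite lerDl !mulr_ge0 ?powR_ge0.
  apply: (@le_trans _ _ (C1 * y `^ (r - 3) * h)).
    apply: (@mvt_bound (fun y => y `^ (r - 2)) (fun y => (r - 2) * y `^ (r - 3))).
    move=> c cyz; have cy := between_dist cyz.
    have c1 : 1 <= c.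
      by move: cyz => /andP[+ _]; apply: le_trans; rewrite le_min y1.
    split.
      have -> : r - 3 = r - 2 - 1 by lra.
      by apply: is_derive1_powR; lra.
    rewrite normrM -mulrA ler_wpM2l // ger0_norm ?powR_ge0 //.
    have := le_trans cy near; rewrite ler_norml => /andP[l1 l2].
    by apply: powR_comparable => //; lra.
  rewrite -mulrA ler_wpM2l // ler_pM ?powR_ge0 //.
    by rewrite le_powR_exp //; lra.
  by rewrite -{1}[h]powRr1 // le_1DpowR // /q; lra.
apply: le_trans (_ : 2 `^ q * (y `^ (r - 2 - kappa) * (1 + h `^ q)) <= _); last first.
  by rewrite lerDr !mulr_ge0 ?powR_ge0.
have y2h : y <= 2 * h by move: far; rewrite ltr_pdivrMr // mulrC => /ltW.
apply: (@le_trans _ _ 1).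
  have p1 t : 1 <= t -> 0 <= t `^ (r - 2) <= 1.
    by move=> t1; rewrite powR_ge0 le1_powR // subr_le0.
  have /andP[a1 a2] := p1 _ y1; have /andP[a3 a4] := p1 _ z1.
  by rewrite ler_norml; apply/andP; split; lra.
apply: (@le_trans _ _ (2 `^ q * (y `^ (- q) * h `^ q))).
  rewrite mulrCA -powRM // -[leLHS](powR_mulV q y0) ler_wpM2l ?powR_ge0 //.
  by rewrite ge0_ler_powRp // ?(ltW y0) // /q; lra.
rewrite ler_wpM2l ?powR_ge0 // ler_pM ?powR_ge0 ?lerDr //.
by rewrite le_powR_exp // /q; lra.
Qed.

Lemma lipschitz_ln y z : 1 <= y -> 1 <= z -> `|ln z - ln y| <= `|z - y|.
Proof.
move=> y1 z1; rewrite -[leRHS]mul1r.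
apply: (@mvt_bound _ (fun y => y^-1)) => c /andP[+ _]; rewrite ge_min => yzc.
have c1 : 1 <= c by case/orP: yzc; apply: le_trans.
split; first by apply: is_derive1_ln; apply: lt_le_trans c1.
by rewrite ger0_norm ?invr_ge0 ?(le_trans _ c1) // invf_le1 // (lt_le_trans _ c1).
Qed.

End Taylor.

(** * Bounds on finite sets *)

Section FiniteMin.
Context {R : realType} {T : choiceType}.

Lemma finite_bound (A : set T) (f : T -> R) : finite_set A ->
  exists M, forall s, A s -> f s <= M.
Proof.
move=> /finite_seqP [l ->]; exists (\big[Num.max/0]_(s <- l) f s) => s sl.
exact: le_bigmax_seq.
Qed.

Lemma finite_argmin (A : set T) (f : T -> R) : finite_set A -> A !=set0 ->
  exists2 m, A m & forall s, A s -> f m <= f s.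
Proof.
move=> /finite_seqP [l ->]; elim: l => [[x]//|x l IH _].
have [[y yl]|no] := pselect ([set` l] !=set0); last first.
  exists x => [|s] /=; first by rewrite mem_head.
  rewrite inE => /orP[/eqP -> //|sl]; case: no; by exists s.
have [m ml hm] := IH (ex_intro _ y yl).
have [xm|mx] := leP (f x) (f m).
  exists x => [|s] /=; first by rewrite mem_head.
  rewrite inE => /orP[/eqP -> //|/hm]; exact: le_trans.
exists m => [|s] /=; first by rewrite inE ml orbT.
by rewrite inE => /orP[/eqP ->|/hm //]; exact: ltW.
Qed.

Lemma finite_lower (A : set T) (f : T -> R) : finite_set A ->
  (forall s, A s -> 0 < f s) -> exists2 c, 0 < c & forall s, A s -> c <= f s.
Proof.
move=> fA f0; have [A0|/set0P A0] := eqVneq A set0.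
  by exists 1 => // s; rewrite A0.
have [m Am hm] := finite_argmin f fA A0.
by exists (f m) => //; exact: f0.
Qed.

End FiniteMin.

(** * One-step means of the chain *)

Section OneStep.
Context {d : measure_display} {T : measurableType d} {R : realType}.
Context {S : finType}.
Variables (P : probability T R) (X : nat -> {RV P >-> R}) (eta : nat -> T -> S).
Variable Sigma : set (R * S).
Hypothesis S_gt0 : (0 < #|S|)%N.
Hypothesis hS : half_strip Sigma.
Hypothesis hC : homogeneous_irreducible_chain X eta Sigma.
Local Notation at_ := (at_state X eta).

Definition chain (n : nat) (w : T) : R * S := (X n w, eta n w).

Lemma countable_strip : countable Sigma.
Proof.
have [h0 hfin _] := hS.
have -> : Sigma = \bigcup_(n in [set: nat]) (Sigma `&` [set s | s.1 <= n%:R]).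
  apply/seteqP; split => [s hs|s [n _ []]//].
  exists (Num.trunc s.1).+1 => //; split => //=.
  by rewrite ltW // truncnS_gt.
apply: bigcup_countable => [|n _]; first exact: countableP.
exact/finite_set_countable/hfin.
Qed.

Lemma infinite_strip : infinite_set Sigma.
Proof.
have [_ _ hub] := hS => fs.
have /card_gt0P [i _] := S_gt0.
have [M hM] : exists M : R, forall s, Sigma s -> s.1 <= M.
  have /finite_seqP [l lE] := fs.
  exists (\big[Num.max/0]_(s <- l) s.1) => s; rewrite lE /= => sl.
  exact: le_bigmax_seq.
have [x sx Mx] := hub i M.
by have := hM _ sx; rewrite leNgt Mx.
Qed.

Lemma ex_enum : exists e : nat -> R * S,
  [/\ forall k, Sigma (e k), injective e & forall t, Sigma t -> exists k, e k = t].
Proof.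
have /card_bijP [f [g fg gf]] : ([set: nat] #= Sigma)%card.
  by apply: Cantor_Bernstein; [exact/infiniteP/infinite_strip|
    exact: countable_strip].
exists (fun k => val (f (exist _ k (mem_setT k)))); split => [k|k l|t ht].
- exact/set_mem/(valP (f _)).
- by move=> /val_inj /(can_inj fg) [].
- exists (val (g (exist _ t (mem_set ht)))).
  set k := g _; have -> : exist _ (val k) (mem_setT (val k)) = k by exact: val_inj.
  by rewrite /k gf.
Qed.

Let enum_state : nat -> R * S := sval (cid ex_enum).

Let enum_in k : Sigma (enum_state k).
Proof. by rewrite /enum_state; case: cid => e []. Qed.

Let enum_inj : injective enum_state.
Proof. by rewrite /enum_state; case: cid => e []. Qed.

Let enum_surj t : Sigma t -> exists k, enum_state k = t.
Proof. by move: t; rewrite /enum_state; case: cid => e []. Qed.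

Lemma chain_in n w : Sigma (chain n w).
Proof. by have [_ h _ _ _] := hC; apply: h. Qed.

Lemma measurable_at n s : measurable (at_ n s).
Proof.
have [he _ _ _ _] := hC; case: s => x i.
have -> : at_ n (x, i) = X n @^-1` [set x] `&` eta n @^-1` [set i].
  by apply/seteqP; split=> w /=; [case=> <- <-|case=> <- <-].
apply: measurableI; last exact: he.
rewrite -[X in measurable X]setTI; exact: measurable_funP.
Qed.
Hint Resolve measurable_at : core.

Lemma chain_cover n : [set: T] = \bigcup_k at_ n (enum_state k).
Proof.
apply/seteqP; split=> // w _; have [k kw] := enum_surj (chain_in n w).
by exists k => //; rewrite kw.
Qed.

Lemma trivIset_at n : trivIset setT (fun k => at_ n (enum_state k)).
Proof.
move=> k l _ _ [w [h1 h2]]; apply: enum_inj; exact: (etrans (esym h1) h2).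
Qed.

Lemma measurable_chain n (B : set (R * S)) : measurable (chain n @^-1` B).
Proof.
have -> : chain n @^-1` B =
    \bigcup_(k in [set k | B (enum_state k)]) at_ n (enum_state k).
  apply/seteqP; split=> w /=; last by case=> k /= Bk; rewrite /chain => ->.
  by have [k kw] := enum_surj (chain_in n w); exists k => /=; rewrite ?kw.
exact: bigcup_measurable.
Qed.

Lemma measurable_comp_chain n D d' (U : sigmaRingType d') (f : R * S -> U) :
  measurable D -> measurable_fun D (f \o chain n).
Proof. by move=> mD _ Y mY; apply: measurableI => //; exact: (measurable_chain
  n (f @^-1` Y)). Qed.
Hint Resolve measurable_comp_chain : core.

Lemma prob_integral_cst A c : measurable A ->
  (\int[P]_(w in A) c = c * P A)%E.
Proof. by move=> mA; rewrite integral_cst. Qed.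

Lemma prob_integral_indic A B : measurable A -> measurable B ->
  (\int[P]_(w in A) (\1_B w)%:E = P (B `&` A))%E.
Proof. by move=> mA mB; rewrite integral_indic. Qed.

Lemma integral_split E n (f : T -> \bar R) : measurable E ->
  measurable_fun E f -> (forall w, E w -> 0 <= f w)%E ->
  (\int[P]_(w in E) f w =
   \sum_(k <oo) \int[P]_(w in E `&` at_ n (enum_state k)) f w)%E.
Proof.
move=> mE mf f0; rewrite -[in LHS](setIT E) (chain_cover n) setI_bigcupr.
apply: ge0_integral_bigcup => [k||w [k _ []]|].
- exact: measurableI.
- by rewrite -setI_bigcupr -chain_cover setIT.
- by move=> /f0.
- by apply: trivIset_setIl; exact: trivIset_at.
Qed.

Lemma integral_chain E n (phi : R * S -> \bar R) : measurable E ->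
  (forall s, Sigma s -> 0 <= phi s)%E ->
  (\int[P]_(w in E) phi (chain n w) =
   \sum_(k <oo) phi (enum_state k) * P (E `&` at_ n (enum_state k)))%E.
Proof.
move=> mE p0.
rewrite (integral_split n) //; last 2 first.
- exact: (measurable_comp_chain _ _ mE).
- by move=> w _; exact/p0/chain_in.
apply: eq_eseriesr => k _.
rewrite -prob_integral_cst; last exact: measurableI.
by apply: eq_integral => w; rewrite inE /= /chain => -[_ ->].
Qed.

(** By homogeneity the transition law out of [s] can be read off at any time
    when [s] is visited with positive probability. *)
Definition start_time (s : R * S) : nat :=
  xget 0%N [set m | (0 < P (at_ m s))%E].

Lemma start_timeP s : Sigma s -> (0 < P (at_ (start_time s) s))%E.
Proof.
move=> hs; have [_ _ _ _ hirr] := hC.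
rewrite /start_time; case: xgetP => [m -> //|/= h].
by have [m [n [h0 _]]] := hirr s s hs hs; case: (h m).
Qed.

Definition next_mean (s : R * S) (phi : R * S -> \bar R) : \bar R :=
  condE P (fun w => phi (chain (start_time s).+1 w)) (at_ (start_time s) s).

Definition single (t : R * S) : R * S -> \bar R := fun s => (s == t)%:R%:E.

Lemma fin_prob A : measurable A -> P A = (fine (P A))%:E.
Proof. by move=> mA; rewrite fineK // fin_num_measure. Qed.

Let w0 s := fine (P (at_ (start_time s) s)).

Lemma w0_gt0 s : Sigma s -> 0 < w0 s.
Proof. by move=> /start_timeP h; rewrite /w0 fine_gt0 // h ltey_eq fin_num_measure. Qed.

Section props.
Variable s : R * S.
Hypothesis sS : Sigma s.

Let wV : (0 <= (w0 s)^-1%:E)%E.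
Proof. by rewrite lee_fin invr_ge0 ltW // w0_gt0. Qed.

Lemma next_mean_ge0 phi : (forall t, Sigma t -> 0 <= phi t)%E -> (0 <= next_mean s phi)%E.
Proof.
move=> p0; apply: mule_ge0 => //; apply: integral_ge0 => w _; exact/p0/chain_in.
Qed.

Lemma next_mean_mono phi psi : (forall t, Sigma t -> 0 <= phi t)%E ->
  (forall t, Sigma t -> phi t <= psi t)%E -> (next_mean s phi <= next_mean s psi)%E.
Proof.
move=> p0 pp; apply: lee_wpmul2r => //; apply: ge0_le_integral => //.
- by move=> w _; exact/p0/chain_in.
- exact: (measurable_comp_chain _ phi).
- exact: (measurable_comp_chain _ psi).
- by move=> w _; exact/pp/chain_in.
Qed.

Lemma next_mean_eq phi psi : (forall t, Sigma t -> phi t = psi t) -> next_mean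
  s phi = next_mean s psi.
Proof.
move=> pp; congr (_ * _)%E; apply: eq_integral => w _; exact/pp/chain_in.
Qed.

Lemma next_meanD phi psi : (forall t, Sigma t -> 0 <= phi t)%E ->
  (forall t, Sigma t -> 0 <= psi t)%E ->
  next_mean s (fun t => phi t + psi t)%E = (next_mean s phi + next_mean s psi)%E.
Proof.
move=> p0 q0; rewrite /next_mean /condE ge0_integralD //.
- by rewrite ge0_muleDl //; apply: integral_ge0 => w _;
    [exact/p0/chain_in | exact/q0/chain_in].
- by move=> w _; exact/p0/chain_in.
- exact: (measurable_comp_chain _ phi).
- by move=> w _; exact/q0/chain_in.
- exact: (measurable_comp_chain _ psi).
Qed.

Lemma next_meanZ phi (c : \bar R) : (0 <= c)%E -> (forall t, Sigma t -> 0 <= phi t)%E ->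
  next_mean s (fun t => c * phi t)%E = (c * next_mean s phi)%E.
Proof.
move=> c0 p0; rewrite /next_mean /condE ge0_integralZl //.
- by rewrite muleA.
- exact: (measurable_comp_chain _ phi).
- by move=> w _; exact/p0/chain_in.
Qed.

Lemma next_mean_cst (c : \bar R) : next_mean s (fun=> c) = c.
Proof.
rewrite /next_mean /condE prob_integral_cst // -muleA -/(w0 s).
by rewrite fin_prob // -EFinM divff ?mule1 // gt_eqF // w0_gt0.
Qed.

Lemma next_mean_series (phi : nat -> R * S -> \bar R) :
  (forall n t, Sigma t -> 0 <= phi n t)%E ->
  next_mean s (fun t => \sum_(n <oo) phi n t)%E = (\sum_(n <oo) next_mean s (phi n))%E.
Proof.
move=> p0; rewrite /next_mean /condE integral_nneseries //.
- rewrite muleC -nneseriesZl; last first.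
    by move=> n _; apply: integral_ge0 => w _; exact/p0/chain_in.
  by apply: eq_eseriesr => n _; rewrite muleC.
- by move=> n; exact: (measurable_comp_chain _ (phi n)).
- by move=> n w _; exact/p0/chain_in.
Qed.

Lemma next_mean_single_le phi t : (forall t', Sigma t' -> 0 <= phi t')%E -> Sigma t ->
  (phi t * next_mean s (single t) <= next_mean s phi)%E.
Proof.
move=> p0 tS; rewrite -next_meanZ //; last 2 first.
- exact: p0.
- by move=> t' _; rewrite lee_fin.
apply: next_mean_mono => t' t'S; first by rewrite mule_ge0 ?p0 // lee_fin.
by rewrite /single; case: eqP => [->|_]; rewrite ?mule1 // mule0 p0.
Qed.

End props.

Lemma integral_single E n t : measurable E ->
  (\int[P]_(w in E) single t (chain n w) = P (E `&` at_ n t))%E.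
Proof.
move=> mE; rewrite setIC -prob_integral_indic //.
apply: eq_integral => w _; rewrite /single indicE; congr ((nat_of_bool _)%:R%:E).
by apply/idP/idP => [/eqP h|]; [rewrite inE | rewrite inE => /eqP].
Qed.

(** [past m s E]: conditionally on the event [E] of the past, which fixes the
    state [s] at time [m], the next state has the one-step law of [s]. *)
Definition past m s E := [/\ measurable E, E `<=` at_ m s &
  forall t, (P (E `&` at_ m.+1 t) = P E * next_mean s (single t))%E].

(** The defining property of [past] concerns a single next state; summing over
    the countable strip extends it to every nonnegative function. *)
Lemma past_integral m s E phi : past m s E ->
  (forall t, Sigma t -> 0 <= phi t)%E -> Sigma s ->
  (\int[P]_(w in E) phi (chain m.+1 w) = P E * next_mean s phi)%E.
Proof.
move=> [mE Es hE] p0 sS; rewrite integral_chain // /next_mean /condE integral_chain //.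
rewrite -/(w0 s) (@fin_prob E) // muleCA muleC -EFinM -nneseriesZl; last first.
  by move=> k _; rewrite mule_ge0 // p0.
apply: eq_eseriesr => k _; rewrite hE /next_mean /condE integral_single // -/(w0 s).
rewrite EFinM -fin_prob // [X in (_ * (_ * X))%E = _]muleC.
by rewrite [X in (_ * X)%E = _]muleA muleCA.
Qed.

Lemma next_mean_singleE m s t : Sigma s -> (0 < P (at_ m s))%E ->
  (next_mean s (single t))%E = (condP P (at_ m.+1 t) (at_ m s))%:E.
Proof.
move=> sS ms; have [_ _ _ hom _] := hC.
rewrite (hom _ _ _ t ms (start_timeP sS)) /next_mean /condE integral_single //.
rewrite fin_prob; last exact: measurableI.
by rewrite -EFinM setIC.
Qed.

Lemma prob_condP A B : measurable A -> measurable B -> (0 < P B)%E ->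
  (P (B `&` A) = P B * (condP P A B)%:E)%E.
Proof.
move=> mA mB B0; rewrite (@fin_prob B) // -EFinM /condP mulrCA divff ?mulr1.
  by rewrite setIC -fin_prob //; exact: measurableI.
by rewrite gt_eqF // fine_gt0 // B0 ltey_eq fin_num_measure.
Qed.

Lemma past_null m s E : measurable E -> E `<=` at_ m s -> P E = 0%E -> past m s E.
Proof.
move=> mE Es E0; split=> // t; rewrite E0 mul0e.
by apply: subset_measure0 E0 => //; exact: measurableI.
Qed.

Lemma past_at m s : Sigma s -> past m s (at_ m s).
Proof.
move=> sS; have [p0|p0] := boolP (0 < P (at_ m s))%E; last first.
  apply: past_null => //; apply/eqP.
  by rewrite -measure_le0 leNgt.
split=> // t; rewrite (next_mean_singleE t sS p0).
exact: prob_condP.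
Qed.

Lemma measurable_history m (s : nat -> R * S) : measurable (history X eta m s).
Proof. by apply: bigcap_measurable => //; exists 0%N. Qed.
Hint Resolve measurable_history : core.

Lemma past_history m (s : nat -> R * S) : Sigma (s m) ->
  past m (s m) (history X eta m s).
Proof.
move=> sS; have sub : history X eta m s `<=` at_ m (s m).
  by move=> w /(_ m) /=; apply.
have [p0|p0] := boolP (0 < P (history X eta m s))%E; last first.
  apply: past_null => //; apply/eqP.
  by rewrite -measure_le0 leNgt.
have [_ _ mkv _ _] := hC.
have a0 : (0 < P (at_ m (s m)))%E.
  by apply: lt_le_trans p0 _; apply: le_measure; rewrite ?inE.
split=> // t; rewrite (next_mean_singleE t sS a0) -mkv //.
exact: prob_condP.
Qed.

Lemma prob_split E n : measurable E ->
  (P E = \sum_(k <oo) P (E `&` at_ n (enum_state k)))%E.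
Proof.
move=> mE; rewrite -[LHS]mul1e -prob_integral_cst // (@integral_split _ n) //.
apply: eq_eseriesr => k _; rewrite prob_integral_cst ?mul1e //.
exact: measurableI.
Qed.

(** * The chain stopped at a target state *)

Definition off (z : R * S) : R * S -> \bar R := fun s => (s != z)%:R%:E.

Lemma off_ge0 z s : (0 <= off z s)%E.
Proof. by rewrite lee_fin. Qed.

(** [taboo_rv z g m n] is [g] of the state at time [m + n + 1], cut off to the
    event that the states at times [m + 1] to [m + n] avoid [z], and
    [taboo z g n] is its conditional mean given the state at time [m + 1]. Both
    are defined by recursion on the first step, the only one to which the Markov
    property applies directly. *)
Fixpoint taboo_rv z (g : R * S -> \bar R) (m n : nat) (w : T) : \bar R :=
  if n is n'.+1 then (off z (chain m.+1 w) * taboo_rv z g m.+1 n' w)%E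
  else g (chain m.+1 w).

Fixpoint taboo z (g : R * S -> \bar R) (n : nat) (s : R * S) : \bar R :=
  if n is n'.+1 then (off z s * next_mean s (taboo z g n'))%E else g s.

Section paths.
Variables (z : R * S) (g : R * S -> \bar R).
Hypothesis g0 : forall s, Sigma s -> (0 <= g s)%E.

Lemma taboo_ge0 n s : Sigma s -> (0 <= taboo z g n s)%E.
Proof.
elim: n s => [|n IH] s sS /=; first exact: g0.
by rewrite mule_ge0 ?off_ge0 // next_mean_ge0.
Qed.

Lemma taboo_rv_ge0 m n w : (0 <= taboo_rv z g m n w)%E.
Proof.
elim: n m => [|n IH] m /=; first exact/g0/chain_in.
by rewrite mule_ge0 ?off_ge0.
Qed.

Lemma measurable_taboo_rv E m n : measurable E -> measurable_fun E (taboo_rv z g m n).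
Proof.
move=> mE; elim: n m => [|n IH] m /=.
  exact: (measurable_comp_chain _ g).
apply: emeasurable_funM => //.
exact: (measurable_comp_chain _ (off z)).
Qed.

Lemma integral_taboo_rv_history n m s : Sigma (s m) ->
  (\int[P]_(w in history X eta m s) taboo_rv z g m n w =
   P (history X eta m s) * next_mean (s m) (taboo z g n))%E.
Proof.
elim: n m s => [|n IH] m s sS.
  by rewrite (past_integral (past_history sS)) //; exact: g0.
rewrite -(past_integral (past_history sS)) //; last by move=> *; exact: taboo_ge0.
rewrite integral_chain //; last by move=> *; exact: taboo_ge0.
rewrite (@integral_split _ m.+1) //; last 2 first.
- exact: measurable_taboo_rv.
- by move=> w _; exact: taboo_rv_ge0.
apply: eq_eseriesr => k _; set t := enum_state k.
have -> : history X eta m s `&` at_ m.+1 t =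
    history X eta m.+1 (fun j => if (j == m.+1)%N then t else s j).
  apply/seteqP; split=> [w [hw1 hw2] j /=|w hw].
    rewrite leq_eqVlt => /predU1P [->|]; first by rewrite eqxx.
    by rewrite ltnS => jm; rewrite ltn_eqF ?ltnS //; apply: hw1.
  split=> [j /= jm|]; last by have := hw m.+1 (leqnn _); rewrite /= eqxx.
  by have := hw j (leqW jm); rewrite /= ltn_eqF.
set s' := fun j => _; have s't : s' m.+1 = t by rewrite /s' eqxx.
have mH : measurable (history X eta m.+1 s') by [].
transitivity (\int[P]_(w in history X eta m.+1 s') (off z t * taboo_rv z g m.+1 n w))%E.
  apply: eq_integral => w; rewrite inE => /(_ m.+1 (leqnn _)).
  by move=> h /=; have -> : chain m.+1 w = t := etrans h s't.
rewrite ge0_integralZl ?off_ge0 //; last 2 first.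
- exact: measurable_taboo_rv.
- by move=> w _; exact: taboo_rv_ge0.
rewrite IH; last by rewrite s't; exact: enum_in.
by rewrite s't /= muleCA muleC.
Qed.

(** The trajectory is prescribed between the times [j] and [m] only. Raising [j]
    from [0] to [m] forgets the past one step at a time, which passes from
    complete histories to the event of being in a given state at time [m]. *)
Definition window j m (s : nat -> R * S) : set T :=
  \bigcap_(k in [set k | (j <= k <= m)%N]) at_ k (s k).

Lemma integral_taboo_rv_window n m j s : Sigma (s m) -> (j <= m)%N ->
  (\int[P]_(w in window j m s) taboo_rv z g m n w =
   P (window j m s) * next_mean (s m) (taboo z g n))%E.
Proof.
move=> sS; elim: j s sS => [|j IH] s sS jm.
  have -> : window 0 m s = history X eta m s by [].
  exact: integral_taboo_rv_history.
have mW : measurable (window j.+1 m s).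
  apply: bigcap_measurable => //; first by exists m; rewrite /= jm /=.
rewrite (@integral_split _ j) //; last 2 first.
- exact: measurable_taboo_rv.
- by move=> w _; exact: taboo_rv_ge0.
have c0 : (0 <= next_mean (s m) (taboo z g n))%E by apply: next_mean_ge0 => //
  *; exact: taboo_ge0.
rewrite muleC -prob_integral_cst // [in RHS](@integral_split _ j) //.
apply: eq_eseriesr => k _; set t := enum_state k.
pose s' i := if (i == j)%N then t else s i.
have s'm : s' m = s m by rewrite /s' gtn_eqF.
have -> : window j.+1 m s `&` at_ j t = window j m s'.
  apply/seteqP; split=> [w [hw1 hw2] i /= /andP[]|w hw].
    rewrite leq_eqVlt => /predU1P [<-|ji im]; first by rewrite /s' eqxx.
    by rewrite /s' gtn_eqF //; apply: hw1; rewrite /= ji.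
  split=> [i /= /andP[ji im]|].
    by have := hw i; rewrite /= /s' gtn_eqF // (ltnW ji) im; apply.
  by have := hw j; rewrite /= /s' eqxx leqnn (ltnW jm); apply.
rewrite IH ?s'm // 1?ltnW // muleC prob_integral_cst //.
by apply: bigcap_measurable => //; exists m; rewrite /= leqnn ltnW.
Qed.

Lemma integral_taboo_rv n m s : Sigma s ->
  (\int[P]_(w in at_ m s) taboo_rv z g m n w = P (at_ m s) * next_mean s (taboo z g n))%E.
Proof.
move=> sS; have := @integral_taboo_rv_window n m m (fun=> s) sS (leqnn m).
have -> // : window m m (fun=> s) = at_ m s.
apply/seteqP; split=> [w /(_ m)|w hw k /=]; first by rewrite /= leqnn; apply.
by rewrite -eqn_leq => /eqP <-.
Qed.

(** With [g] the indicator of [z] this is the probability of ever hitting [z];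
    with [g] the indicator of the complement of [z] it is the mean hitting time
    of [z]. *)
Definition green s := (\sum_(n <oo) taboo z g n s)%E.

Lemma green_ge0 s : Sigma s -> (0 <= green s)%E.
Proof. by move=> sS; apply: nneseries_ge0 => n _ _; exact: taboo_ge0. Qed.

Lemma integral_series_taboo_rv m s : Sigma s ->
  (\int[P]_(w in at_ m s) \sum_(n <oo) taboo_rv z g m n w =
   P (at_ m s) * next_mean s green)%E.
Proof.
move=> sS; rewrite integral_nneseries //; last 2 first.
- by move=> n; exact: measurable_taboo_rv.
- by move=> n w _; exact: taboo_rv_ge0.
rewrite next_mean_series //; last by move=> *; exact: taboo_ge0.
rewrite [P _]fin_prob // -nneseriesZl; last by move=> n _; apply: next_mean_ge0
  => // *; exact: taboo_ge0.
apply: eq_eseriesr => n _; rewrite -fin_prob //; exact: integral_taboo_rv.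
Qed.

(** The Poisson equation of the Green function: its one-step mean falls short
    of it by [g], except at [z] where the chain is stopped. *)
Lemma green_step s : Sigma s -> s != z -> (green s = g s + next_mean s green)%E.
Proof.
move=> sS sz; rewrite [in RHS]/green next_mean_series //; last by move=> *;
  exact: taboo_ge0.
rewrite /green nneseries_recl //; last by move=> n _; exact: taboo_ge0.
congr (_ + _)%E; rewrite -(nneseries_addn 1); last by move=> n; exact: taboo_ge0.
by apply: eq_eseriesr => n _; rewrite addn1 /= /off sz mul1e.
Qed.

Lemma green_stop : Sigma z -> green z = g z.
Proof.
move=> zS; rewrite /green nneseries_recl //; last by move=> n _; exact: taboo_ge0.
rewrite eseries0 ?adde0 // => -[//|n] _ _ /=.
by rewrite /off eqxx mul0e.
Qed.

Definition greenN N s := (\sum_(0 <= n < N) taboo z g n s)%E.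

Lemma greenN_ge0 N s : Sigma s -> (0 <= greenN N s)%E.
Proof. by move=> sS; apply: sume_ge0 => n _; exact: taboo_ge0. Qed.

Lemma greenN_rec N s : Sigma s ->
  (greenN N.+1 s = g s + off z s * next_mean s (greenN N))%E.
Proof.
move=> sS; rewrite /greenN big_nat_recl //=; congr (_ + _)%E.
transitivity (off z s * \sum_(0 <= n < N) next_mean s (taboo z g n))%E.
  by rewrite ge0_sume_distrr // => n _; apply: next_mean_ge0 => // *; exact: taboo_ge0.
congr (_ * _)%E; elim: N => [|N IH].
  rewrite big_geq // (_ : (fun s => _) = cst 0%E) ?next_mean_cst //.
  by apply/funext => t; rewrite big_geq.
rewrite big_nat_recr //= IH -next_meanD //.
- by apply: next_mean_eq => t tS; rewrite big_nat_recr.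
- by move=> t tS; apply: greenN_ge0.
- by move=> *; exact: taboo_ge0.
Qed.

Lemma green_le_bound s B : Sigma s -> (forall N, greenN N s <= B)%E ->
  (green s <= B)%E.
Proof.
move=> sS h; apply: lime_le; last by apply: nearW.
by apply: is_cvg_nneseries => n _ _; exact: taboo_ge0.
Qed.

End paths.

Lemma taboo_rv_avoid z g m n w : (forall k, (0 < k <= n)%N -> chain (m + k) w != z) ->
  taboo_rv z g m n w = g (chain (m + n).+1 w).
Proof.
elim: n m => [|n IH] m hn /=; first by rewrite addn0.
have := hn 1%N erefl; rewrite addn1 /off => ->; rewrite mul1e IH ?addSnnS //.
by move=> k /andP[k0 kn]; rewrite addSnnS; apply: hn.
Qed.

Lemma taboo_rv_hit z g m n w k : (0 < k <= n)%N -> chain (m + k) w = z ->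
  taboo_rv z g m n w = 0%E.
Proof.
elim: n m k => [|n IH] m [|k] //= kn hk.
have [e|ne] := eqVneq (chain m.+1 w) z; first by rewrite /off e eqxx mul0e.
rewrite (IH m.+1 k) ?mule0 //; last by rewrite addSnnS.
case: k kn hk => [_|k kn _ //]; rewrite addn1 => e.
by rewrite e eqxx in ne.
Qed.

Definition first_return m z k w :=
  chain (m + k.+1) w = z /\ forall l, (0 < l <= k)%N -> chain (m + l) w != z.

Lemma first_returnP m z w :
  (exists k, first_return m z k w) \/ (forall k, (0 < k)%N -> chain (m + k) w != z).
Proof.
have [[k h]|h] := pselect (exists k, chain (m + k.+1) w == z); last first.
  by right => -[//|k] _; apply/negP => e; apply: h; exists k.
left; have [k0 /eqP k0z k0min] := @ex_minnP (fun k => chain (m + k.+1) w == z)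
  (ex_intro _ k h).
exists k0; split=> // -[//|l] /= lk; apply/negP => /k0min.
by rewrite leqNgt lk.
Qed.

Lemma returns_series m z w :
  (\sum_(n <oo) taboo_rv z (single z) m n w)%E = (\1_(returns X eta m z) w)%:E.
Proof.
have s0 n : (0 <= taboo_rv z (single z) m n w)%E.
  by apply: taboo_rv_ge0 => s _; rewrite lee_fin.
case: (first_returnP m z w) => [[k [kz kmin]]|hno].
  rewrite indicE mem_set; last by exists k.+1.
  rewrite (@nneseriesD1 _ _ k) // eseries0 => [|n _ /= nk].
    by rewrite adde0 taboo_rv_avoid // /single -addnS kz eqxx.
  have := leqP k.+1 n; case=> [kn|nk'].
    by rewrite (@taboo_rv_hit _ _ _ _ _ k.+1).
  rewrite taboo_rv_avoid; last by move=> l /andP[l0 ln]; rewrite kmin // l0 (leq_trans ln).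
  rewrite /single -addnS; have := kmin n.+1; rewrite /= ltn_neqAle nk => h.
  by rewrite (negbTE (h _)).
rewrite eseries0 ?indicE => [|n _ _].
  rewrite memNset // => -[k k0 kz]; have := hno k k0.
  by rewrite [chain _ _]kz eqxx.
rewrite taboo_rv_avoid => [|k /andP[k0 _]]; last exact: hno.
by rewrite /single -addnS (negbTE (hno n.+1 _)).
Qed.

(** The events of a first return at a given time partition the event of a
    return. *)
Lemma returns_green m z : Sigma z -> (0 < P (at_ m z))%E ->
  (condP P (returns X eta m z) (at_ m z))%:E = next_mean z (green z (single z)).
Proof.
move=> zS p0; have mr : measurable (returns X eta m z).
  have -> : returns X eta m z =
      \bigcup_(k in [set k | (0 < k)%N]) at_ (m + k) z.
    by apply/seteqP; split=> w [k k0 hk]; exists k.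
  exact: bigcup_measurable.
have g0 s : Sigma s -> (0 <= single z s)%E by rewrite lee_fin.
have := integral_series_taboo_rv z g0 m zS.
have -> : (\int[P]_(w in at_ m z) \sum_(n <oo) taboo_rv z (single z) m n w)%E =
    P (returns X eta m z `&` at_ m z).
  by under eq_integral do rewrite returns_series; rewrite prob_integral_indic.
have pf : P (at_ m z) \is a fin_num by rewrite fin_num_measure.
rewrite setIC prob_condP // => h; apply/eqP; rewrite eq_le.
by apply/andP; split; rewrite -(lee_pmul2l pf p0) h.
Qed.

Lemma return_time_series m z w :
  return_time X eta m z w = (1 + \sum_(n <oo) taboo_rv z (off z) m n w)%E.
Proof.
have s0 n : (0 <= taboo_rv z (off z) m n w)%E.
  by apply: taboo_rv_ge0 => s _; exact: off_ge0.
rewrite /return_time; case: (first_returnP m z w) => [[k [kz kmin]]|hno].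
  have -> : (\sum_(n <oo) taboo_rv z (off z) m n w)%E = k%:R%:E.
    rewrite (nneseries_split 0 k) // add0n eseries0 ?adde0 => [|n kn _].
      rewrite big_nat (eq_bigr (fun=> 1%E)) => [|n /andP[_ nk]].
        by rewrite -big_nat sumEFin big_const_nat subn0 iter_addr_0.
      rewrite taboo_rv_avoid => [|l /andP[l0 ln]].
        by rewrite /off -addnS (kmin n.+1).
      by rewrite kmin // l0 (leq_trans ln) // ltnW.
    have [->|nk] := eqVneq n k.
      by rewrite taboo_rv_avoid // -addnS kz /off eqxx.
    by rewrite (@taboo_rv_hit _ _ _ _ _ k.+1) //= ltn_neqAle eq_sym nk.
  rewrite -EFinD nat1r; apply/eqP; rewrite eq_le; apply/andP; split.
    by apply: ereal_inf_lbound; exists k.+1.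
  apply: le_ereal_inf_tmp => _ [l [l0 lz] <-]; rewrite lee_fin ler_nat leqNgt.
  apply/negP; rewrite ltnS => lk; have := kmin l; rewrite l0 lk => /(_ erefl).
  by rewrite [chain _ _]lz eqxx.
have -> : [set k | (0 < k)%N /\ at_ (m + k) z w] = set0.
  apply/seteqP; split=> // k [k0 kz]; have := hno k k0.
  by rewrite [chain _ _]kz eqxx.
rewrite image_set0 ereal_inf0 (_ : (\sum_(n <oo) _)%E = +oo%E) //.
apply/eqyP => A A0; apply: le_trans (nneseries_lim_ge (Num.trunc A).+1 _) => //.
rewrite (eq_bigr (fun=> 1%E)) => [|n _].
  rewrite sumEFin big_const_nat subn0 iter_addr_0 lee_fin.
  by rewrite ltW // truncnS_gt.
rewrite taboo_rv_avoid => [|l /andP[l0 _]]; last exact: hno.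
by rewrite /off -addnS (hno n.+1).
Qed.

(** The mean of the return time is the sum over [n] of the probabilities that it
    exceeds [n]. *)
Lemma return_time_green m z : Sigma z -> (0 < P (at_ m z))%E ->
  condE P (return_time X eta m z) (at_ m z) = (1 + next_mean z (green z (off z)))%E.
Proof.
move=> zS p0; have g0 s : Sigma s -> (0 <= off z s)%E by move=> _; exact: off_ge0.
have s0 n w : (0 <= taboo_rv z (off z) m n w)%E by exact: taboo_rv_ge0.
rewrite /condE; under eq_integral do rewrite return_time_series.
rewrite ge0_integralD //; last 2 first.
- by move=> w _; apply: nneseries_ge0.
- apply: ge0_emeasurable_sum => [n w _ _|n _]; first exact: s0.
  exact: measurable_taboo_rv.
rewrite integral_series_taboo_rv // prob_integral_cst //.
have c0 : (0 <= next_mean z (green z (off z)))%E.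
  by apply: next_mean_ge0 => // *; exact: green_ge0.
rewrite muleC [(P _ * _)%E]muleC -ge0_muleDl //.
rewrite muleC -muleA fin_prob // -EFinM divff ?mule1 //.
by rewrite gt_eqF // fine_gt0 // p0 ltey_eq fin_num_measure.
Qed.

(** If no step leaves [C], the chain started in [C] almost surely stays there at
    every time, so irreducibility forces [C] to be everything. *)
Lemma absorbing_full (C : set (R * S)) s : Sigma s -> C s ->
  (forall c t, Sigma c -> C c -> Sigma t -> (0 < next_mean c (single t))%E -> C t) ->
  forall t, Sigma t -> C t.
Proof.
move=> sS Cs hstep t tS; have [_ _ _ _ hirr] := hC.
have [m [n [p0 pc]]] := hirr s t sS tS.
have mE k : measurable (at_ m s `&` chain (m + k) @^-1` (~` C)).
  by apply: measurableI => //; exact: measurable_chain.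
have null k : P (at_ m s `&` chain (m + k) @^-1` (~` C)) = 0%E.
  elim: k => [|k IH].
    rewrite addn0 (_ : _ `&` _ = set0) ?measure0 //.
    by apply/seteqP; split=> // w [hw /=]; rewrite [chain m w]hw; apply.
  rewrite (prob_split (m + k) (mE _)) eseries0 // => i _ _.
  set c := enum_state i; have [Cc|nCc] := pselect (C c); last first.
    apply: subset_measure0 IH => //; first exact: measurableI.
    by move=> w [[hw _] hc]; split=> //=; rewrite [chain _ w]hc.
  pose E := at_ (m + k) c `&` chain (m + k).+1 @^-1` (~` C).
  have mE' : measurable E by apply: measurableI => //; exact: measurable_chain.
  suff E0 : P E = 0%E.
    apply: subset_measure0 E0 => //; first exact: measurableI.
    by move=> w [[_ hw] hc]; split => //; move: hw; rewrite /= addnS.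
  rewrite (prob_split (m + k).+1 mE') eseries0 // => j _ _.
  have [Cj|nCj] := pselect (C (enum_state j)).
    rewrite (_ : _ `&` _ = set0) ?measure0 //.
    by apply/seteqP; split=> // w [[_ /= hw] hc]; apply: hw; rewrite [chain _ w]hc.
  have [_ _ /(_ (enum_state j))] := past_at (m + k) (enum_in i).
  have -> : next_mean (enum_state i) (single (enum_state j)) = 0%E.
    apply/eqP; rewrite eq_le next_mean_ge0 ?enum_in ?andbT //; last first.
      by move=> *; rewrite lee_fin.
    rewrite leNgt; apply/negP => h; apply: nCj.
    exact: (hstep _ _ (enum_in i) Cc (enum_in j) h).
  rewrite mule0 => h0; apply: subset_measure0 h0 => //; try exact: measurableI.
  by move=> w [[h1 _] h2].
apply: contrapT => nCt; move: pc; rewrite /condP.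
rewrite (_ : P (_ `&` _) = 0%E) ?mul0r ?ltxx //.
apply: subset_measure0 (null n) => //; first exact: measurableI.
by move=> w [h1 h2]; split=> //=; rewrite [chain _ w]h1.
Qed.

(** * Foster criteria by the minimum principle *)

Definition coercive (f : R * S -> R) :=
  forall c, finite_set (Sigma `&` [set s | f s <= c]).

Definition superharmonic_at (f : R * S -> R) s :=
  (next_mean s (fun t => (f t)%:E) <= (f s)%:E)%E.

Definition nonneg_on (f : R * S -> R) := forall s, Sigma s -> 0 <= f s.

Lemma next_mean_EFin_ge0 f s : nonneg_on f -> Sigma s -> (0 <= next_mean s (fun
  t => (f t)%:E))%E.
Proof. by move=> f0 sS; apply: next_mean_ge0 => // t tS; rewrite lee_fin f0. Qed.

(** A superharmonic function attaining its minimum also takes this value at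
    every possible next state, so irreducibility spreads it everywhere. *)
Lemma superharmonic_min f m : nonneg_on f -> Sigma m ->
  (forall s, Sigma s -> f m <= f s) ->
  (forall s, Sigma s -> f s = f m -> superharmonic_at f s) ->
  forall s, Sigma s -> f s = f m.
Proof.
move=> f0 mS fm hsup.
apply: (absorbing_full mS (C := fun s => f s = f m)) => //.
move=> c t cS fc tS ct; apply/eqP; rewrite eq_le fm // andbT leNgt.
apply/negP => ft.
have g0 s : Sigma s -> (0 <= (f s - f m)%:E)%E by move=> sS; rewrite lee_fin subr_ge0 fm.
have h1 := hsup c cS fc.
have h2 : (next_mean c (fun t => (f t)%:E) = next_mean c (fun t => (f t - f
  m)%:E) + (f m)%:E)%E.
  rewrite -[X in (_ + X)%E](next_mean_cst cS) -next_meanD //; last first.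
    by move=> *; rewrite lee_fin f0.
  by apply: next_mean_eq => s sS; rewrite -EFinD subrK.
have h3 : (next_mean c (fun t => (f t - f m)%:E) <= 0)%E.
  by move: h1; rewrite /superharmonic_at h2 fc -leeBrDr // subee.
have h4 := next_mean_single_le cS g0 tS.
have : (0 < (f t - f m)%:E * next_mean c (single t))%E by rewrite mule_gt0 //
  lte_fin subr_gt0.
by rewrite ltNge (le_trans h4 h3).
Qed.

(** Coercivity provides a minimum over the whole strip. If it were attained only
    off [A], the function would be superharmonic wherever it is minimal, hence
    constant. *)
Lemma min_principle f (A : set (R * S)) : nonneg_on f -> coercive f ->
  (Sigma `&` A) !=set0 ->
  (forall s, Sigma s -> ~ A s -> superharmonic_at f s) ->
  exists a, [/\ Sigma a, A a & forall s, Sigma s -> f a <= f s].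
Proof.
move=> f0 fc [s0 [s0S As0]] hsup.
have [m [mS mle] mmin] : exists2 m, (Sigma `&` [set s | f s <= f s0]) m &
    forall s, (Sigma `&` [set s | f s <= f s0]) s -> f m <= f s.
  by apply: finite_argmin; [exact: fc|exists s0; split => /=].
have gmin s : Sigma s -> f m <= f s.
  move=> sS; have [h|/ltW h] := leP (f s) (f s0); first exact: mmin.
  exact: le_trans h.
apply: contrapT => no.
have ftm : f s0 = f m.
  apply: (superharmonic_min f0 mS gmin) => // t tS ftm; apply: hsup => // At.
  by apply: no; exists t; split=> // s sS; rewrite ftm gmin.
by apply: no; exists s0; split=> // s sS; rewrite ftm gmin.
Qed.

Section HittingProbability.
Variable z : R * S.
Hypothesis zS : Sigma z.

Let u := green z (single z).

Let single0 s : Sigma s -> (0 <= single z s)%E.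
Proof. by rewrite lee_fin. Qed.

Lemma hitting_le1 s : Sigma s -> (u s <= 1)%E.
Proof.
move=> sS; apply: green_le_bound => // N; elim: N s sS => [|N IH] s sS.
  by rewrite /greenN big_geq.
rewrite greenN_rec // /single /off; case: eqP => [->|_] /=.
  by rewrite mul0e adde0.
rewrite add0e mul1e -(next_mean_cst sS 1%E).
by apply: next_mean_mono => // t tS; exact: greenN_ge0.
Qed.

Definition hitting s := fine (u s).

Lemma hittingE s : Sigma s -> u s = (hitting s)%:E.
Proof.
move=> sS; rewrite /hitting fineK // fin_numElt (le_lt_trans (hitting_le1 sS)) ?ltry //.
by rewrite (lt_le_trans ltNy0) // green_ge0.
Qed.

Lemma hitting_bounds s : Sigma s -> 0 <= hitting s <= 1.
Proof.
by move=> sS; rewrite -!lee_fin -hittingE // hitting_le1 // green_ge0.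
Qed.

Lemma hitting_at : hitting z = 1.
Proof. by rewrite /hitting /u green_stop // /single eqxx. Qed.

Lemma next_mean_hitting s : Sigma s -> s != z -> next_mean s u = (hitting s)%:E.
Proof.
by move=> sS sz; rewrite -hittingE // /u green_step // /single (negbTE sz) add0e.
Qed.

Lemma next_mean_hitting_le s : Sigma s -> (next_mean s u <= (hitting s)%:E)%E.
Proof.
move=> sS; have [->|/(next_mean_hitting sS) -> //] := eqVneq s z.
rewrite hitting_at -(next_mean_cst zS 1%E); apply: next_mean_mono => // t tS.
  exact: green_ge0.
exact: hitting_le1.
Qed.

Lemma next_mean_EFin_hitting s : Sigma s -> next_mean s (fun t => (hitting
  t)%:E) = next_mean s u.
Proof. by move=> sS; apply: next_mean_eq => t tS; rewrite hittingE. Qed.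

Lemma le_eps (a b c : R) : 0 <= c -> (forall eps, 0 < eps -> a <= b + eps * c) ->
  a <= b.
Proof.
move=> c0 h; rewrite leNgt; apply/negP => ba.
have e0 : 0 < (a - b) / 2 / (c + 1).
  by rewrite !divr_gt0 ?subr_gt0 // ltr_wpDl.
have := h _ e0; have : (a - b) / 2 / (c + 1) * c <= (a - b) / 2.
  rewrite -mulrA ger_pMr ?divr_gt0 ?subr_gt0 // mulrC ler_pdivrMr ?ltr_wpDl //.
  by rewrite mul1r lerDl.
lra.
Qed.

Lemma next_meanDr f g s : nonneg_on f -> nonneg_on g -> Sigma s ->
  (next_mean s (fun t => (f t + g t)%:E) =
   next_mean s (fun t => (f t)%:E) + next_mean s (fun t => (g t)%:E))%E.
Proof.
by move=> f0 g0 sS; rewrite -next_meanD // => t tS; rewrite lee_fin ?f0 ?g0.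
Qed.

Lemma next_meanZr (c : R) f s : 0 <= c -> nonneg_on f -> Sigma s ->
  (next_mean s (fun t => (c * f t)%:E) = c%:E * next_mean s (fun t => (f t)%:E))%E.
Proof.
by move=> c0 f0 sS; rewrite -next_meanZ // => t tS; rewrite lee_fin f0.
Qed.

(** The function [hitting + eps * f] is superharmonic off a finite set and
    coercive, so it is minimal there; letting [eps] vanish, [hitting] attains
    its minimum, hence is constant, equal to its value [1] at [z]. *)
Lemma hitting_eq1 (f : R * S -> R) (A : set (R * S)) : finite_set A ->
  nonneg_on f -> coercive f ->
  (forall s, Sigma s -> ~ A s -> superharmonic_at f s) ->
  forall s, Sigma s -> hitting s = 1.
Proof.
move=> fA f0 fc hsup.
have h0 : nonneg_on hitting by move=> s /hitting_bounds/andP[].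
pose F := A `|` [set z].
have fF : finite_set (Sigma `&` F).
  by apply: finite_setIr; rewrite finite_setU; split=> //; exact: finite_set1.
have [m [mS _] mmin] := finite_argmin hitting fF (ex_intro _ z (conj zS (or_intror erefl))).
have gmin s : Sigma s -> hitting m <= hitting s.
  move=> sS; apply: (@le_eps _ _ (f s)) => [|eps e0]; first exact: f0.
  have ef0 : nonneg_on (fun s => eps * f s) by move=> t tS; rewrite mulr_ge0 ?f0 // ltW.
  have [||||a [aS Fa amin]] := @min_principle (fun s => hitting s + eps * f s) F.
  - by move=> t tS; rewrite addr_ge0 ?h0 ?ef0.
  - move=> c; apply: sub_finite_set (fc (c / eps)) => t [tS /= tc]; split=> //=.
    rewrite ler_pdivlMr // mulrC (le_trans _ tc) // lerDr h0 //.
  - by exists z; split => //; right.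
  - move=> t tS nF; rewrite /superharmonic_at next_meanDr // next_meanZr ?(ltW e0) // EFinD.
    apply: leeD; first by rewrite next_mean_EFin_hitting // next_mean_hitting_le.
    rewrite EFinM lee_wpmul2l ?lee_fin ?(ltW e0) //; apply: hsup => // At.
    by apply: nF; left.
  - apply: le_trans (mmin a _) _ => //; apply: le_trans (amin s sS).
    by rewrite lerDl ef0.
have hm := superharmonic_min h0 mS gmin.
have hall : forall s, Sigma s -> hitting s = hitting m.
  by apply: hm => s sS _; rewrite /superharmonic_at next_mean_EFin_hitting //
    next_mean_hitting_le.
by move=> s sS; rewrite hall // -(hall z) // hitting_at.
Qed.

End HittingProbability.

(** A return to [z] is certain because [z] is almost surely hit from every
    successor of [z]. *)
Lemma foster_recurrent f (A : set (R * S)) : finite_set A ->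
  nonneg_on f -> coercive f ->
  (forall s, Sigma s -> ~ A s -> superharmonic_at f s) ->
  recurrent X eta Sigma.
Proof.
move=> fA f0 fc hsup z zS m p0; apply: EFin_inj.
rewrite returns_green // -(next_mean_cst zS 1%E); apply: next_mean_eq => t tS.
by rewrite hittingE // (hitting_eq1 zS fA f0 fc hsup).
Qed.

(** If the return to [z] were certain, then [z] would be hit with probability 1
    from everywhere, so a bounded positive superharmonic function could not fall
    below its value at [z]; but [f] vanishes at infinity. *)
Lemma foster_transient f (A : set (R * S)) : finite_set A ->
  (forall s, Sigma s -> 0 < f s) ->
  (forall c, 0 < c -> finite_set (Sigma `&` [set s | c <= f s])) ->
  (forall s, Sigma s -> ~ A s -> superharmonic_at f s) ->
  transient X eta Sigma.
Proof.
move=> fA f0 fv hsup z zS m p0; rewrite lt_neqAle; apply/andP; split; last first.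
  rewrite -lee_fin returns_green // -(next_mean_cst zS 1%E); apply:
    next_mean_mono => // t tS.
    by apply: green_ge0 => // s; rewrite lee_fin.
  exact: hitting_le1.
apply/negP => /eqP h1.
have Ez : next_mean z (fun t => (hitting z t)%:E) = 1%E.
  by rewrite next_mean_EFin_hitting // -(returns_green zS p0) h1.
have nh0 : nonneg_on (fun s => 1 - hitting z s).
  by move=> s /(hitting_bounds z)/andP[_]; rewrite subr_ge0.
have h0 : nonneg_on (hitting z) by move=> s /(hitting_bounds z)/andP[].
have Ec s : Sigma s -> (next_mean s (fun t => (1 - hitting z t)%:E) +
    next_mean s (fun t => (hitting z t)%:E) = 1)%E.
  move=> sS; rewrite -next_meanDr // -(next_mean_cst sS 1%E); apply: next_mean_eq => t _.
  by rewrite subrK.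
have hall s : Sigma s -> hitting z s = 1.
  move=> sS; apply/eqP; rewrite eq_sym -subr_eq0; apply/eqP.
  have -> : 0 = 1 - hitting z z by rewrite hitting_at // subrr.
  apply: (superharmonic_min nh0 zS) => // [t tS|t tS].
    by rewrite hitting_at // subrr nh0.
  rewrite hitting_at // subrr => ht.
  rewrite /superharmonic_at ht.
  have Et : next_mean t (fun t => (hitting z t)%:E) = 1%E.
    have [-> //|tz] := eqVneq t z.
    by rewrite next_mean_EFin_hitting // next_mean_hitting //; congr (_%:E); lra.
  have := Ec _ tS; rewrite Et; case: (next_mean t _) => [r||] //; rewrite -EFinD => -[h].
  by rewrite lee_fin; lra.
have [c c0 cA] : exists2 c, 0 < c & forall s, (Sigma `&` A) s -> c <= f s.
  by apply: finite_lower => [|s [sS _]]; [exact: finite_setIr|exact: f0].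
pose g s := Num.min (f s) c.
have g0 : nonneg_on g by move=> s sS; rewrite /g le_min !ltW // f0.
have gsup s : Sigma s -> superharmonic_at g s.
  move=> sS; rewrite /superharmonic_at /g.
  have hc : (next_mean s (fun t => (g t)%:E) <= c%:E)%E.
    rewrite -[leRHS](next_mean_cst sS); apply: next_mean_mono => // t tS;
      rewrite ?lee_fin ?g0 //.
    by rewrite /g ge_min lexx orbT.
  have [As|nAs] := pselect (A s); first by rewrite (min_r (cA _ _)).
  have hf : (next_mean s (fun t => (g t)%:E) <= (f s)%:E)%E.
    apply: le_trans (hsup _ sS nAs); apply: next_mean_mono => // t tS; rewrite
      ?lee_fin ?g0 //.
    by rewrite /g ge_min lexx.
  by have [_|_] := leP (f s) c.
have gz : 0 < g z by rewrite /g lt_min f0.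
have gN N s : Sigma s -> ((g z)%:E * greenN z (single z) N s <= (g s)%:E)%E.
  elim: N s => [|N IH] s sS; first by rewrite /greenN big_geq // mule0 lee_fin g0.
  have s0 t : Sigma t -> (0 <= single z t)%E by rewrite lee_fin.
  rewrite greenN_rec // /single /off; case: eqP => [->|_].
    by rewrite mul0e adde0 mule1.
  rewrite add0e mul1e; apply: le_trans (gsup s sS); rewrite -next_meanZ //; last first.
  - by move=> t tS; apply: greenN_ge0.
  - by rewrite lee_fin ltW.
  apply: next_mean_mono => // t tS.
  by rewrite mule_ge0 ?lee_fin ?(ltW gz) // greenN_ge0.
have gle s : Sigma s -> g z <= g s.
  move=> sS; have s0 t : Sigma t -> (0 <= single z t)%E by rewrite lee_fin.
  have : (green z (single z) s <= (g s / g z)%:E)%E.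
    apply: green_le_bound => // N; rewrite EFinM lee_pdivlMr // muleC; exact: gN.
  by rewrite (hittingE z) // hall // lee_fin ler_pdivlMr // mul1r.
apply: infinite_strip; apply: sub_finite_set (fv _ gz) => s sS; split=> //=.
by apply: le_trans (gle s sS) _; rewrite /g ge_min lexx.
Qed.

Section ReturnTime.
Variable z : R * S.
Hypothesis zS : Sigma z.

Let off0 s : Sigma s -> (0 <= off z s)%E.
Proof. by move=> _; exact: off_ge0. Qed.

(** [avoid n s] is the probability that the chain started at [s] avoids [z]
    up to time [n]. *)
Let avoid n s := taboo z (off z) n s.

Let avoid_le1 n s : Sigma s -> (avoid n s <= 1)%E.
Proof.
rewrite /avoid; elim: n s => [|n IH] s sS /=.
  by rewrite /off lee_fin lern1 leq_b1.
apply: (@le_trans _ _ (next_mean s (taboo z (off z) n))).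
  rewrite /off; case: (s != z); rewrite ?mul1e ?mul0e // next_mean_ge0 // => t tS.
  exact: taboo_ge0.
rewrite -[leRHS](next_mean_cst sS).
by apply: next_mean_mono => // t tS; first [exact: taboo_ge0 | exact: IH].
Qed.

Let avoid_decr n s : Sigma s -> (avoid n.+1 s <= avoid n s)%E.
Proof.
rewrite /avoid; elim: n s => [|n IH] s sS.
  rewrite /= -[leRHS]mule1 lee_wpmul2l ?off_ge0 // -(next_mean_cst sS 1%E).
  by apply: next_mean_mono => // t tS; first [exact: off_ge0|rewrite /off
    lee_fin lern1 leq_b1].
have tabooS k t : taboo z (off z) k.+1 t = (off z t * next_mean t (taboo z (off
  z) k))%E by [].
rewrite [leLHS]tabooS [leRHS]tabooS lee_wpmul2l ?off_ge0 //.
by apply: next_mean_mono => // t tS; first [exact: taboo_ge0 | exact: IH].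
Qed.

Let avoid_fin n s : Sigma s -> avoid n s = (fine (avoid n s))%:E.
Proof.
move=> sS; rewrite fineK // fin_numElt (le_lt_trans (avoid_le1 n sS)) ?ltry //.
by rewrite (lt_le_trans ltNy0) // taboo_ge0.
Qed.

(** The states from which [z] is avoided almost surely at all times form an
    absorbing set that does not contain [z], hence an empty set. *)
Lemma avoid_lt1 s : Sigma s -> exists n, (avoid n s < 1)%E.
Proof.
move=> sS; apply: contrapT => no.
have s1 n : avoid n s = 1%E.
  apply/eqP; rewrite eq_le avoid_le1 // leNgt /=; apply/negP => h.
  by apply: no; exists n.
have hz := @absorbing_full (fun s => forall n, avoid n s = 1%E) s sS s1.
have : forall n, avoid n z = 1%E.
  apply: hz => // c t cS hc tS ct n; apply/eqP; rewrite eq_le avoid_le1 //=.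
  rewrite leNgt; apply/negP => lt1.
  have cz : (off z c = 1)%E by exact: (hc 0%N).
  have e1 : next_mean c (avoid n) = 1%E by have := hc n.+1; rewrite /avoid /= cz mul1e.
  have e2 : (next_mean c (fun t => 1 - avoid n t) + next_mean c (avoid n) = 1)%E.
    rewrite -next_meanD //.
    - rewrite -[RHS](next_mean_cst cS); apply: next_mean_eq => t' t'S.
      by rewrite avoid_fin // -EFinB -EFinD subrK.
    - by move=> t' t'S; rewrite sube_ge0 ?avoid_le1 // avoid_fin.
    - by move=> t' t'S; exact: taboo_ge0.
  have e3 : (next_mean c (fun t => 1 - avoid n t) <= 0)%E.
    by move: e2; rewrite e1; case: (next_mean c _) => [r||] //; rewrite -EFinD => -[h];
      rewrite lee_fin; lra.
  have := @next_mean_single_le c cS (fun t => 1 - avoid n t)%E t _ tS.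
  have h0 t' : Sigma t' -> (0 <= 1 - avoid n t')%E.
    by move=> t'S; rewrite sube_ge0 ?avoid_le1 // avoid_fin.
  move=> /(_ h0)/le_trans/(_ e3); rewrite leNgt => /negP; apply.
  by rewrite mule_gt0 // sube_gt0.
by move=> /(_ 0%N); rewrite /avoid /= /off eqxx => -[] /eqP; rewrite eq_sym oner_eq0.
Qed.

Lemma avoid_uniform (A : set (R * S)) : finite_set A ->
  exists n, exists2 c, 0 < c & forall s, (Sigma `&` A) s ->
    (avoid n s <= (1 - c)%:E)%E.
Proof.
move=> fA.
have [n hn] : exists n, forall s, (Sigma `&` A) s -> (avoid n s < 1)%E.
  pose N s := xget 0%N [set n | (avoid n s < 1)%E].
  have [M hM] := finite_bound (fun s => (N s)%:R : R) (finite_setIr Sigma fA).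
  exists (Num.trunc M) => s sA; have [sS _] := sA.
  have : (avoid (N s) s < 1)%E.
    by rewrite /N; case: xgetP => [m -> //|no]; have [m hm] := avoid_lt1 sS; case: (no m).
  apply: le_lt_trans.
  have : (N s <= Num.trunc M)%N by rewrite truncn_ge_nat ?hM // (le_trans _ (hM _ sA)).
  elim: (Num.trunc M) => [|k IH]; first by rewrite leqn0 => /eqP ->.
  rewrite leq_eqVlt => /predU1P [-> //|/IH]; apply: le_trans; exact: avoid_decr.
have [c c0 hc] : exists2 c, 0 < c &
    forall s, (Sigma `&` A) s -> c <= 1 - fine (avoid n s).
  apply: finite_lower; first exact: finite_setIr.
  by move=> s sA; rewrite subr_gt0 -lte_fin -avoid_fin ?hn //; case: sA.
exists n, c => // s sA; rewrite avoid_fin ?lee_fin; last by case: sA.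
by have := hc s sA; lra.
Qed.

(** The drift of [f] is only known to be negative off [A]. The mean hitting time
    of [z] truncated at [n], that is [greenN z (off z) n], decreases in one step
    by the probability of hitting [z] before time [n], which is bounded below on
    [A]; a large multiple of it, added to [f], corrects the drift on [A]. *)
Lemma foster_return_time f (A : set (R * S)) (eps : R) : finite_set A -> 0 < eps ->
  nonneg_on f ->
  (forall s, Sigma s -> ~ A s ->
     (next_mean s (fun t => (f t)%:E) <= (f s - eps)%:E)%E) ->
  (forall s, Sigma s -> A s -> (next_mean s (fun t => (f t)%:E) < +oo)%E) ->
  (next_mean z (green z (off z)) < +oo)%E.
Proof.
move=> fA e0 f0 hoff hon.
have [n [c c0 hc]] := avoid_uniform fA.
have fin s : Sigma s -> exists2 r : R, 0 <= r & next_mean s (fun t => (f t)%:E) = r%:E.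
  move=> sS; have h1 := next_mean_EFin_ge0 f0 sS.
  have h2 : (next_mean s (fun t => (f t)%:E) < +oo)%E.
    have [As|nAs] := pselect (A s); first exact: hon.
    by apply: le_lt_trans (hoff s sS nAs) _; rewrite ltry.
  by case: (next_mean s _) h1 h2 => [r||] // r0 _; exists r.
pose G s := fine (greenN z (off z) n s).
have Gfin s : Sigma s -> greenN z (off z) n s = (G s)%:E.
  move=> sS; rewrite /G fineK // /greenN.
  by apply/sum_fin_numP => i _ _; rewrite -/(avoid i s) avoid_fin.
have G0 : nonneg_on G.
  by move=> s sS; rewrite -lee_fin -Gfin // greenN_ge0.
have ExG s : Sigma s -> s != z ->
    next_mean s (fun t => (G t)%:E) = (G s - (1 - fine (avoid n s)))%:E.
  move=> sS sz; have -> : next_mean s (fun t => (G t)%:E) = next_mean s (greenN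
    z (off z) n).
    by apply: next_mean_eq => t tS; rewrite Gfin.
  have := greenN_rec z off0 n sS; rewrite {1}/greenN big_nat_recr //=.
  rewrite -/(greenN z (off z) n s) -/(avoid n s) Gfin // avoid_fin // /off sz mul1e.
  case: (next_mean s _) => [r||] //; rewrite -!EFinD => -[h]; congr (_%:E); lra.
have [B hB] := finite_bound (fun s => fine (next_mean s (fun t => (f t)%:E)))
  (finite_setIr Sigma fA).
pose B' := Num.max B 0.
pose beta := (1 + B' / eps) / c.
have B'0 : 0 <= B' by rewrite /B' le_max lexx orbT.
have beta0 : 0 <= beta by rewrite /beta divr_ge0 ?addr_ge0 ?divr_ge0 // ltW.
pose H s := eps^-1 * f s + beta * G s.
have ef0 : nonneg_on (fun s => eps^-1 * f s).
  by move=> s sS; rewrite mulr_ge0 ?f0 // invr_ge0 ltW.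
have bG0 : nonneg_on (fun s => beta * G s) by move=> s sS; rewrite mulr_ge0 ?G0.
have H0 : nonneg_on H by move=> s sS; rewrite addr_ge0 ?ef0 ?bG0.
have ei0 : 0 <= eps^-1 by rewrite invr_ge0 ltW.
have ExH s : Sigma s -> next_mean s (fun t => (H t)%:E) =
    (eps^-1%:E * next_mean s (fun t => (f t)%:E) + beta%:E * next_mean s (fun t
      => (G t)%:E))%E.
  by move=> sS; rewrite next_meanDr // !next_meanZr.
have Hstep s : Sigma s -> s != z -> (1 + next_mean s (fun t => (H t)%:E) <= (H s)%:E)%E.
  move=> sS sz; rewrite ExH // ExG //; have [r r0 Er] := fin s sS.
  rewrite Er -!EFinM -!EFinD lee_fin /H.
  have a1 : fine (avoid n s) <= 1 by rewrite -lee_fin -avoid_fin ?avoid_le1.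
  have [As|nAs] := pselect (A s).
    have := hc s (conj sS As); rewrite avoid_fin // lee_fin => ac.
    have rB : r <= B'.
      by have := hB s (conj sS As); rewrite Er /= /B' le_max => ->.
    have h1 : 1 + B' / eps <= beta * (1 - fine (avoid n s)).
      rewrite -(@divfK _ c _ (1 + B' / eps)) ?gt_eqF // -/beta ler_wpM2l //; lra.
    have h2 : eps^-1 * r <= B' / eps by rewrite mulrC ler_wpM2r.
    have h3 : 0 <= eps^-1 * f s by exact: ef0.
    rewrite mulrBr; lra.
  have := hoff s sS nAs; rewrite Er lee_fin => rf.
  have h2 : eps^-1 * r <= eps^-1 * f s - 1.
    by rewrite -(@mulVf _ eps) ?gt_eqF // -mulrBr ler_wpM2l.
  have h3 : 0 <= beta * (1 - fine (avoid n s)) by rewrite mulr_ge0 // subr_ge0.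
  rewrite mulrBr; lra.
have gH N s : Sigma s -> (greenN z (off z) N s <= (H s)%:E)%E.
  elim: N s => [|N IH] s sS; first by rewrite /greenN big_geq // lee_fin H0.
  rewrite greenN_rec // {1}/off {1}/off; case: eqP => [->|/eqP sz] /=.
    by rewrite mul0e adde0 lee_fin H0.
  rewrite mul1e; apply: le_trans (Hstep s sS sz); rewrite leeD2l //.
  by apply: next_mean_mono => // t tS; first [exact: greenN_ge0 | exact: IH].
have ExHz : (next_mean z (fun t => (H t)%:E) < +oo)%E.
  rewrite ExH //; have [r r0 ->] := fin z zS.
  have GM t : Sigma t -> (G t <= n%:R).
    move=> tS; rewrite -lee_fin -Gfin // /greenN.
    apply: le_trans (_ : (\sum_(0 <= i < n) 1 <= _)%E).
      by apply: lee_sum => i _; exact: avoid_le1.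
    by rewrite sumEFin big_const_nat subn0 iter_addr_0.
  have : (next_mean z (fun t => (G t)%:E) <= n%:R%:E)%E.
    rewrite -[leRHS](next_mean_cst zS).
    by apply: next_mean_mono => // t tS; rewrite lee_fin; first [exact: G0|exact: GM].
  have := next_mean_EFin_ge0 G0 zS.
  by case: (next_mean z _) => [r'||] // _ _; rewrite -!EFinM -EFinD ltry.
apply: le_lt_trans ExHz; apply: next_mean_mono => // t tS; first exact: green_ge0.
by apply: green_le_bound => // N; exact: gH.
Qed.

(** If the mean return time were finite, the mean hitting time [W] of [z] would
    be finite everywhere and [delta * (h + C * W) - f] superharmonic off a
    finite set; the minimum principle then bounds [f]. *)
Lemma foster_infinite_return_time f h (A : set (R * S)) (C : R) :
  finite_set A -> nonneg_on f -> nonneg_on h -> 0 <= C -> coercive f ->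
  (forall delta, 0 < delta -> exists M, forall s, Sigma s ->
     f s <= delta * h s + M) ->
  (forall s, Sigma s -> ~ A s -> ((f s)%:E <= next_mean s (fun t => (f t)%:E))%E) ->
  (forall s, Sigma s -> ~ A s ->
     (next_mean s (fun t => (h t)%:E) <= (h s + C)%:E)%E) ->
  next_mean z (green z (off z)) = +oo%E.
Proof.
move=> fA f0 h0 C0 fc fh fsub hsup.
apply: contrapT => /eqP; rewrite -ltey => zfin.
pose w := green z (off z).
have w_ge0 s : Sigma s -> (0 <= w s)%E by move=> sS; exact: green_ge0.
have wfin : forall s, Sigma s -> (w s < +oo)%E.
  apply: (@absorbing_full (fun s => (w s < +oo)%E) z) => //.
    by rewrite /w green_stop // ltry.
  move=> c t cS wc tS ct.
  have Ec : (next_mean c w < +oo)%E.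
    have [-> //|cz] := eqVneq c z.
    apply: le_lt_trans wc; rewrite /w [leRHS]green_step // leeDr ?off_ge0 //.
  have : (w t * next_mean c (single t) <= next_mean c w)%E by exact: next_mean_single_le.
  move=> /le_lt_trans/(_ Ec) wt; rewrite ltey; apply/eqP => wy.
  by move: wt; rewrite wy gt0_mulye // ltxx.
pose W s := fine (w s).
have WE s : Sigma s -> w s = (W s)%:E.
  move=> sS; rewrite /W fineK // fin_numElt wfin // andbT.
  by rewrite (lt_le_trans ltNy0) // w_ge0.
have W0 : nonneg_on W by move=> s sS; rewrite -lee_fin -WE // w_ge0.
have ExW s : Sigma s -> s != z -> next_mean s (fun t => (W t)%:E) = (W s - 1)%:E.
  move=> sS sz; have -> : next_mean s (fun t => (W t)%:E) = next_mean s w.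
    by apply: next_mean_eq => t tS; rewrite WE.
  have := green_step off0 sS sz; rewrite -/w WE // {1}/off sz.
  by case: (next_mean s _) => [r||] //; rewrite -EFinD => -[->]; congr (_%:E); lra.
pose F := A `|` [set z].
have fF : finite_set F by rewrite finite_setU; split=> //; exact: finite_set1.
have [B hB] := finite_bound f fF.
have fB s : Sigma s -> f s <= B.
  move=> sS; apply: (@le_eps _ _ (h s + C * W s)) => [|delta d0].
    by rewrite addr_ge0 ?h0 // mulr_ge0 ?W0.
  have d20 : 0 < delta / 2 by rewrite divr_gt0.
  have [M hM] := fh _ d20; have [M1 hM1] := fh 1 ltr01.
  pose M' := Num.max M 0.
  have M'0 : 0 <= M' by rewrite /M' le_max lexx orbT.
  have hM' t : Sigma t -> f t <= delta / 2 * h t + M'.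
    by move=> tS; apply: le_trans (hM t tS) _; rewrite lerD2l /M' le_max lexx.
  pose psi t := delta * (h t + C * W t) + M'.
  have CW0 : nonneg_on (fun t => C * W t) by move=> t tS; rewrite mulr_ge0 ?W0.
  have hCW0 : nonneg_on (fun t => h t + C * W t).
    by move=> t tS; rewrite addr_ge0 ?h0 ?CW0.
  have dh0 : nonneg_on (fun t => delta * (h t + C * W t)).
    by move=> t tS; rewrite mulr_ge0 ?hCW0 // ltW.
  have M'n : nonneg_on (fun=> M') by [].
  pose phi t := psi t - f t.
  have phi_ge t : Sigma t -> delta / 2 * h t <= phi t.
    move=> tS; have := hM' t tS; have := CW0 t tS; rewrite /phi /psi mulrDr => a1 a2.
    have := mulr_ge0 (ltW d0) a1; lra.
  have phi0 : nonneg_on phi.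
    by move=> t tS; apply: le_trans (phi_ge t tS); rewrite mulr_ge0 ?h0 // ltW.
  have [|||a [aS Fa amin]] := @min_principle phi F phi0.
  - move=> c; apply: sub_finite_set (fc (c / (delta / 2) + M1)) => t [tS /= tc].
    split=> //=; apply: le_trans (hM1 t tS) _; rewrite mul1r lerD2r.
    by rewrite ler_pdivlMr // mulrC (le_trans (phi_ge t tS)).
  - by exists z; split => //; right.
  - move=> t tS nF; have nA : ~ A t by move=> At; apply: nF; left.
    have tz : t != z by apply/eqP => tz; apply: nF; right.
    have e1 : (next_mean t (fun t => (phi t)%:E) + next_mean t (fun t => (f t)%:E) <=
        (psi t)%:E)%E.
      rewrite -next_meanDr // (_ : next_mean t _ = next_mean t (fun t => (psi
        t)%:E)); last first.
        by apply: next_mean_eq => t' _; rewrite /phi subrK.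
      rewrite /psi next_meanDr // next_meanZr ?(ltW d0) // next_meanDr //
        next_meanZr // ExW // next_mean_cst //.
      rewrite [leRHS]EFinD leeD2r // EFinM lee_wpmul2l ?lee_fin ?(ltW d0) //.
      apply: le_trans (leeD2r _ (hsup t tS nA)) _.
      by rewrite -EFinM -EFinD lee_fin; lra.
    have e2 := fsub t tS nA; have e3 := next_mean_EFin_ge0 phi0 tS.
    have e4 := next_mean_EFin_ge0 f0 tS.
    rewrite /superharmonic_at; move: e1 e2 e3 e4; rewrite /phi.
    case: (next_mean t _) => [r1||] //; case: (next_mean t _) => [r2||] //.
    by rewrite -EFinD !lee_fin => *; lra.
  - have := amin s sS; have := phi_ge a aS; rewrite /phi /psi => a1 a2.
    have := hB a Fa; have := dh0 a aS; lra.
apply: infinite_strip; apply: sub_finite_set (fc B) => s sS; split=> //=.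
exact: fB.
Qed.

End ReturnTime.

Lemma foster_positive f (A : set (R * S)) (eps : R) : finite_set A -> 0 < eps ->
  nonneg_on f -> coercive f ->
  (forall s, Sigma s -> ~ A s ->
     (next_mean s (fun t => (f t)%:E) <= (f s - eps)%:E)%E) ->
  (forall s, Sigma s -> A s -> (next_mean s (fun t => (f t)%:E) < +oo)%E) ->
  positive_recurrent X eta Sigma.
Proof.
move=> fA e0 f0 fc hoff hon; split.
  apply: (foster_recurrent fA f0 fc) => s sS nA.
  by apply: le_trans (hoff s sS nA) _; rewrite lee_fin lerBlDr lerDl ltW.
move=> z zS m p0; rewrite return_time_green //.
by rewrite lte_add_pinfty ?ltry //; apply: foster_return_time fA e0 f0 hoff hon.
Qed.

Lemma foster_null f h (A : set (R * S)) (C : R) : finite_set A ->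
  nonneg_on f -> nonneg_on h -> 0 <= C -> coercive f ->
  (forall delta, 0 < delta -> exists M, forall s, Sigma s ->
     f s <= delta * h s + M) ->
  (forall s, Sigma s -> ~ A s -> ((f s)%:E <= next_mean s (fun t => (f t)%:E))%E) ->
  (forall s, Sigma s -> ~ A s ->
     (next_mean s (fun t => (h t)%:E) <= (h s + C)%:E)%E) ->
  recurrent X eta Sigma -> null_recurrent X eta Sigma.
Proof.
move=> fA f0 h0 C0 fc fh fsub hsup hr; split => // z zS m p0.
by rewrite return_time_green // (foster_infinite_return_time zS fA f0 h0 C0 fc
  fh fsub hsup).
Qed.

End OneStep.

(** * Moments of the jumps and drift of test functions *)

Section Increments.
Context {d : measure_display} {T : measurableType d} {R : realType}.
Context {S : finType}.
Variables (P : probability T R) (X : nat -> {RV P >-> R}) (eta : nat -> T -> S).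
Variable Sigma : set (R * S).
Hypothesis S_gt0 : (0 < #|S|)%N.
Hypothesis hS : half_strip Sigma.
Hypothesis hC : homogeneous_irreducible_chain X eta Sigma.
Variables (p Cp : R).
Hypothesis p_gt2 : 2 < p.
Hypothesis hmom : forall (n : nat) (x : R) (i : S), Sigma (x, i) ->
  (0 < P (at_state X eta n (x, i)))%E ->
  (condE P (fun w => (`|incr X n w| `^ p)%:E) (at_state X eta n (x, i))
     <= Cp%:E)%E.
Local Notation tm := (start_time X eta).
Local Notation B := (fun s => at_state X eta (tm s) s).
Local Notation chain := (chain X eta).

Definition cond_mean (s : R * S) (f : T -> R) : R :=
  fine (condE P (fun w => (f w)%:E) (B s)).

Definition dominated (s : R * S) (f : T -> R) :=
  measurable_fun (B s) f /\
  exists K, forall w, B s w -> `|f w| <= K * (1 + `|incr X (tm s) w| `^ p).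

Lemma measurable_B s : measurable (B s).
Proof. exact: (measurable_at hC). Qed.
Hint Resolve measurable_B : core.

Lemma measurable_incr n D : measurable_fun D (incr X n).
Proof.
apply: (@measurable_funS _ _ _ _ setT) => //.
exact: (measurable_funB (measurable_funP (X n.+1)) (measurable_funP (X n))).
Qed.

Section fixed_state.
Variable s : R * S.
Hypothesis sS : Sigma s.

Lemma PB_gt0 : 0 < fine (P (B s)).
Proof. exact: (w0_gt0 hC sS). Qed.

Lemma moment_le : (\int[P]_(w in B s) (`|incr X (tm s) w| `^ p)%:E
  <= (Cp * fine (P (B s)))%:E)%E.
Proof.
case: s sS PB_gt0 => x i sS' PB; have := hmom sS' (start_timeP hC sS').
by rewrite /condE -lee_pdivlMr ?invr_gt0 // -EFinM invrK.
Qed.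

Lemma measurable_moment D :
  measurable_fun D (fun w => `|incr X (tm s) w| `^ p).
Proof.
apply: (measurableT_comp (measurable_powR p)).
by apply: measurableT_comp => //; exact: measurable_incr.
Qed.

Lemma integrable_weight :
  P.-integrable (B s) (fun w => (1 + `|incr X (tm s) w| `^ p)%:E).
Proof.
rewrite (_ : (fun w => _) = (EFin \o cst 1) \+ (fun w => (`|incr X (tm s) w| `^ p)%:E)) //.
apply: integrableD => //.
  exact: finite_measure_integrable_cst.
apply/integrableP; split; first by apply/measurable_EFinP; exact: measurable_moment.
apply: le_lt_trans (ltry (Cp * fine (P (B s)))).
apply: le_trans moment_le; rewrite le_eqVlt; apply/orP; left; apply/eqP.
by apply: eq_integral => w _; rewrite abse_EFin ger0_norm // powR_ge0.
Qed.

Lemma dominated_integrable f : dominated s f -> P.-integrable (B s) (EFin \o f).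
Proof.
move=> [mf [K hK]].
apply: (@le_integrable _ _ _ _ _ _ _
  (fun w => (K%:E * (1 + `|incr X (tm s) w| `^ p)%:E)%E)) => //.
- exact/measurable_EFinP.
- move=> w Bw; rewrite /= lee_fin; apply: le_trans (hK w Bw) _; exact: ler_norm.
- exact: integrableZl integrable_weight.
Qed.

Lemma cond_mean_Rintegral f : dominated s f ->
  cond_mean s f = (\int[P]_(w in B s) f w)%R / fine (P (B s)).
Proof.
move=> /dominated_integrable h; rewrite /cond_mean /condE fineM //.
exact: integrable_fin_num.
Qed.

Lemma dominated_cst c : dominated s (fun=> c).
Proof.
split=> //; exists `|c| => w _; by rewrite ler_peMr // lerDl powR_ge0.
Qed.

Lemma dominatedD f g : dominated s f -> dominated s g ->
  dominated s (fun w => f w + g w).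
Proof.
move=> [mf [K hK]] [mg [L hL]]; split; first exact: measurable_funD.
exists (K + L) => w Bw; apply: le_trans (ler_normD _ _) _.
by rewrite mulrDl lerD ?hK ?hL.
Qed.

Lemma dominatedZ c f : dominated s f -> dominated s (fun w => c * f w).
Proof.
move=> [mf [K hK]]; split; first exact: measurable_funM.
exists (`|c| * K) => w Bw; by rewrite normrM -mulrA ler_wpM2l // hK //.
Qed.

Lemma dominated_le (f g : T -> R) : measurable_fun (B s) f -> dominated s g ->
  (forall w, B s w -> `|f w| <= g w) -> dominated s f.
Proof.
move=> mf [mg [K hK]] fg; split=> //; exists K => w Bw.
by apply: le_trans (hK w Bw); apply: le_trans (fg w Bw) (ler_norm _).
Qed.

Lemma dominated_sum (I : finType) (c : I -> R) (f : I -> T -> R) :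
  (forall i, dominated s (f i)) ->
  dominated s (fun w => \sum_i c i * f i w).
Proof.
move=> hf.
suff H l : dominated s (fun w => \sum_(i <- l) c i * f i w) by exact: H.
elim: l => [|i l IH].
  have -> : (fun w => \sum_(i <- [::]) c i * f i w) = fun=> 0.
    by apply/funext => w; rewrite big_nil.
  exact: dominated_cst.
have -> : (fun w => \sum_(i0 <- i :: l) c i0 * f i0 w) =
    fun w => c i * f i w + \sum_(i <- l) c i * f i w.
  by apply/funext => w; rewrite big_cons.
by apply: dominatedD => //; exact: dominatedZ.
Qed.

Lemma cond_mean_cst c : cond_mean s (fun=> c) = c.
Proof.
rewrite cond_mean_Rintegral; last exact: dominated_cst.
by rewrite Rintegral_cst // mulfK // gt_eqF // PB_gt0.
Qed.

Lemma cond_meanD f g : dominated s f -> dominated s g ->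
  cond_mean s (fun w => f w + g w) = cond_mean s f + cond_mean s g.
Proof.
move=> hf hg; rewrite !cond_mean_Rintegral //; last exact: dominatedD.
by rewrite RintegralD ?mulrDl //; exact: dominated_integrable.
Qed.

Lemma cond_meanZ c f : dominated s f -> cond_mean s (fun w => c * f w) = c * cond_mean s f.
Proof.
move=> hf; rewrite !cond_mean_Rintegral //; last exact: dominatedZ.
by rewrite RintegralZl ?mulrA //; exact: dominated_integrable.
Qed.

Lemma cond_mean_sum (I : finType) (c : I -> R) (f : I -> T -> R) :
  (forall i, dominated s (f i)) ->
  cond_mean s (fun w => \sum_i c i * f i w) = \sum_i c i * cond_mean s (f i).
Proof.
move=> hf.
suff H l : dominated s (fun w => \sum_(i <- l) c i * f i w) /\
    cond_mean s (fun w => \sum_(i <- l) c i * f i w) = \sum_(i <- l) c i *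
      cond_mean s (f i).
  by have [] := H (index_enum I).
elim: l => [|i l [IH1 IH2]].
  have -> : (fun w => \sum_(i <- [::]) c i * f i w) = fun=> 0.
    by apply/funext => w; rewrite big_nil.
  by split; [exact: dominated_cst|rewrite cond_mean_cst big_nil].
have -> : (fun w => \sum_(i0 <- i :: l) c i0 * f i0 w) =
    fun w => c i * f i w + \sum_(i <- l) c i * f i w.
  by apply/funext => w; rewrite big_cons.
have hi := dominatedZ (c i) (hf i).
by split; [exact: dominatedD|rewrite cond_meanD // cond_meanZ // IH2 big_cons].
Qed.

Lemma cond_mean_le f g : dominated s f -> dominated s g ->
  (forall w, B s w -> f w <= g w) -> cond_mean s f <= cond_mean s g.
Proof.
move=> hf hg fg; rewrite !cond_mean_Rintegral // ler_wpM2r ?invr_ge0 ?(ltW PB_gt0) //.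
by apply: le_Rintegral => //; exact: dominated_integrable.
Qed.

Lemma cond_mean_eq f g : (forall w, B s w -> f w = g w) -> cond_mean s f = cond_mean s g.
Proof.
move=> fg; rewrite /cond_mean /condE; congr (fine (_ * _)%E).
by apply: eq_integral => w; rewrite inE => /fg ->.
Qed.

Lemma cond_mean_norm_le f g : dominated s f -> dominated s g ->
  (forall w, B s w -> `|f w| <= g w) -> `|cond_mean s f| <= cond_mean s g.
Proof.
move=> hf hg fg; rewrite ler_norml; apply/andP; split; last first.
  by apply: cond_mean_le => // w Bw; apply: le_trans (ler_norm _) (fg w Bw).
rewrite -mulN1r -cond_meanZ //; apply: cond_mean_le => //; first exact: dominatedZ.
by move=> w Bw; rewrite mulN1r lerNl (le_trans (ler_norm _)) // normrN fg.
Qed.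

Lemma next_mean_cond_mean (F : R * S -> R) : dominated s (fun w => F (chain (tm s).+1 w)) ->
  next_mean X eta s (fun t => (F t)%:E) = (cond_mean s (fun w => F (chain (tm s).+1 w)))%:E.
Proof.
move=> hF; rewrite /cond_mean /next_mean fineK // /condE fin_numM //.
by apply: integrable_fin_num => //; exact: dominated_integrable.
Qed.

Lemma measurable_next (F : R * S -> R) D : measurable D ->
  measurable_fun D (fun w => F (chain (tm s).+1 w)).
Proof. exact: (@measurable_comp_chain _ _ _ _ _ _ _ _ S_gt0 hS hC _ _ _ _ F). Qed.

End fixed_state.

Variables (q : S -> S -> R -> R) (mu sigma2 : S -> R -> R) (muj : S -> S -> R -> R).
Hypothesis hq : forall i j,
  is_condP X eta (fun n => [set w | eta n.+1 w = j]) i (q i j).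
Hypothesis hmu : forall i, is_condE X eta (incr X) i (mu i).
Hypothesis hsigma : forall i,
  is_condE X eta (fun n w => incr X n w ^+ 2) i (sigma2 i).
Hypothesis hmuj : forall i j, is_condE X eta
  (fun n w => incr X n w * (eta n.+1 w == j)%:R) i (muj i j).
Variables (a : S -> R) (K0 : R).
Hypothesis aK : forall i, 1 <= a i + K0.

(** The equation for [a] cancels the leading drift of this quantity, and [K0]
    keeps it above [1], where the powers are smooth. *)
Definition height (s : R * S) : R := s.1 + (a s.2 + K0).

Definition jump s w : R := height (chain (tm s).+1 w) - height s.

Lemma height_ge1 s : Sigma s -> 1 <= height s.
Proof.
have [h0 _ _] := hS => /h0 x0; rewrite /height; apply: le_trans (aK s.2) _.
by rewrite lerDr.
Qed.

Lemma jumpE s w : B s w ->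
  jump s w = incr X (tm s) w + a (eta (tm s).+1 w) - a s.2.
Proof.
move=> Bw; have e1 : X (tm s) w = s.1 := congr1 fst Bw.
by rewrite /jump /height /incr /= e1; ring.
Qed.

Lemma chain_next_in s w : Sigma (chain (tm s).+1 w).
Proof. exact: (chain_in hC). Qed.

(* The moment of order [qe] exists and [2 < qe <= 3], so that it controls both
   the cubic Taylor remainder near the current height and the far jumps. *)
Let kappa : R := Num.min (p - 2) 1 / 2.
Let qe : R := 2 + 2 * kappa.

Lemma kappa_gt0 : 0 < kappa.
Proof. by rewrite /kappa divr_gt0 // lt_min subr_gt0 p_gt2 ltr01. Qed.

Lemma kappa_le : kappa <= 2^-1.
Proof. by rewrite /kappa ler_piMl ?invr_ge0 // ge_min lexx orbT. Qed.

Lemma qe_bounds : 2 < qe <= p.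
Proof.
have := kappa_gt0; rewrite /qe => k0.
have : 2 * kappa <= p - 2 by rewrite /kappa mulrC divfK // ge_min lexx.
by move=> h; apply/andP; split; lra.
Qed.

Definition spread : R := \sum_i \sum_j `|a j - a i|.

Lemma spread_le i j : `|a j - a i| <= spread.
Proof.
rewrite /spread (bigD1 i) //= (bigD1 j) //= -addrA lerDl.
by rewrite addr_ge0 // sumr_ge0 // => k _; rewrite ?sumr_ge0.
Qed.

Definition jump_moment : R := 1 + (2 `^ p * Cp + (2 * spread) `^ p).

Lemma sum_indic (c : S -> R) (k : S) : \sum_j c j * (k == j)%:R = c k.
Proof.
rewrite (bigD1 k) //= eqxx mulr1 big1 ?addr0 // => j /negbTE jk.
by rewrite eq_sym jk mulr0.
Qed.

Section at_state.
Variable s : R * S.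
Hypothesis sS : Sigma s.
Let n := tm s.
Let i := s.2.
Let x := s.1.

Let ind j w : R := (eta n.+1 w == j)%:R.

Let dom_weight : dominated s (fun w => 1 + `|incr X n w| `^ p).
Proof.
split; first by apply: measurable_funD => //; exact: measurable_moment.
by exists 1 => w _; rewrite mul1r ger0_norm // addr_ge0 // powR_ge0.
Qed.

Lemma dominated_moment : dominated s (fun w => `|incr X n w| `^ p).
Proof.
apply: (dominated_le _ dom_weight); first exact: measurable_moment.
by move=> w _; rewrite ger0_norm ?powR_ge0 // lerDr.
Qed.

Lemma dominated_indic j : dominated s (ind j).
Proof.
apply: (dominated_le _ dom_weight).
  exact: (measurable_next s (fun t => (t.2 == j)%:R)).
move=> w _; rewrite ger0_norm // (@le_trans _ _ 1) // ?lerDl ?powR_ge0 //.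
by rewrite lern1 leq_b1.
Qed.

Lemma dominated_incr : dominated s (incr X n).
Proof.
apply: (dominated_le _ dom_weight); first exact: measurable_incr.
move=> w _; rewrite -{1}[`|_|]powRr1 //; apply: le_1DpowR => //.
by have := p_gt2; lra.
Qed.

Lemma dominated_incr_indic j : dominated s (fun w => incr X n w * ind j w).
Proof.
apply: (dominated_le _ dom_weight).
  by apply: measurable_funM; [exact: dominated_incr.1|exact: (dominated_indic j).1].
move=> w _; rewrite normrM; apply: (@le_trans _ _ `|incr X n w|).
  by rewrite ler_piMr // ger0_norm // lern1 leq_b1.
rewrite -{1}[`|_|]powRr1 //; apply: le_1DpowR => //.
by have := p_gt2; lra.
Qed.

Lemma dominated_incr2 : dominated s (fun w => incr X n w ^+ 2).
Proof.
apply: (dominated_le _ dom_weight).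
  by apply: measurable_funX; exact: dominated_incr.1.
move=> w _; rewrite normrX -powR_mulrn //; apply: le_1DpowR => //.
by have := p_gt2; lra.
Qed.

Let pos_s : (0 < P (at_state X eta n (x, i)))%E.
Proof. by have := start_timeP hC sS; rewrite [X in at_state _ _ _ X]surjective_pairing. Qed.

Let BE : at_state X eta n (x, i) = B s.
Proof. by rewrite /x /i -surjective_pairing. Qed.

Lemma cond_mean_indic j : cond_mean s (ind j) = q i j x.
Proof.
rewrite -(hq _ pos_s) BE /cond_mean /condE /condP.
rewrite (_ : (\int[P]_(w in B s) (ind j w)%:E =
   P ([set w | eta n.+1 w = j] `&` B s))%E).
  rewrite fineM // fin_num_measure //; apply: measurableI => //.
  exact: (measurable_chain S_gt0 hS hC n.+1 [set t | t.2 = j]).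
rewrite -prob_integral_indic //; last first.
  exact: (measurable_chain S_gt0 hS hC n.+1 [set t | t.2 = j]).
apply: eq_integral => w _; rewrite indicE; congr ((nat_of_bool _)%:R%:E).
by apply/idP/idP => [/eqP h|]; [rewrite inE | rewrite inE => /eqP].
Qed.

Lemma cond_mean_incr : cond_mean s (incr X n) = mu i x.
Proof. by have := hmu pos_s; rewrite BE /cond_mean => ->. Qed.

Lemma cond_mean_incr2 : cond_mean s (fun w => incr X n w ^+ 2) = sigma2 i x.
Proof. by have := hsigma pos_s; rewrite BE /cond_mean => ->. Qed.

Lemma cond_mean_incr_indic j : cond_mean s (fun w => incr X n w * ind j w) = muj i j x.
Proof. by have := hmuj j pos_s; rewrite BE /cond_mean => ->. Qed.

Definition mean1 : R := mu i x + \sum_j a j * q i j x - a i.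

Definition mean2 : R := sigma2 i x + 2 * (\sum_j a j * muj i j x) -
  2 * a i * mu i x + \sum_j (a j - a i) ^+ 2 * q i j x.

Lemma cond_mean_moment_le : cond_mean s (fun w => `|incr X n w| `^ p) <= Cp.
Proof.
rewrite cond_mean_Rintegral //; last exact: dominated_moment.
rewrite ler_pdivrMr; last exact: PB_gt0.
rewrite -lee_fin /Rintegral fineK ?moment_le //.
exact: integrable_fin_num (dominated_integrable sS dominated_moment).
Qed.

Lemma abs_jump_le w : B s w -> `|jump s w| <= `|incr X n w| + spread.
Proof.
move=> Bw; rewrite jumpE // -addrA; apply: le_trans (ler_normD _ _) _.
by rewrite lerD2l spread_le.
Qed.

Lemma spread_ge0 : 0 <= spread.
Proof. by rewrite (le_trans _ (spread_le i i)). Qed.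

Lemma jump_powR_le (t : R) w : 0 <= t -> t <= p -> B s w ->
  `|jump s w| `^ t <= 1 + (2 `^ p * `|incr X n w| `^ p + (2 * spread) `^ p).
Proof.
move=> t0 tp Bw; apply: le_trans (le_1DpowR t0 tp (normr_ge0 _)) _.
have p0 : 0 <= p by have := p_gt2; lra.
rewrite lerD2l; have := abs_jump_le Bw; set D := `|incr X n w| => hj.
have sp := spread_ge0; have D0 : 0 <= D by rewrite /D.
have [Ds|sD] := leP D spread.
  apply: (@le_trans _ _ ((2 * spread) `^ p)); last first.
    by rewrite lerDr mulr_ge0 ?powR_ge0.
  by apply: ge0_ler_powRp => //; lra.
apply: (@le_trans _ _ ((2 * D) `^ p)).
  by apply: ge0_ler_powRp => //; lra.
by rewrite [leLHS]powRM // lerDl powR_ge0.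
Qed.

Let dom_jump_bound : dominated s
  (fun w => 1 + (2 `^ p * `|incr X n w| `^ p + (2 * spread) `^ p)).
Proof.
apply: dominatedD; first exact: dominated_cst.
apply: dominatedD; last exact: dominated_cst.
exact: dominatedZ dominated_moment.
Qed.

Lemma measurable_jump : measurable_fun (B s) (jump s).
Proof. exact: (measurable_next s (fun t => height t - height s)). Qed.

Lemma dominated_jump_powR (t : R) : 0 <= t -> t <= p ->
  dominated s (fun w => `|jump s w| `^ t).
Proof.
move=> t0 tp; apply: (dominated_le _ dom_jump_bound).
  apply: (measurableT_comp (measurable_powR t)).
  by apply: measurableT_comp => //; exact: measurable_jump.
by move=> w Bw; rewrite ger0_norm ?powR_ge0 //; exact: jump_powR_le.
Qed.

Lemma cond_mean_jump_powR (t : R) : 0 <= t -> t <= p ->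
  cond_mean s (fun w => `|jump s w| `^ t) <= jump_moment.
Proof.
move=> t0 tp; apply: le_trans (cond_mean_le sS (dominated_jump_powR t0 tp)
  dom_jump_bound _) _.
  by move=> w Bw; exact: jump_powR_le.
have d1 := dominatedZ (2 `^ p) dominated_moment.
have d2 := dominated_cst s ((2 * spread) `^ p).
rewrite cond_meanD //; [|exact: dominated_cst|exact: dominatedD].
rewrite cond_meanD // !cond_mean_cst // cond_meanZ //; last exact: dominated_moment.
rewrite /jump_moment lerD2l lerD2r ler_wpM2l ?powR_ge0 //.
exact: cond_mean_moment_le.
Qed.

Lemma dominated_jump : dominated s (jump s).
Proof.
apply: (dominated_le measurable_jump (@dominated_jump_powR 1 _ _)) => //.
  by have := p_gt2; lra.
by move=> w _; rewrite powRr1.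
Qed.

Lemma dominated_jump2 : dominated s (fun w => jump s w ^+ 2).
Proof.
apply: (dominated_le _ (@dominated_jump_powR 2 _ _)) => //.
- by apply: measurable_funX; exact: measurable_jump.
- by have := p_gt2; lra.
- by move=> w _; rewrite normrX -powR_mulrn.
Qed.

Lemma cond_mean_jump : cond_mean s (jump s) = mean1.
Proof.
have d1 := dominated_sum a dominated_indic.
have d2 := dominatedD dominated_incr d1.
have -> : cond_mean s (jump s) =
    cond_mean s (fun w => (incr X n w + \sum_j a j * ind j w) + - a i).
  by apply: cond_mean_eq => w Bw; rewrite jumpE // /ind sum_indic.
rewrite cond_meanD //; last exact: dominated_cst.
rewrite cond_meanD // ?cond_mean_cst // ?cond_mean_sum // ?cond_mean_incr; try
  exact: dominated_incr.
  by rewrite /mean1; congr (_ + _ - _); apply: eq_bigr => j _; rewrite cond_mean_indic.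
exact: dominated_indic.
Qed.

Lemma cond_mean_jump2 : cond_mean s (fun w => jump s w ^+ 2) = mean2.
Proof.
have d1 := dominatedZ 2 (dominated_sum a dominated_incr_indic).
have d2 := dominatedD dominated_incr2 d1.
have d3 := dominatedZ (- (2 * a i)) dominated_incr.
have d4 := dominated_sum (fun j => (a j - a i) ^+ 2) dominated_indic.
have d5 := dominatedD d2 d3.
have -> : cond_mean s (fun w => jump s w ^+ 2) =
    cond_mean s (fun w => ((incr X n w ^+ 2 + 2 * \sum_j a j * (incr X n w * ind j w)) +
      - (2 * a i) * incr X n w) + \sum_j (a j - a i) ^+ 2 * ind j w).
  apply: cond_mean_eq => w Bw; rewrite jumpE // /ind sum_indic.
  rewrite (eq_bigr (fun j => (incr X n w * a j) * (eta n.+1 w == j)%:R)); last first.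
    by move=> j _; rewrite mulrCA mulrA.
  by rewrite (sum_indic (fun j => incr X n w * a j)); rewrite -/i -/n; ring.
rewrite cond_meanD // cond_meanD // cond_meanD //; last exact: dominated_incr2.
rewrite cond_meanZ //; last exact: dominated_sum dominated_incr_indic.
rewrite cond_meanZ //; last exact: dominated_incr.
rewrite !cond_mean_sum //; [|exact: dominated_indic|exact: dominated_incr_indic].
rewrite cond_mean_incr cond_mean_incr2 /mean2 mulNr; congr (_ + 2 * _ - _ + _).
  by apply: eq_bigr => j _; rewrite cond_mean_incr_indic.
by apply: eq_bigr => j _; rewrite cond_mean_indic.
Qed.

Definition drift (F : R * S -> R) : R := cond_mean s (fun w => F (chain n.+1 w)) - F s.

Definition dominated_next (F : R * S -> R) := dominated s (fun w => F (chain n.+1 w)).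

Lemma driftD F G : dominated_next F -> dominated_next G ->
  drift (fun t => F t + G t) = drift F + drift G.
Proof. by move=> hF hG; rewrite /drift cond_meanD //; ring. Qed.

Lemma driftB F G : dominated_next F -> dominated_next G ->
  drift (fun t => F t - G t) = drift F - drift G.
Proof.
move=> hF hG; rewrite /drift.
have -> : cond_mean s (fun w => F (chain n.+1 w) - G (chain n.+1 w)) =
  cond_mean s (fun w => F (chain n.+1 w) + -1 * G (chain n.+1 w)).
  by apply: cond_mean_eq => w _; rewrite mulN1r.
by rewrite cond_meanD ?cond_meanZ //; [ring|exact: dominatedZ].
Qed.

Let y := height s.

(** Only the first two moments of the jump of the height matter, the remainder
    being integrable thanks to the moment of order [p]. *)
Lemma drift_height (G G1 G2 E : R -> R) :
  (forall y z, 1 <= y -> 1 <= z ->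
    `|G z - G y - G1 y * (z - y) - G2 y / 2 * (z - y) ^+ 2|
      <= E y * `|z - y| `^ qe) ->
  dominated_next (fun t => G (height t)) /\
  `|drift (fun t => G (height t)) - (G1 y * mean1 + G2 y / 2 * mean2)|
    <= E y * jump_moment.
Proof.
move=> hG; have /andP[q2 qp] := qe_bounds.
have y1 : 1 <= y by exact: height_ge1.
have q0 : 0 <= qe by lra.
pose rem w := G (height (chain n.+1 w)) - G y - G1 y * jump s w
  - G2 y / 2 * jump s w ^+ 2.
have hrem w : B s w -> `|rem w| <= E y * `|jump s w| `^ qe.
  by move=> _; apply: hG => //; exact/height_ge1/chain_next_in.
have dE := dominatedZ (E y) (dominated_jump_powR q0 qp).
have E0 : 0 <= E y.
  have y2 : 1 <= y + 1 by rewrite lerDr (le_trans _ y1).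
  have := hG y (y + 1) y1 y2; have -> : y + 1 - y = 1 by ring.
  by rewrite normr1 powR1 [E y * 1]mulr1 => /(le_trans (normr_ge0 _)).
have dj1 := dominatedZ (G1 y) dominated_jump.
have dj2 := dominatedZ (G2 y / 2) dominated_jump2.
have drem : dominated s rem.
  apply: (dominated_le _ dE) => //.
  exact: (measurable_next s (fun t => G (height t) - G y
     - G1 y * (height t - y) - G2 y / 2 * (height t - y) ^+ 2)).
have dc := dominated_cst s (G y).
have dl := dominatedD drem dc; have dr := dominatedD dj1 dj2.
have e : forall w, G (height (chain n.+1 w)) =
    (rem w + G y) + (G1 y * jump s w + G2 y / 2 * jump s w ^+ 2).
  by move=> w; rewrite /rem; ring.
split.
  have := dominatedD dl dr; rewrite /dominated_next.
  by congr (dominated _ _); apply/funext => w; rewrite e.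
have dj := dominated_jump; have djj := dominated_jump2.
clearbody rem.
rewrite /drift (cond_mean_eq (fun w _ => e w)) cond_meanD // cond_meanD //
  cond_meanD // cond_mean_cst // !cond_meanZ //.
rewrite cond_mean_jump cond_mean_jump2 -/y (_ : _ - _ = cond_mean s rem); last by ring.
apply: le_trans (cond_mean_norm_le sS drem dE hrem) _.
rewrite cond_meanZ //; last exact: dominated_jump_powR.
by rewrite ler_wpM2l // cond_mean_jump_powR.
Qed.

(** To leading order the height does not change in one step, so the drift of a
    corrector comes from the change of line alone. *)
Lemma drift_corrector (W E : R -> R) (b : S -> R) (bM : R) :
  (forall j, `|b j| <= bM) ->
  (forall y z, 1 <= y -> 1 <= z ->
    `|W z - W y| <= E y * (1 + `|z - y| `^ qe)) ->
  dominated_next (fun t => b t.2 * W (height t)) /\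
  `|drift (fun t => b t.2 * W (height t)) -
      W y * \sum_j (b j - b i) * q i j x|
    <= bM * (E y * (1 + jump_moment)).
Proof.
move=> hb hW; have /andP[q2 qp] := qe_bounds.
have y1 : 1 <= y by exact: height_ge1.
have q0 : 0 <= qe by lra.
pose rem w := b (eta n.+1 w) * (W (height (chain n.+1 w)) - W y).
have bM0 : 0 <= bM by rewrite (le_trans _ (hb i)).
have hrem w : B s w -> `|rem w| <= bM * (E y * (1 + `|jump s w| `^ qe)).
  move=> _; rewrite normrM ler_pM //.
  by apply: hW => //; exact/height_ge1/chain_next_in.
have d1 := dominatedD (dominated_cst s 1) (dominated_jump_powR q0 qp).
have dE := dominatedZ bM (dominatedZ (E y) d1).
have E0 : 0 <= E y.
  have := hW y y y1 y1; rewrite subrr normr0.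
  by rewrite pmulr_lge0 // ltr_pwDl // powR_ge0.
have drem : dominated s rem.
  apply: (dominated_le _ dE) => //.
  exact: (measurable_next s (fun t => b t.2 * (W (height t) - W y))).
have dsum := dominated_sum (fun j => b j - b i) dominated_indic.
have dWs := dominatedZ (W y) dsum; have dc := dominated_cst s (b i * W y).
have dl := dominatedD drem dc.
have e : forall w, b (eta n.+1 w) * W (height (chain n.+1 w)) =
    (rem w + b i * W y) + W y * \sum_j (b j - b i) * ind j w.
  by move=> w; rewrite /rem /ind sum_indic; ring.
split.
  have := dominatedD dl dWs; rewrite /dominated_next.
  by congr (dominated _ _); apply/funext => w; rewrite -e.
clearbody rem.
rewrite /drift (cond_mean_eq (fun w _ => e w)) cond_meanD // cond_meanD //
  cond_mean_cst // cond_meanZ // cond_mean_sum //;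
  last exact: dominated_indic.
under eq_bigr do rewrite cond_mean_indic.
rewrite -/i -/y (_ : _ - _ = cond_mean s rem); last by ring.
apply: le_trans (cond_mean_norm_le sS drem dE hrem) _.
rewrite cond_meanZ ?ler_wpM2l //; last exact: dominatedZ.
rewrite cond_meanZ // ler_wpM2l // cond_meanD ?cond_mean_cst ?lerD2l
  ?cond_mean_jump_powR //.
- exact: dominated_cst.
- exact: dominated_jump_powR.
Qed.

End at_state.

End Increments.

(** * Asymptotics of the moments far out in the strip *)

Section Eventually.
Context {R : realType} {S : finType}.
Variable Sigma : set (R * S).
Hypothesis hS : half_strip Sigma.

(** Since the strip is locally finite, a property holds far out exactly when it
    fails only at finitely many states. *)
Definition far_out (Q : R * S -> Prop) :=
  exists x0 : R, forall s, Sigma s -> x0 <= s.1 -> Q s.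

Lemma far_out_imp (Q1 Q2 : R * S -> Prop) : far_out Q1 ->
  (forall s, Sigma s -> Q1 s -> Q2 s) -> far_out Q2.
Proof. by move=> [x0 h] q12; exists x0 => s sS xs; apply: q12 => //; apply: h. Qed.

Lemma far_outI (Q1 Q2 : R * S -> Prop) : far_out Q1 -> far_out Q2 ->
  far_out (fun s => Q1 s /\ Q2 s).
Proof.
move=> [x1 h1] [x2 h2]; exists (Num.max x1 x2) => s sS.
by rewrite ge_max => /andP[xs1 xs2]; split; [apply: h1|apply: h2].
Qed.

Lemma far_out_forall (I : finType) (Q : I -> R * S -> Prop) :
  (forall i, far_out (Q i)) -> far_out (fun s => forall i, Q i s).
Proof.
move=> h; have [x0 hx] := choice h.
exists (\sum_i `|x0 i|) => s sS xs i; apply: hx => //; apply: le_trans xs.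
by rewrite (bigD1 i) //= (le_trans (ler_norm _)) // lerDl sumr_ge0.
Qed.

Lemma far_out_ge (c : R) : far_out (fun s => c <= s.1).
Proof. by exists c. Qed.

Lemma far_out_line (Q : R * S -> Prop) :
  (forall i, exists x0, forall x, Sigma (x, i) -> x0 <= x -> Q (x, i)) ->
  far_out Q.
Proof.
move=> h; have [x0 hx] := choice h.
exists (\sum_i `|x0 i|) => -[x i] sS xs; apply: hx => //; apply: le_trans xs.
by rewrite (bigD1 i) //= (le_trans (ler_norm _)) // lerDl sumr_ge0.
Qed.

Lemma far_out_finite (Q : R * S -> Prop) : far_out Q ->
  exists2 A : set (R * S), finite_set A & forall s, Sigma s -> ~ A s -> Q s.
Proof.
move=> [x0 hx]; have [_ hfin _] := hS.
exists (Sigma `&` [set s | s.1 <= Num.max x0 0]).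
  by apply: hfin; rewrite le_max lexx orbT.
move=> s sS nA; apply: hx => //; rewrite leNgt; apply/negP => sx; apply: nA.
by split=> //=; rewrite le_max (ltW sx).
Qed.

Lemma far_out_finite_compl (Q : R * S -> Prop) : far_out Q ->
  finite_set (Sigma `&` [set s | ~ Q s]).
Proof.
move=> /far_out_finite [A fA hA]; apply: sub_finite_set fA => s [sS nQ].
by apply: contrapT => /(hA s sS).
Qed.

Variable delta : R.
Hypothesis delta01 : 0 <= delta < 1.

(** The class of error terms [o(x `^ (- delta))], uniformly over the lines;
    [delta = 0] is the plain [o(1)]. *)
Definition small (f : R * S -> R) :=
  forall eps, 0 < eps -> far_out (fun s => `|f s| <= eps * s.1 `^ (- delta)).

Lemma smallD f g : small f -> small g -> small (fun s => f s + g s).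
Proof.
move=> hf hg eps e0; have e2 : 0 < eps / 2 by rewrite divr_gt0.
apply: far_out_imp (far_outI (hf _ e2) (hg _ e2)) _ => s _ [h1 h2].
by apply: le_trans (ler_normD _ _) _; lra.
Qed.

Lemma smallM (M : R) f g : far_out (fun s => `|g s| <= M) -> small f ->
  small (fun s => g s * f s).
Proof.
move=> hg hf eps e0; pose M' := `|M| + 1.
have M0 : 0 < M' by rewrite ltr_wpDl.
have e2 : 0 < eps / M' by rewrite divr_gt0.
apply: far_out_imp (far_outI hg (hf _ e2)) _ => s _ [h1 h2].
rewrite normrM; apply: (@le_trans _ _ (M' * `|f s|)).
  rewrite ler_wpM2r // (le_trans h1) // /M'.
  by apply: le_trans (ler_norm _) _; rewrite lerDl.
apply: le_trans (ler_wpM2l (ltW M0) h2) _.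
by rewrite mulrA mulrCA divff ?mulr1 // gt_eqF.
Qed.

Lemma small_coef (c : S -> R) f : small f -> small (fun s => c s.2 * f s).
Proof.
apply: (@smallM (\sum_i `|c i|)); exists 0 => s _ _.
by rewrite (bigD1 s.2) //= lerDl sumr_ge0.
Qed.

Lemma small_eq f g : (forall s, Sigma s -> f s = g s) -> small f -> small g.
Proof.
move=> fg hf eps e0; apply: far_out_imp (hf _ e0) _ => s sS.
by rewrite fg.
Qed.

Lemma small_eq_far f g : far_out (fun s => f s = g s) -> small f -> small g.
Proof.
move=> fg hf eps e0; apply: far_out_imp (far_outI fg (hf _ e0)) _ => s sS [e].
by rewrite e.
Qed.

Lemma small0 : small (fun=> 0).
Proof.
by move=> eps e0; exists 0 => s _ _; rewrite normr0 mulr_ge0 ?powR_ge0 // ltW.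
Qed.

Lemma small_sum (I : finType) (f : I -> R * S -> R) :
  (forall i, small (f i)) -> small (fun s => \sum_i f i s).
Proof.
move=> hf; suff H l : small (fun s => \sum_(i <- l) f i s) by exact: H.
elim: l => [|i l IH].
  by apply: small_eq small0 => s _; rewrite big_nil.
by apply: small_eq (smallD (hf i) IH) => s _; rewrite big_cons.
Qed.

Lemma small_inv : small (fun s => s.1^-1).
Proof.
move=> eps e0; have /andP[d0 d1] := delta01.
have dd : 0 < 1 - delta by rewrite subr_gt0.
apply: far_out_imp (far_outI (far_out_ge 1)
  (far_out_ge (eps^-1 `^ (1 - delta)^-1))) _ => s _ [x1 x2].
have x0 : 0 < s.1 by apply: lt_le_trans x1.
rewrite ger0_norm ?invr_ge0 ?(ltW x0) // -powR_inv1 ?(ltW x0) //.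
rewrite (_ : - delta = -1 + (1 - delta)); last by ring.
rewrite powRDp // mulrCA ler_peMr ?powR_ge0 // -ler_pdivrMl // mulr1.
have := ge0_ler_powRp (ltW dd) (powR_ge0 _ _) x2.
by rewrite -powRrM mulVf ?gt_eqF // powRr1 // invr_ge0 ltW.
Qed.

End Eventually.

Definition little_on {R : realType} {S : finType} (Sigma : set (R * S)) (i : S)
    (f g : R -> R) :=
  forall eps, 0 < eps -> exists x0, forall x, Sigma (x, i) -> x0 <= x ->
    `|f x| <= eps * `|g x|.

Section Asymptotics.
Context {R : realType} {S : finType}.
Variable Sigma : set (R * S).
Hypothesis hS : half_strip Sigma.
Variables (q : S -> S -> R -> R) (mu sigma2 : S -> R -> R) (muj : S -> S -> R -> R).
Variables (qlim gamma dlim : S -> S -> R) (d e t2 : S -> R).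
Variables (a : S -> R) (K0 : R).
Hypothesis q_stoch : stochastic qlim.
Hypothesis aK : forall i, 1 <= a i + K0.
Hypothesis a_sol : forall i, d i + \sum_j (a j - a i) * qlim i j = 0.
Variable delta : R.
Hypothesis delta01 : 0 <= delta < 1.

Definition rate1 : R -> R := fun x => x `^ (- 1 - delta).
Definition rate0 : R -> R := fun x => x `^ (- delta).

Hypothesis as_q : forall i j, little_on Sigma i
  (fun x => q i j x - (qlim i j + gamma i j / x)) rate1.
Hypothesis as_mu : forall i, little_on Sigma i
  (fun x => mu i x - (d i + e i / x)) rate1.
Hypothesis as_sigma : forall i, little_on Sigma i
  (fun x => sigma2 i x - t2 i) rate0.
Hypothesis as_muj : forall i j, little_on Sigma i
  (fun x => muj i j x - dlim i j) rate0.

Definition drift_coef (i : S) : R := 2 * e i + 2 * \sum_j a j * gamma i j.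

Definition var_coef (i : S) : R :=
  t2 i + 2 * (\sum_j a j * dlim i j) - 2 * a i * d i
  + \sum_j (a j - a i) ^+ 2 * qlim i j.

Local Notation y := (height a K0).

(** The error is [eps * y `^ (- delta)] for the critical cases and, with
    [delta = 0], just [eps] for the others. *)
Definition moments_close (eps : R) (s : R * S) :=
  [/\ `|y s * mean1 q mu a s - drift_coef s.2 / 2| <= eps * y s `^ (- delta),
      `|mean2 q mu sigma2 muj a s - var_coef s.2| <= eps * y s `^ (- delta) &
      forall j, `|q s.2 j s.1 - qlim s.2 j| <= eps * y s `^ (- delta)].

Local Notation small := (small Sigma delta).

Let small_of_littleo1 (f : S -> R -> R) :
  (forall i, little_on Sigma i (f i) rate1) -> small (fun s => s.1 * f s.2 s.1).
Proof.
move=> hf eps e0; apply: (far_out_imp (Q1 := fun s => 1 <= s.1 /\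
    `|f s.2 s.1| <= eps * `|rate1 s.1|)).
  apply: far_outI; first exact: far_out_ge.
  apply: far_out_line => i; have [x0 hx] := hf i _ e0.
  by exists x0.
move=> s _ [x1 h]; have x0 : 0 < s.1 by apply: lt_le_trans x1.
rewrite normrM ger0_norm ?(ltW x0) //.
apply: le_trans (ler_wpM2l (ltW x0) h) _; rewrite mulrCA.
rewrite /rate1 ger0_norm ?powR_ge0 // powRDp // powR_inv1 ?(ltW x0) //.
by rewrite [s.1 * (_ * _)]mulrA divff ?mul1r ?gt_eqF.
Qed.

Let small_of_littleo0 (f : S -> R -> R) :
  (forall i, little_on Sigma i (f i) rate0) -> small (fun s => f s.2 s.1).
Proof.
move=> hf eps e0; apply: far_out_line => i.
have [x0 hx] := hf i _ e0; exists x0 => x sx xx.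
by have := hx x sx xx; rewrite /rate0 [`|_ `^ _|]ger0_norm ?powR_ge0.
Qed.

Let inv_small := small_inv Sigma delta01.

Let far_pos : far_out Sigma (fun s => 1 <= s.1).
Proof. exact: far_out_ge. Qed.

Let gap : R := \sum_i `|a i + K0|.

Let height_gap s : `|y s - s.1| <= gap.
Proof.
by rewrite /height addrC addKr /gap (bigD1 s.2) //= lerDl sumr_ge0.
Qed.

Let height_comparable : far_out Sigma (fun s => 1 <= s.1 /\ s.1 <= y s <= 2 * s.1).
Proof.
apply: far_out_imp (far_outI far_pos (far_out_ge Sigma gap)) _ => s _ [x1 xg].
have := height_gap s; rewrite ler_norml => /andP[_ h].
have h2 : s.1 <= y s by rewrite /height lerDl (le_trans _ (aK _)).
by split=> //; rewrite h2 /=; lra.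
Qed.

Let small_height f : small f -> forall eps, 0 < eps ->
  far_out Sigma (fun s => `|f s| <= eps * y s `^ (- delta)).
Proof.
move=> hf eps e0; have e2 : 0 < eps / 2 by rewrite divr_gt0.
have /andP[d0 d1] := delta01.
apply: far_out_imp (far_outI height_comparable (hf _ e2)) _.
move=> s _ [[x1 /andP[h1 h2]] h]; apply: (le_trans h).
have x0 : 0 < s.1 by apply: lt_le_trans x1.
have y0 : 0 < y s by apply: lt_le_trans h1.
rewrite -mulrA ler_wpM2l ?(ltW e0) // ler_pdivrMl //.
apply: (@le_trans _ _ (2 `^ delta * y s `^ (- delta))); last first.
  by rewrite ler_wpM2r ?powR_ge0 // -[leRHS]powRr1 // ler_powR ?ler1n // ltW.
have -> : s.1 `^ (- delta) = 2 `^ delta * (2 * s.1) `^ (- delta).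
  by rewrite powRM ?(ltW x0) // mulrA [2 `^ delta * _]mulrC powR_mulV // mul1r.
by rewrite ler_wpM2l ?powR_ge0 // le0_ler_powRp // oppr_le0.
Qed.

Let rq j s := s.1 * (q s.2 j s.1 - (qlim s.2 j + gamma s.2 j / s.1)).
Let rmu s := s.1 * (mu s.2 s.1 - (d s.2 + e s.2 / s.1)).

Let rq_small j : small (rq j).
Proof.
exact: (@small_of_littleo1 (fun i x => q i j x - (qlim i j + gamma i j / x))).
Qed.

Let rmu_small : small rmu.
Proof. exact: (@small_of_littleo1 (fun i x => mu i x - (d i + e i / x))). Qed.

Let q_small j : small (fun s => q s.2 j s.1 - qlim s.2 j).
Proof.
have h1 := small_coef (fun i => gamma i j) inv_small.
have h2 : small (fun s => s.1^-1 * rq j s).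
  apply: (@smallM _ _ _ _ 1) (rq_small j).
  apply: far_out_imp far_pos _ => s _ x1.
  by rewrite ger0_norm ?invr_ge0 ?(le_trans _ x1) // invf_le1 // (lt_le_trans _ x1).
apply: small_eq_far (smallD h1 h2); apply: far_out_imp far_pos _ => s _ x1.
by rewrite /rq; field; lra.
Qed.

Let mu_small : small (fun s => mu s.2 s.1 - d s.2).
Proof.
have h1 := small_coef e inv_small.
have h2 : small (fun s => s.1^-1 * rmu s).
  apply: (@smallM _ _ _ _ 1) rmu_small.
  apply: far_out_imp far_pos _ => s _ x1.
  by rewrite ger0_norm ?invr_ge0 ?(le_trans _ x1) // invf_le1 // (lt_le_trans _ x1).
apply: small_eq_far (smallD h1 h2); apply: far_out_imp far_pos _ => s _ x1.
by rewrite /rmu; field; lra.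
Qed.

Let mean1_small : small (fun s => y s * mean1 q mu a s - drift_coef s.2 / 2).
Proof.
have hs : small (fun s => rmu s + \sum_j a j * rq j s).
  apply: smallD rmu_small _; apply: small_sum => j.
  exact: (small_coef (fun=> a j) (rq_small j)).
have hyx : small (fun s => (y s / s.1) * (rmu s + \sum_j a j * rq j s)).
  apply: (@smallM _ _ _ _ 2) hs; apply: far_out_imp height_comparable _.
  move=> s _ [x1 /andP[h1 h2]].
  have x0 : 0 < s.1 by apply: lt_le_trans x1.
  by rewrite ger0_norm ?divr_ge0 ?(ltW x0) ?(le_trans (ltW x0) h1) // ler_pdivrMr.
have hu : small (fun s => drift_coef s.2 / 2 * ((y s - s.1) * s.1^-1)).
  apply: (@small_coef _ _ _ _ (fun i => drift_coef i / 2) (fun s => (y s - s.1) * s.1^-1)).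
  by apply: smallM inv_small; exists 0 => s _ _; exact: height_gap.
apply: small_eq_far (smallD hyx hu); apply: far_out_imp far_pos _ => s _ x1.
have := a_sol s.2; rewrite (gen_eq q_stoch a s.2) => sol.
have -> : mean1 q mu a s = (drift_coef s.2 / 2) / s.1 +
    (rmu s + \sum_j a j * rq j s) / s.1.
  have e1 : \sum_j a j * rq j s = s.1 * \sum_j a j * q s.2 j s.1 -
      s.1 * (\sum_j a j * qlim s.2 j) - \sum_j a j * gamma s.2 j.
    rewrite !mulr_sumr -!sumrB; apply: eq_bigr => j _.
    by rewrite /rq; field; lra.
  have sol' : \sum_j a j * qlim s.2 j = a s.2 - d s.2 by lra.
  rewrite e1 sol' /mean1 /drift_coef /rmu; field; lra.
by field; lra.
Qed.

Let mean2_small : small (fun s => mean2 q mu sigma2 muj a s - var_coef s.2).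
Proof.
have h1 := small_of_littleo0 as_sigma.
have h2 : small (fun s => \sum_j 2 * a j * (muj s.2 j s.1 - dlim s.2 j)).
  apply: small_sum => j; apply: (small_coef (fun=> 2 * a j)).
  exact: (small_of_littleo0 (fun i => as_muj i j)).
have h3 := small_coef (fun i => - (2 * a i)) mu_small.
have h4 : small (fun s => \sum_j (a j - a s.2) ^+ 2 * (q s.2 j s.1 - qlim s.2 j)).
  apply: small_sum => j.
  exact: (small_coef (fun i => (a j - a i) ^+ 2) (q_small j)).
apply: small_eq (smallD (smallD h1 h2) (smallD h3 h4)) => s _.
rewrite /mean2 /var_coef.
have -> : \sum_j 2 * a j * (muj s.2 j s.1 - dlim s.2 j) =
   2 * (\sum_j a j * muj s.2 j s.1) - 2 * \sum_j a j * dlim s.2 j.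
  by rewrite !mulr_sumr -sumrB; apply: eq_bigr => j _; ring.
have -> : \sum_j (a j - a s.2) ^+ 2 * (q s.2 j s.1 - qlim s.2 j) =
   \sum_j (a j - a s.2) ^+ 2 * q s.2 j s.1 - \sum_j (a j - a s.2) ^+ 2 * qlim s.2 j.
  by rewrite -sumrB; apply: eq_bigr => j _; ring.
ring.
Qed.

Lemma moments_close_far eps : 0 < eps -> far_out Sigma (moments_close eps).
Proof.
move=> e0; have h1 := small_height mean1_small e0.
have h2 := small_height mean2_small e0.
have h3 : far_out Sigma (fun s => forall j,
    `|q s.2 j s.1 - qlim s.2 j| <= eps * y s `^ (- delta)).
  by apply: far_out_forall => j; exact: (small_height (q_small j) e0).
apply: far_out_imp (far_outI h1 (far_outI h2 h3)) _ => s _ [c1 [c2 c3]].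
by split.
Qed.

Variable pi_ : S -> R.
Hypothesis pi_stat : stationary_distribution qlim pi_.

(** The second moment of [Y] also contains the terms
    [(a j - a i) ^+ 2 * qlim i j] and [- 2 * a i * d i]. They cancel on average
    because of the equation satisfied by [a] and because the generator applied
    to [a ^+ 2] has mean zero under the stationary law. *)
Lemma sum_var_coef : \sum_i pi_ i * var_coef i =
  \sum_i (t2 i + 2 * \sum_j a j * dlim i j) * pi_ i.
Proof.
have := stationary_gen q_stoch pi_stat (fun i => a i ^+ 2) => h.
rewrite -[RHS]addr0 -[X in _ = _ + X]h -big_split /=; apply: eq_bigr => i _.
have -> : \sum_j (a j ^+ 2 - a i ^+ 2) * qlim i j =
    \sum_j (a j - a i) ^+ 2 * qlim i j + 2 * a i * \sum_j (a j - a i) * qlim i j.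
  by rewrite mulr_sumr -big_split; apply: eq_bigr => j _ /=; ring.
have -> : \sum_j (a j - a i) * qlim i j = - d i by have := a_sol i; lra.
rewrite /var_coef; ring.
Qed.

Lemma sum_drift_coef : \sum_i pi_ i * drift_coef i =
  \sum_i (2 * e i + 2 * \sum_j a j * gamma i j) * pi_ i.
Proof. by apply: eq_bigr => i _; rewrite mulrC. Qed.

End Asymptotics.

(** * Test functions and their drift *)

Section Lyapunov.
Context {disp : measure_display} {T : measurableType disp} {R : realType}.
Context {S : finType}.
Variables (P : probability T R) (X : nat -> {RV P >-> R}) (eta : nat -> T -> S).
Variable Sigma : set (R * S).
Hypothesis S_gt0 : (0 < #|S|)%N.
Hypothesis hS : half_strip Sigma.
Hypothesis hC : homogeneous_irreducible_chain X eta Sigma.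
Variables (p Cp : R).
Hypothesis p_gt2 : 2 < p.
Hypothesis hmom : forall (n : nat) (x : R) (i : S), Sigma (x, i) ->
  (0 < P (at_state X eta n (x, i)))%E ->
  (condE P (fun w => (`|incr X n w| `^ p)%:E) (at_state X eta n (x, i))
     <= Cp%:E)%E.
Variables (q : S -> S -> R -> R) (mu sigma2 : S -> R -> R) (muj : S -> S -> R -> R).
Hypothesis hq : forall i j,
  is_condP X eta (fun n => [set w | eta n.+1 w = j]) i (q i j).
Hypothesis hmu : forall i, is_condE X eta (incr X) i (mu i).
Hypothesis hsigma : forall i,
  is_condE X eta (fun n w => incr X n w ^+ 2) i (sigma2 i).
Hypothesis hmuj : forall i j, is_condE X eta
  (fun n w => incr X n w * (eta n.+1 w == j)%:R) i (muj i j).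
Variables (qlim gamma dlim : S -> S -> R) (d e t2 : S -> R).
Variables (a : S -> R) (K0 : R).
Hypothesis aK : forall i, expR 1 <= a i + K0.

Local Notation y := (height a K0).
Local Notation m1 := (mean1 q mu a).
Local Notation m2 := (mean2 q mu sigma2 muj a).
Local Notation u := (drift_coef gamma e a).
Local Notation v := (var_coef qlim dlim d t2 a).
Local Notation Dr := (drift X eta).
Local Notation dom := (dominated_next X eta p).
Local Notation close := (moments_close q mu sigma2 muj qlim gamma dlim d e t2 a K0).
Local Notation far := (far_out Sigma).
Local Notation M := (jump_moment p Cp a).
Let kappa : R := Num.min (p - 2) 1 / 2.

Let k0 : 0 < kappa := kappa_gt0 p_gt2.
Let k1 : kappa <= 2^-1 := kappa_le p.

Let aK1 i : 1 <= a i + K0.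
Proof. by apply: le_trans (aK i); rewrite -[leLHS]expR0 ler_expR. Qed.

Lemma height_ge_e s : Sigma s -> expR 1 <= y s.
Proof.
have [h0 _ _] := hS => /h0 x0; rewrite /height; apply: le_trans (aK s.2) _.
by rewrite lerDr.
Qed.

Let y1 s : Sigma s -> 1 <= y s.
Proof. exact: height_ge1. Qed.

Let y0 s : Sigma s -> 0 < y s.
Proof. by move=> /y1; apply: lt_le_trans. Qed.

Lemma ln_height_ge1 s : Sigma s -> 1 <= ln (y s).
Proof.
move=> sS; rewrite -[leLHS](@expRK R) ler_ln ?posrE ?expR_gt0 ?y0 //.
exact: height_ge_e.
Qed.

Lemma far_height (c : R) : far (fun s => c <= y s).
Proof.
exists c => s _ cx; rewrite /height (le_trans cx) // lerDl.
by rewrite (le_trans _ (aK1 _)).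
Qed.

Lemma far_powR (c alpha : R) : 0 < alpha -> far (fun s => c <= y s `^ alpha).
Proof.
move=> a0; apply: far_out_imp (far_height (`|c| `^ alpha^-1)) _ => s _ h.
have := ge0_ler_powRp (ltW a0) (powR_ge0 _ _) h.
rewrite -powRrM mulVf ?gt_eqF // powRr1 //; apply: le_trans; exact: ler_norm.
Qed.

Lemma far_powRN (c alpha : R) : 0 < c -> 0 < alpha ->
  far (fun s => y s `^ (- alpha) <= c).
Proof.
move=> c0 a0; apply: far_out_imp (far_powR c^-1 a0) _ => s sS h.
rewrite powRN -[c]invrK lef_pV2 ?posrE ?invr_gt0 ?powR_gt0 ?y0 //.
Qed.

Lemma far_ln (c : R) : far (fun s => c <= ln (y s)).
Proof.
apply: far_out_imp (far_height (expR c)) _ => s sS h.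
by rewrite -[leLHS](@expRK R) ler_ln ?posrE ?expR_gt0 ?y0.
Qed.

Definition coef_bound (alpha beta : R) (b : S -> R) : R :=
  `|alpha| + `|beta| + spread b.

Lemma spread_nonneg (b : S -> R) : 0 <= spread b.
Proof. by apply: sumr_ge0 => i _; apply: sumr_ge0. Qed.

Lemma coef_bound_ge0 alpha beta b : 0 <= coef_bound alpha beta b.
Proof. by rewrite !addr_ge0 // spread_nonneg. Qed.

Lemma coef_close alpha beta (b : S -> R) delta eps s : close delta eps s ->
  `|alpha * (y s * m1 s - u s.2 / 2) + beta * (m2 s - v s.2)
    + \sum_j (b j - b s.2) * (q s.2 j s.1 - qlim s.2 j)|
  <= coef_bound alpha beta b * (eps * y s `^ (- delta)).
Proof.
move=> [h1 h2 h3]; rewrite /coef_bound [leRHS]mulrDl [X in _ <= X + _]mulrDl.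
apply: le_trans (ler_normD _ _) _; apply: lerD.
  apply: le_trans (ler_normD _ _) _; rewrite !normrM.
  by apply: lerD; rewrite ler_wpM2l.
have e0 : 0 <= eps * y s `^ (- delta) by apply: le_trans h2.
apply: le_trans (ler_norm_sum _ _ _) _.
apply: (@le_trans _ _ (\sum_j `|b j - b s.2| * (eps * y s `^ (- delta)))).
  by apply: ler_sum => j _; rewrite normrM ler_wpM2l.
rewrite -mulr_suml ler_wpM2r // /spread [leRHS](bigD1 s.2) //= lerDl.
by apply: sumr_ge0 => i _; apply: sumr_ge0.
Qed.

Let bmax (b : S -> R) := \sum_j `|b j|.

Lemma le_bmax (b : S -> R) j : `|b j| <= bmax b.
Proof. by rewrite /bmax (bigD1 j) //= lerDl sumr_ge0. Qed.

Lemma bmax_ge0 (b : S -> R) : 0 <= bmax b.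
Proof. exact: sumr_ge0. Qed.

(** Here [dG] stands for the drift of a function of the height and [dW] for that
    of its corrector. The hypothesis on [b] makes the local coefficients of the
    line cancel and leaves their stationary average [c]. *)
Lemma drift_combine (dG dW Z k KG KW alpha beta c delta eps : R) (b : S -> R) s :
  0 <= Z -> 0 <= k -> 0 <= KG -> 0 <= KW ->
  `|dG - Z * (alpha * (y s * m1 s) + beta * m2 s)| <= KG * k * Z ->
  `|dW - Z * \sum_j (b j - b s.2) * q s.2 j s.1| <= KW * k * Z ->
  \sum_j (b j - b s.2) * qlim s.2 j = c - (alpha * (u s.2 / 2) + beta * v s.2) ->
  close delta eps s ->
  `|dG + dW - c * Z| <=
    (KG + KW + coef_bound alpha beta b) * (eps * y s `^ (- delta) + k) * Z.
Proof.
move=> Z0 k_0 KG0 KW0 hG hW hb hc.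
have E0 : 0 <= eps * y s `^ (- delta).
  by have [_ h _] := hc; exact: le_trans (normr_ge0 _) h.
have := coef_close alpha beta b hc; set B := coef_bound alpha beta b.
have B0 : 0 <= B by exact: coef_bound_ge0.
have -> : \sum_j (b j - b s.2) * (q s.2 j s.1 - qlim s.2 j) =
    \sum_j (b j - b s.2) * q s.2 j s.1 - (c - (alpha * (u s.2 / 2) + beta * v s.2)).
  by rewrite -hb -sumrB; apply: eq_bigr => j _; rewrite mulrBr.
move: hG hW; set E := eps * _ in E0 *; set Q := \sum_j _ => hG hW hQ.
have hQ' : `|Z * (alpha * (y s * m1 s - u s.2 / 2) + beta * (m2 s - v s.2)
    + (Q - (c - (alpha * (u s.2 / 2) + beta * v s.2))))| <= B * E * Z.
  by rewrite normrM (ger0_norm Z0) [leRHS]mulrC ler_wpM2l.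
have -> : dG + dW - c * Z = (dG - Z * (alpha * (y s * m1 s) + beta * m2 s)) +
  ((dW - Z * Q) + Z * (alpha * (y s * m1 s - u s.2 / 2) + beta * (m2 s - v s.2)
    + (Q - (c - (alpha * (u s.2 / 2) + beta * v s.2))))) by ring.
apply: le_trans (ler_normD _ _) _.
apply: le_trans (lerD hG (le_trans (ler_normD _ _) (lerD hW hQ'))) _.
rewrite -subr_ge0 (_ : _ - _ = (KG + KW) * E * Z + B * k * Z); last by ring.
by apply: addr_ge0; do 2 apply: mulr_ge0 => //; exact: addr_ge0.
Qed.

(** With [b] a solution of the Poisson equation in [drift_power], the second term
    averages the local coefficients over the lines; it is of the order of the
    second derivative of the first one, like the drift itself. *)
Definition power_test (r : R) (b : S -> R) (t : R * S) : R :=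
  y t `^ r + b t.2 * y t `^ (r - 2).

Let corrector_power (r : R) (b : S -> R) : - kappa <= r -> r <= 2 ->
  exists2 L, 0 <= L & forall s, Sigma s ->
    dom s (fun t => b t.2 * y t `^ (r - 2)) /\
    `|Dr s (fun t => b t.2 * y t `^ (r - 2)) -
       y s `^ (r - 2) * \sum_j (b j - b s.2) * q s.2 j s.1|
    <= L * y s `^ (- kappa) * y s `^ (r - 2).
Proof.
move=> kr r2; have [L L0 hL] := lipschitz_power k0 k1 kr r2.
exists (bmax b * (L * (1 + `|M|))) => [|s sS].
  by rewrite !mulr_ge0 ?bmax_ge0 ?addr_ge0.
have [|d1 h1] := drift_corrector S_gt0 hS hC p_gt2 hmom hq aK1 sS
    (W := fun z => z `^ (r - 2)) (E := fun z => L * z `^ (r - 2 - kappa))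
    (le_bmax b).
  by move=> z w z1 w1; rewrite -[leRHS]mulrA; exact: hL.
split=> //; apply: le_trans h1 _.
rewrite (powRDp (r - 2) (- kappa) (y0 sS)).
set Z := _ `^ (r - 2); set k := _ `^ (- kappa).
rewrite (_ : bmax b * (L * (1 + `|M|)) * k * Z =
    bmax b * (L * (Z * k) * (1 + `|M|))); last by ring.
by rewrite !ler_wpM2l ?bmax_ge0 ?lerD2l ?ler_norm // !mulr_ge0 ?powR_ge0.
Qed.

Lemma drift_power (r c : R) (b : S -> R) : - kappa <= r -> r <= 2 ->
  (forall i, \sum_j (b j - b i) * qlim i j =
     c - (r * (u i / 2) + r * (r - 1) / 2 * v i)) ->
  (forall s, Sigma s -> dom s (power_test r b)) /\
  exists2 C, 0 <= C & forall delta eps s, Sigma s -> close delta eps s ->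
    `|Dr s (power_test r b) - c * y s `^ (r - 2)|
    <= C * (eps * y s `^ (- delta) + y s `^ (- kappa)) * y s `^ (r - 2).
Proof.
move=> kr r2 hb.
have [K K_0 hK] := taylor_power k0 k1 kr r2.
have [L L0 hW] := corrector_power b kr r2.
have hG s : Sigma s -> dom s (fun t => y t `^ r) /\
    `|Dr s (fun t => y t `^ r) - (r * y s `^ (r - 1) * m1 s +
      r * (r - 1) * y s `^ (r - 2) / 2 * m2 s)| <= K * y s `^ (r - 2 - kappa) * M.
  move=> sS; apply: (drift_height S_gt0 hS hC p_gt2 hmom hq hmu hsigma hmuj aK1 sS
    (G := fun z => z `^ r) (G1 := fun z => r * z `^ (r - 1))
    (G2 := fun z => r * (r - 1) * z `^ (r - 2))
    (E := fun z => K * z `^ (r - 2 - kappa))) => z w z1 w1.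
  by rewrite -[leRHS]mulrA; exact: hK.
split.
  by move=> s sS; apply: dominatedD; [exact: (hG s sS).1|exact: (hW s sS).1].
have C1 : 0 <= K * `|M| by rewrite mulr_ge0.
exists (K * `|M| + L + coef_bound r (r * (r - 1) / 2) b) => [|delta eps s sS hc].
  by rewrite addr_ge0 ?coef_bound_ge0 // addr_ge0.
have [d1 e1] := hG s sS; have [d2 e2] := hW s sS.
rewrite (driftD hC hmom sS d1 d2).
apply: drift_combine hc => //; rewrite ?powR_ge0 //.
have yr1 : y s `^ (r - 1) = y s `^ (r - 2) * y s.
  rewrite -{3}[y s]powRr1 ?(ltW (y0 sS)) // -powRDp ?y0 //; congr (_ `^ _); ring.
move: e1; rewrite yr1 (powRDp (r - 2) (- kappa) (y0 sS)).
have : 0 <= y s `^ (- kappa) by exact: powR_ge0.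
have : 0 <= y s `^ (r - 2) by exact: powR_ge0.
set Z := _ `^ (r - 2); set k := _ `^ (- kappa) => Z0 k_0.
rewrite (_ : r * (Z * y s) * m1 s + r * (r - 1) * Z / 2 * m2 s =
  Z * (r * (y s * m1 s) + r * (r - 1) / 2 * m2 s)); last by ring.
move=> h; apply: le_trans h _.
rewrite (_ : K * `|M| * k * Z = K * (Z * k) * `|M|); last by ring.
by rewrite ler_wpM2l ?ler_norm // !mulr_ge0.
Qed.

Definition ln_test (b : S -> R) (t : R * S) : R :=
  ln (y t) + b t.2 * y t `^ (- 2).

(** The exponent [r = 0] of the power family: [r * y `^ (r - 1)] is replaced by
    [y `^ (- 1)], and the average is [(U - V) / 2]. *)
Lemma drift_ln (c : R) (b : S -> R) :
  (forall i, \sum_j (b j - b i) * qlim i j = c - (u i / 2 - v i / 2)) ->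
  (forall s, Sigma s -> dom s (ln_test b)) /\
  exists2 C, 0 <= C & forall delta eps s, Sigma s -> close delta eps s ->
    `|Dr s (ln_test b) - c * y s `^ (- 2)|
    <= C * (eps * y s `^ (- delta) + y s `^ (- kappa)) * y s `^ (- 2).
Proof.
move=> hb.
have [K K_0 hK] := taylor_power_ln k0 k1 (lexx 0) (ler0n _ 2).
have kr : - kappa <= 0 by rewrite oppr_le0 ltW.
have [L L0] := corrector_power b kr (ler0n _ 2); rewrite sub0r => hW.
have hG s : Sigma s -> dom s (fun t => ln (y t)) /\
    `|Dr s (fun t => ln (y t)) - (y s `^ (- 1) * m1 s +
      - y s `^ (- 2) / 2 * m2 s)| <= K * y s `^ (- 2 - kappa) * M.
  move=> sS; apply: (drift_height S_gt0 hS hC p_gt2 hmom hq hmu hsigma hmuj aK1 sS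
    (G := @ln R) (G1 := fun z => z `^ (- 1)) (G2 := fun z => - z `^ (- 2))
    (E := fun z => K * z `^ (- 2 - kappa))) => z w z1 w1.
  have := hK z w z1 w1; rewrite !powRr0 !mul1r !mul0r !sub0r !add0r !mulr0 sub0r.
  by rewrite mulN1r [X in _ <= X -> _]mulrA.
split.
  by move=> s sS; apply: dominatedD; [exact: (hG s sS).1|exact: (hW s sS).1].
have C1 : 0 <= K * `|M| by rewrite mulr_ge0.
exists (K * `|M| + L + coef_bound 1 (- 2^-1) b) => [|delta eps s sS hc].
  by rewrite addr_ge0 ?coef_bound_ge0 // addr_ge0.
have [d1 e1] := hG s sS; have [d2 e2] := hW s sS.
rewrite (driftD hC hmom sS d1 d2).
apply: drift_combine hc => //; rewrite ?powR_ge0 //; last first.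
  by rewrite hb; ring.
have yr1 : y s `^ (- 1) = y s `^ (- 2) * y s.
  rewrite -{3}[y s]powRr1 ?(ltW (y0 sS)) // -powRDp ?y0 //; congr (_ `^ _); ring.
move: e1; rewrite yr1 (powRDp (- 2) (- kappa) (y0 sS)).
have : 0 <= y s `^ (- kappa) by exact: powR_ge0.
have : 0 <= y s `^ (- 2) by exact: powR_ge0.
set Z := _ `^ (- 2); set k := _ `^ (- kappa) => Z0 k_0.
rewrite (_ : Z * y s * m1 s + - Z / 2 * m2 s =
  Z * (1 * (y s * m1 s) + - 2^-1 * m2 s)); last by field.
move=> h; apply: le_trans h _.
rewrite (_ : K * `|M| * k * Z = K * (Z * k) * `|M|); last by ring.
by rewrite ler_wpM2l ?ler_norm // !mulr_ge0.
Qed.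

Definition sqr_ln_test (b : S -> R) (t : R * S) : R :=
  y t `^ 2 * ln (y t) + b t.2 * ln (y t).

(** The leading term of the drift is [(u i + v i) * ln y]. When [U + V = 0] its
    coefficient has mean zero and the corrector cancels it; the polynomial rate
    then bounds the error times the logarithm. *)
Lemma drift_sqr_ln (delta : R) (b : S -> R) : 0 < delta ->
  (forall i, \sum_j (b j - b i) * qlim i j = - (u i + v i)) ->
  (forall s, Sigma s -> dom s (sqr_ln_test b)) /\
  exists2 C, 0 <= C & forall s, Sigma s -> close delta 1 s ->
    Dr s (sqr_ln_test b) <= C.
Proof.
move=> delta0 hb.
have [K K_0 hK] := taylor_power_ln k0 k1 (ler0n _ 2) (lexx 2).
have hG s : Sigma s -> dom s (fun t => y t `^ 2 * ln (y t)) /\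
    `|Dr s (fun t => y t `^ 2 * ln (y t)) - ((2 * (y s * ln (y s)) + y s) * m1 s +
      (2 * ln (y s) + 3) / 2 * m2 s)| <= K * y s `^ (- kappa) * M.
  move=> sS; apply: (drift_height S_gt0 hS hC p_gt2 hmom hq hmu hsigma hmuj aK1 sS
    (G := fun z => z `^ 2 * ln z) (G1 := fun z => 2 * (z * ln z) + z)
    (G2 := fun z => 2 * ln z + 3)
    (E := fun z => K * z `^ (- kappa))) => z w z1 w1.
  have z0 : 0 <= z by apply: le_trans z1.
  have x1 : z `^ (2 - 1) = z.
    have e1 : 2 - 1 = 1 :> R by ring.
    by rewrite e1 powRr1.
  have x2 : z `^ (2 - 2) = 1 by rewrite subrr powRr0.
  have x3 : z `^ (2 - 2 - kappa) = z `^ (- kappa) by rewrite subrr sub0r.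
  have := hK z w z1 w1; rewrite x1 x2 x3 => h.
  rewrite -[leRHS]mulrA; apply: le_trans h; rewrite le_eqVlt; apply/orP; left.
  by apply/eqP; congr (`|_|); ring.
have hW s : Sigma s -> dom s (fun t => b t.2 * ln (y t)) /\
    `|Dr s (fun t => b t.2 * ln (y t)) -
       ln (y s) * \sum_j (b j - b s.2) * q s.2 j s.1| <= bmax b * (1 * (1 + M)).
  move=> sS; apply: (drift_corrector S_gt0 hS hC p_gt2 hmom hq aK1 sS
    (W := @ln R) (E := fun=> 1) (le_bmax b)) => z w z1 w1.
  rewrite mul1r; apply: le_trans (lipschitz_ln z1 w1) _.
  rewrite -[leLHS]powRr1 //; apply: le_1DpowR => //.
  by have := k0; rewrite /kappa; lra.
split.
  by move=> s sS; apply: dominatedD; [exact: (hG s sS).1|exact: (hW s sS).1].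
pose uM := \sum_i `|u i|; pose vM := \sum_i `|v i|.
pose C := K * `|M| + bmax b * (1 + `|M|) + coef_bound 2 1 b * delta^-1
  + (uM / 2 + 1) + 3 / 2 * (vM + 1).
have Cb := coef_bound_ge0 2 1 b.
have uM0 : 0 <= uM by exact: sumr_ge0.
have vM0 : 0 <= vM by exact: sumr_ge0.
have di0 : 0 <= delta^-1 by rewrite invr_ge0 ltW.
have bM0 := bmax_ge0 b.
exists C => [|s sS hc].
  by rewrite /C !addr_ge0 // !mulr_ge0 // addr_ge0.
have [d1 e1] := hG s sS; have [d2 e2] := hW s sS.
rewrite (driftD hC hmom sS d1 d2).
have l0 : 0 <= ln (y s) by apply: le_trans (ln_height_ge1 sS).
have e3 := coef_close 2 1 b hc; rewrite !mul1r in e3.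
have [c1 c2 _] := hc; rewrite !mul1r in c1 c2.
have p1 : y s `^ (- delta) <= 1 by apply: le1_powR; rewrite ?y1 // oppr_le0 ltW.
have k1' : y s `^ (- kappa) <= 1 by apply: le1_powR; rewrite ?y1 // oppr_le0 ltW.
have pl : y s `^ (- delta) * ln (y s) <= delta^-1.
  have := ln_le_powR delta0 (y1 sS); rewrite ger0_norm // => h.
  apply: le_trans (ler_wpM2l (powR_ge0 _ _) h) _.
  by rewrite mulrCA powR_mulV ?y0 // mulr1.
have sq : \sum_j (b j - b s.2) * (q s.2 j s.1 - qlim s.2 j) =
    \sum_j (b j - b s.2) * q s.2 j s.1 + (u s.2 + v s.2).
  rewrite -[X in _ + X]opprK -hb -sumrB.
  by apply: eq_bigr => j _; rewrite mulrBr.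
rewrite sq in e3.
have uu : `|u s.2| <= uM by rewrite /uM (bigD1 s.2) //= lerDl sumr_ge0.
have vv : `|v s.2| <= vM by rewrite /vM (bigD1 s.2) //= lerDl sumr_ge0.
have e3' : ln (y s) * (2 * (y s * m1 s - u s.2 / 2) + (m2 s - v s.2) +
   (\sum_j (b j - b s.2) * q s.2 j s.1 + (u s.2 + v s.2))) <=
   coef_bound 2 1 b * delta^-1.
  apply: le_trans (ler_wpM2l l0 (le_trans (ler_norm _) e3)) _.
  by rewrite mulrCA ler_wpM2l // mulrC.
have e1' : K * y s `^ (- kappa) * M <= K * `|M|.
  rewrite -mulrA ler_wpM2l //; apply: le_trans (ler_wpM2l (powR_ge0 _ _) (ler_norm M)) _.
  by rewrite ler_piMl.
have e2' : bmax b * (1 * (1 + M)) <= bmax b * (1 + `|M|).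
  by rewrite mul1r ler_wpM2l // lerD2l ler_norm.
have f1 := le_trans (ler_norm _) (le_trans e1 e1').
have f2 := le_trans (ler_norm _) (le_trans e2 e2').
have g1 : y s * m1 s <= uM / 2 + 1.
  by have := le_trans (ler_norm _) c1; have := le_trans (ler_norm _) uu; lra.
have g2 : m2 s <= vM + 1.
  by have := le_trans (ler_norm _) c2; have := le_trans (ler_norm _) vv; lra.
have := lerD (lerD f1 f2) e3'; rewrite /C.
set Q := \sum_j _; set l := ln _.
rewrite (_ : _ + ln (y s) * _ = Dr s (fun t => y t `^ 2 * ln (y t)) +
  Dr s (fun t => b t.2 * ln (y t)) - (y s * m1 s) - 3 / 2 * m2 s); last first.
  by rewrite -/l; field.
lra.
Qed.

Lemma next_mean_drift F s : Sigma s -> dom s F ->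
  next_mean X eta s (fun t => (F t)%:E) = (F s + Dr s F)%:E.
Proof. by move=> sS hF; rewrite (next_mean_cond_mean hC hmom sS hF) /drift addrC subrK. Qed.

Lemma coercive_far (F : R * S -> R) : (forall c, far (fun s => c < F s)) ->
  coercive Sigma F.
Proof.
move=> h c; apply: sub_finite_set (far_out_finite_compl hS (h c)) => s [sS /= Fc].
by split=> //=; apply/negP; rewrite -leNgt.
Qed.

(** The finitely many states where the domination fails are absorbed by the
    constant. *)
Lemma le_add_far (f h : R * S -> R) (A : R) : (forall s, Sigma s -> 0 <= h s) ->
  far (fun s => f s <= A * h s) -> 0 <= A ->
  exists B, forall s, Sigma s -> f s <= A * h s + B.
Proof.
move=> h0 hf A0; have [F fF hF] := far_out_finite hS hf.
have [B hB] := finite_bound f fF.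
exists (Num.max B 0) => s sS.
have [Fs|nFs] := pselect (F s).
  rewrite (le_trans (hB s Fs)) // (@le_trans _ _ (Num.max B 0)) //.
    by rewrite le_max lexx.
  by rewrite lerDr mulr_ge0 // h0.
by rewrite (le_trans (hF s sS nFs)) // lerDl le_max lexx orbT.
Qed.

Variable pi_ : S -> R.
Hypothesis q_stoch : stochastic qlim.
Hypothesis q_irr : irreducible_matrix qlim.
Hypothesis pi_stat : stationary_distribution qlim pi_.

(** Solutions may be shifted by constants, and a corrector of the right sign
    keeps the test functions nonnegative. *)
Lemma poisson_ge0 (k : S -> R) : \sum_i pi_ i * k i = 0 ->
  exists2 b : S -> R, forall i, 0 <= b i &
    forall i, \sum_j (b j - b i) * qlim i j = k i.
Proof.
move=> hk; have [b hb] := poisson_solvable q_stoch q_irr pi_stat hk.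
exists (fun i => b i + \sum_j `|b j|) => i.
  have : - b i <= \sum_j `|b j|.
    by rewrite (bigD1 i) //= -normrN (le_trans (ler_norm _)) // lerDl sumr_ge0.
  lra.
by rewrite -hb; apply: eq_bigr => j _; ring.
Qed.

Lemma poisson_le0 (k : S -> R) : \sum_i pi_ i * k i = 0 ->
  exists2 b : S -> R, forall i, b i <= 0 &
    forall i, \sum_j (b j - b i) * qlim i j = k i.
Proof.
move=> hk; have [|b b0 hb] := @poisson_ge0 (fun i => - k i).
  by under eq_bigr do rewrite mulrN; rewrite sumrN hk oppr0.
exists (fun i => - b i) => i; first by rewrite oppr_le0.
rewrite -[RHS]opprK -hb -sumrN; apply: eq_bigr => j _; ring.
Qed.

Let U := \sum_i pi_ i * u i.
Let V := \sum_i pi_ i * v i.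

Lemma sum_centered (c A B : R) :
  \sum_i pi_ i * (c - (A * (u i / 2) + B * v i)) = c - (A * (U / 2) + B * V).
Proof.
have [_ pi1 _] := pi_stat.
rewrite (eq_bigr (fun i => c * pi_ i - (A / 2 * (pi_ i * u i) + B * (pi_ i * v i)))).
  rewrite sumrB big_split /= -!mulr_sumr pi1 -/U -/V; ring.
by move=> i _; ring.
Qed.

Definition power_rate (r : R) : R := r / 2 * (U + (r - 1) * V).

Let power_poisson r : \sum_i pi_ i *
  (power_rate r - (r * (u i / 2) + r * (r - 1) / 2 * v i)) = 0.
Proof. by rewrite sum_centered /power_rate; ring. Qed.

Hypothesis close0 : forall eps, 0 < eps -> far (close 0 eps).

Lemma power_drift_far (r c : R) (b : S -> R) (eps : R) :
  - kappa <= r -> r <= 2 -> 0 < eps ->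
  (forall i, \sum_j (b j - b i) * qlim i j =
     c - (r * (u i / 2) + r * (r - 1) / 2 * v i)) ->
  far (fun s => dom s (power_test r b) /\
    `|Dr s (power_test r b) - c * y s `^ (r - 2)| <= eps * y s `^ (r - 2)).
Proof.
move=> kr r2 e0 hb; have [hd [C C0 hC']] := drift_power kr r2 hb.
have e1 : 0 < eps / (2 * (C + 1)) by rewrite divr_gt0 // mulr_gt0 // ltr_wpDl.
apply: far_out_imp (far_outI (close0 e1) (far_powRN e1 k0)) _ => s sS [c1 c2].
split; first exact: hd.
apply: le_trans (hC' _ _ _ sS c1) _; rewrite ler_wpM2r ?powR_ge0 //.
rewrite oppr0 powRr0 mulr1.
apply: (@le_trans _ _ (C * (eps / (2 * (C + 1)) + eps / (2 * (C + 1))))).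
  by rewrite ler_wpM2l // lerD2l.
rewrite (_ : C * _ = (C / (C + 1)) * eps); last by field; lra.
by rewrite ler_piMl ?(ltW e0) // ler_pdivrMr ?ltr_wpDl // mul1r lerDl.
Qed.

(** An exponent [al] so small that the term [al * V] in the rate cannot outweigh
    the gap [g] between [U] and [V], or between [U] and [- V]. *)
Lemma ex_small_exponent (g : R) : 0 < g ->
  exists al, [/\ 0 < al, al <= kappa & al * `|V| < g].
Proof.
move=> g0; have V1 : 0 < `|V| + 1 by rewrite ltr_wpDl.
exists (Num.min kappa (g / (`|V| + 1))); split.
- by rewrite lt_min k0 divr_gt0.
- by rewrite ge_min lexx.
- apply: (@le_lt_trans _ _ (g / (`|V| + 1) * `|V|)).
    by rewrite ler_wpM2r // ge_min lexx orbT.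
  by rewrite mulrAC ltr_pdivrMr // ltr_pM2l // ltrDl.
Qed.

Let le_absV (al : R) : 0 < al -> (al * V <= al * `|V|) /\ (- (al * V) <= al * `|V|).
Proof.
move=> al0; split; first by rewrite ler_wpM2l ?ler_norm // ltW.
by rewrite -mulrN ler_wpM2l ?(ltW al0) // -normrN ler_norm.
Qed.

Let powR_le_exp (r t : R) s : Sigma s -> r <= t -> y s `^ r <= y s `^ t.
Proof. by move=> sS rt; apply: le_powR_exp => //; exact: y1. Qed.

Let corrector_ge0 (b : S -> R) (r : R) s : (forall i, 0 <= b i) ->
  0 <= b s.2 * y s `^ r.
Proof. by move=> b0; rewrite mulr_ge0 ?powR_ge0. Qed.

Lemma power_test_le (r : R) (b : S -> R) s : Sigma s ->
  power_test r b s <= (1 + bmax b) * y s `^ r.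
Proof.
move=> sS; rewrite /power_test mulrDl mul1r lerD2l.
apply: (@le_trans _ _ (bmax b * y s `^ (r - 2))).
  by rewrite ler_wpM2r ?powR_ge0 // (le_trans (ler_norm _)) // le_bmax.
by rewrite ler_wpM2l ?bmax_ge0 // powR_le_exp //; lra.
Qed.

(** * Choice of the test function in each regime *)

Lemma drift_transient : V < U -> transient X eta Sigma.
Proof.
move=> VU; have g0 : 0 < U - V by rewrite subr_gt0.
have [al [al0 alk alV]] := ex_small_exponent g0.
have [b b0 hb] := poisson_ge0 (power_poisson (- al)).
have [aV1 aV2] := le_absV al0.
have c0 : 0 < - power_rate (- al).
  rewrite /power_rate (_ : - _ = al / 2 * (U - V - al * V)); last by ring.
  by rewrite mulr_gt0 ?divr_gt0 //; lra.
have kr : - kappa <= - al by rewrite lerN2.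
have r2 : - al <= 2 by lra.
have [A fA hA] := far_out_finite hS (power_drift_far kr r2 c0 hb).
apply: (foster_transient S_gt0 hS hC (f := power_test (- al) b) fA).
- move=> s sS; rewrite /power_test ltr_pwDl ?powR_gt0 ?y0 //.
  exact: corrector_ge0.
- move=> c c_0; have bM1 : 0 < 1 + bmax b by rewrite ltr_pwDl ?bmax_ge0.
  have e0 : 0 < c / 2 / (1 + bmax b) by rewrite !divr_gt0.
  apply: sub_finite_set (far_out_finite_compl hS (far_powRN e0 al0)).
  move=> s [sS /= cf]; split=> //=; apply/negP; rewrite -ltNge.
  rewrite ltr_pdivrMr // [ltRHS]mulrC; apply: lt_le_trans (power_test_le (- al) b sS).
  by apply: lt_le_trans cf; lra.
- move=> s sS /(hA s sS) [hd]; rewrite ler_norml => /andP[_ h].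
  by rewrite /superharmonic_at next_mean_drift // lee_fin; lra.
Qed.

Lemma drift_recurrent : U < V -> recurrent X eta Sigma.
Proof.
move=> UV; have g0 : 0 < V - U by rewrite subr_gt0.
have [al [al0 alk alV]] := ex_small_exponent g0.
have [b b0 hb] := poisson_ge0 (power_poisson al).
have [aV1 aV2] := le_absV al0.
have c0 : 0 < - power_rate al.
  rewrite /power_rate (_ : - _ = al / 2 * (V - U - al * V)); last by ring.
  by rewrite mulr_gt0 ?divr_gt0 //; lra.
have k1' := k1; have k0' := k0.
have kr : - kappa <= al by lra.
have r2 : al <= 2 by lra.
have [A fA hA] := far_out_finite hS (power_drift_far kr r2 c0 hb).
apply: (foster_recurrent S_gt0 hS hC (f := power_test al b) fA).
- by move=> s sS; rewrite /power_test addr_ge0 ?powR_ge0 ?corrector_ge0.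
- apply: coercive_far => c; apply: far_out_imp (far_powR (c + 1) al0) _ => s sS h.
  have := corrector_ge0 (al - 2) s b0; rewrite /power_test; lra.
- move=> s sS /(hA s sS) [hd]; rewrite ler_norml => /andP[_ h].
  by rewrite /superharmonic_at next_mean_drift // lee_fin; lra.
Qed.

Lemma power2 s : y s `^ (2 - 2) = 1.
Proof. by rewrite subrr powRr0. Qed.

Let k2 : - kappa <= 2.
Proof. by have k0' := k0; lra. Qed.

Lemma drift_positive : U < - V -> positive_recurrent X eta Sigma.
Proof.
move=> UV; have [b b0 hb] := poisson_ge0 (power_poisson 2).
have c0 : 0 < - power_rate 2 / 2.
  rewrite divr_gt0 // /power_rate (_ : - _ = - V - U) ?subr_gt0 //; by field.
have [A fA hA] := far_out_finite hS (power_drift_far k2 (lexx 2) c0 hb).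
apply: (foster_positive S_gt0 hS hC (f := power_test 2 b) fA c0).
- by move=> s sS; rewrite /power_test addr_ge0 ?powR_ge0 ?corrector_ge0.
- apply: coercive_far => c; apply: far_out_imp (far_powR (c + 1) (ltr0n _ 2)) _ => s sS h.
  have := corrector_ge0 (2 - 2) s b0; rewrite /power_test; lra.
- move=> s sS /(hA s sS) [hd]; rewrite power2 !mulr1 ler_norml => /andP[_ h].
  by rewrite next_mean_drift // lee_fin; lra.
- move=> s sS _; rewrite next_mean_drift ?ltry //.
  by have [hd _] := drift_power k2 (lexx 2) hb; exact: hd.
Qed.

(** The second moment bounds the mean of [Y ^ 2], which dominates the
    submartingale [Y ^ (2 - al)] growing strictly slower. *)
Lemma drift_null : - V < U -> recurrent X eta Sigma -> null_recurrent X eta Sigma.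
Proof.
move=> UV; have g0 : 0 < U + V by lra.
have [al [al0 alk alV]] := ex_small_exponent g0.
have [b b0 hb] := poisson_ge0 (power_poisson (2 - al)).
have [b' b'0 hb'] := poisson_ge0 (power_poisson 2).
have [aV1 aV2] := le_absV al0.
have k1' := k1; have k0' := k0.
have c0 : 0 < power_rate (2 - al).
  rewrite /power_rate (_ : (2 - al) / 2 * _ = (2 - al) / 2 * (U + V - al * V)).
    by rewrite mulr_gt0 ?divr_gt0 //; lra.
  by congr (_ * _); ring.
have kr : - kappa <= 2 - al by lra.
have r2 : 2 - al <= 2 by lra.
have [A fA hA] := far_out_finite hS (far_outI (power_drift_far kr r2 c0 hb)
  (power_drift_far k2 (lexx 2) ltr01 hb')).
have f0 : nonneg_on Sigma (power_test (2 - al) b).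
  by move=> s sS; rewrite /power_test addr_ge0 ?powR_ge0 ?corrector_ge0.
have h0 : nonneg_on Sigma (power_test 2 b').
  by move=> s sS; rewrite /power_test addr_ge0 ?powR_ge0 ?corrector_ge0.
apply: (foster_null S_gt0 hS hC (f := power_test (2 - al) b)
  (h := power_test 2 b') (C := `|power_rate 2| + 1) fA f0 h0).
- by rewrite addr_ge0.
- apply: coercive_far => c.
  have al2 : 0 < 2 - al by lra.
  apply: far_out_imp (far_powR (c + 1) al2) _ => s sS h.
  have := corrector_ge0 (2 - al - 2) s b0; rewrite /power_test; lra.
- move=> delta d0; have bM1 : 0 < 1 + bmax b by rewrite ltr_pwDl ?bmax_ge0.
  apply: le_add_far => //; last exact: ltW.
  have e0 : 0 < delta / (1 + bmax b) by rewrite divr_gt0.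
  apply: far_out_imp (far_powRN e0 al0) _ => s sS h.
  apply: le_trans (power_test_le _ _ sS) _.
  apply: (@le_trans _ _ (delta * y s `^ 2)); last first.
    by rewrite ler_wpM2l ?(ltW d0) // lerDl corrector_ge0.
  rewrite powRDp ?y0 // mulrCA mulrC ler_wpM2r ?powR_ge0 //.
  by move: h; rewrite ler_pdivlMr // mulrC.
- move=> s sS /(hA s sS) [[hd h] _]; move: h; rewrite ler_norml => /andP[h _].
  by rewrite next_mean_drift // lee_fin; lra.
- move=> s sS /(hA s sS) [_ [hd h]]; move: h; rewrite power2 !mulr1.
  rewrite ler_norml => /andP[_ h].
  by rewrite next_mean_drift // lee_fin; have := ler_norm (power_rate 2); lra.
Qed.

Section Boundary.
Variable delta : R.
Hypothesis delta_gt0 : 0 < delta.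
Hypothesis close_delta : far (close delta 1).
Hypothesis V_gt0 : 0 < V.

Let ep := Num.min delta kappa / 2.

Let ep0 : 0 < ep.
Proof. by rewrite /ep divr_gt0 // lt_min delta_gt0 k0. Qed.

Let epk : ep <= kappa / 2.
Proof. by rewrite /ep ler_wpM2r ?invr_ge0 // ge_min lexx orbT. Qed.

Let powR_rates s : Sigma s ->
  1 * y s `^ (- delta) + y s `^ (- kappa) <= 2 * (y s `^ (- ep) * y s `^ (- ep)).
Proof.
move=> sS; rewrite -powRDp ?y0 // mul1r mulrDl mul1r.
have h1 : 2 * ep <= delta by rewrite /ep mulrC divfK // ge_min lexx.
have h2 : 2 * ep <= kappa by rewrite /ep mulrC divfK // ge_min lexx orbT.
by apply: lerD; apply: powR_le_exp => //; lra.
Qed.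

(** The drift of the logarithm is of order [y `^ (- 2 - 2 * ep)] at most, whereas
    [y `^ (- ep)] has a positive drift of the larger order [y `^ (- 2 - ep)];
    subtracting the latter makes the sum decrease in mean. *)
Lemma boundary_recurrent : U = V -> recurrent X eta Sigma.
Proof.
move=> UV; have k1' := k1; have k0' := k0; have ep_0 := ep0; have ep_k := epk.
have [b b0 hb] : exists2 b : S -> R, forall i, 0 <= b i &
    forall i, \sum_j (b j - b i) * qlim i j = 0 - (u i / 2 - v i / 2).
  have [|b b0 hb] := @poisson_ge0 (fun i => 0 - (1 * (u i / 2) + - 2^-1 * v i)).
    by rewrite sum_centered UV; field.
  by exists b => // i; rewrite hb; field.
have [b' b'0 hb'] := poisson_le0 (power_poisson (- ep)).
have rate : power_rate (- ep) = ep ^+ 2 * V / 2.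
  by rewrite /power_rate UV; field.
have c0 : 0 < power_rate (- ep) / 2.
  by rewrite rate !divr_gt0 // mulr_gt0 // exprn_gt0.
have kr : - kappa <= - ep by lra.
have r2 : - ep <= 2 by lra.
have [hd [C C0 hL]] := drift_ln hb.
have C1 : 0 < 2 * (C + 1) by rewrite mulr_gt0 // ltr_wpDl.
have e0 : 0 < power_rate (- ep) / 2 / (2 * (C + 1)) by rewrite divr_gt0.
have [A fA hA] := far_out_finite hS (far_outI (power_drift_far kr r2 c0 hb')
  (far_outI close_delta (far_powRN e0 ep0))).
have f1 s : Sigma s -> ln (y s) - 1 <= ln_test b s - power_test (- ep) b' s.
  move=> sS; rewrite /ln_test /power_test.
  have := corrector_ge0 (- 2) s b0.
  have : b' s.2 * y s `^ (- ep - 2) <= 0 by rewrite mulr_le0_ge0 ?powR_ge0.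
  have : y s `^ (- ep) <= 1 by rewrite le1_powR ?y1 // oppr_le0 ltW.
  lra.
apply: (foster_recurrent S_gt0 hS hC
  (f := fun s => ln_test b s - power_test (- ep) b' s) fA).
- move=> s sS; apply: le_trans (f1 s sS); rewrite subr_ge0.
  exact: ln_height_ge1.
- apply: coercive_far => c; apply: far_out_imp (far_ln (c + 2)) _ => s sS h.
  by have := f1 s sS; lra.
- move=> s sS /(hA s sS) [[hd' h1] [h2 h3]].
  have hd1 := hd s sS; have := hL _ _ _ sS h2; rewrite mul0r subr0 => h4.
  rewrite /superharmonic_at next_mean_drift //; last first.
    rewrite /dominated_next.
    rewrite (_ : (fun w => _) = (fun w => ln_test b (chain X eta (start_time X eta s).+1 w)
      + -1 * power_test (- ep) b' (chain X eta (start_time X eta s).+1 w))).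
      by apply: dominatedD => //; exact: dominatedZ.
    by apply/funext => w; rewrite mulN1r.
  rewrite lee_fin (driftB hC hmom sS hd1 hd').
  have Z0 : 0 < y s `^ (- 2) by rewrite powR_gt0 ?y0.
  have E0 : 0 < y s `^ (- ep) by rewrite powR_gt0 ?y0.
  move: h1 h3 h4 (powR_rates sS); rewrite (powRDp (- ep) (- 2) (y0 sS)).
  set Z := y s `^ (- 2) in Z0 *; set E := y s `^ (- ep) in E0 *.
  set c := power_rate (- ep) => h1 h3 h4 h5.
  have h6 : Dr s (ln_test b) <= C * (2 * (E * E)) * Z.
    apply: le_trans (ler_norm _) (le_trans h4 _).
    by rewrite ler_wpM2r ?(ltW Z0) // ler_wpM2l.
  have h7 : c * (E * Z) - c / 2 * (E * Z) <= Dr s (power_test (- ep) b').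
    by move: h1; rewrite ler_norml => /andP[h1 _]; lra.
  have h8 : 2 * C * E <= c / 2.
    move: h3; rewrite ler_pdivlMr // => h3; apply: le_trans h3.
    rewrite mulrC ler_wpM2l ?(ltW E0) //; lra.
  have h9 : C * (2 * (E * E)) * Z <= c / 2 * (E * Z).
    rewrite (_ : C * (2 * (E * E)) * Z = 2 * C * E * (E * Z)); last by ring.
    by rewrite ler_wpM2r // mulr_ge0 ?ltW.
  lra.
Qed.

(** Here [Y ^ 2] has drift of order [y `^ (- 2 * ep)] at most, and subtracting
    [Y ^ (2 - ep)], of negative drift of order [y `^ (- ep)], gives a
    submartingale. It is still of order [Y ^ 2], so the comparison function
    with bounded drift has to be [Y ^ 2 * ln Y]. *)
Lemma boundary_null : U = - V -> recurrent X eta Sigma ->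
  null_recurrent X eta Sigma.
Proof.
move=> UV; have k1' := k1; have k0' := k0; have ep_0 := ep0; have ep_k := epk.
have [b b0 hb] := poisson_ge0 (power_poisson 2).
have rate2 : power_rate 2 = 0 by rewrite /power_rate UV; field.
have [b' b'0 hb'] := poisson_le0 (power_poisson (2 - ep)).
have [b2 b20 hb2] : exists2 b : S -> R, forall i, 0 <= b i &
    forall i, \sum_j (b j - b i) * qlim i j = - (u i + v i).
  have [|b2 b20 hb2] := @poisson_ge0 (fun i => 0 - (2 * (u i / 2) + 1 * v i)).
    by rewrite sum_centered UV; field.
  by exists b2 => // i; rewrite hb2; field.
have kr : - kappa <= 2 - ep by lra.
have r2 : 2 - ep <= 2 by lra.
have rate : - power_rate (2 - ep) = (2 - ep) / 2 * (ep * V).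
  by rewrite /power_rate UV; field.
have c0 : 0 < - power_rate (2 - ep) / 2.
  have e1 : 0 < 2 - ep by lra.
  have e2 : 0 < ep * V by exact: mulr_gt0.
  by rewrite rate divr_gt0 // mulr_gt0 // divr_gt0.
have [hd [C C0 hF2]] := drift_power k2 (lexx 2) hb.
have [hdh [C' C'0 hh]] := drift_sqr_ln delta_gt0 hb2.
have C1 : 0 < 2 * (C + 1) by rewrite mulr_gt0 // ltr_wpDl.
have e0 : 0 < - power_rate (2 - ep) / 2 / (2 * (C + 1)) by rewrite divr_gt0.
have [A fA hA] := far_out_finite hS (far_outI (power_drift_far kr r2 c0 hb')
  (far_outI close_delta (far_powRN e0 ep0))).
pose f s := power_test 2 b s - power_test (2 - ep) b' s.
have f1 s : Sigma s -> y s `^ 2 - y s `^ (2 - ep) <= f s.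
  move=> sS; rewrite /f /power_test.
  have := corrector_ge0 (2 - 2) s b0.
  have : b' s.2 * y s `^ (2 - ep - 2) <= 0 by rewrite mulr_le0_ge0 ?powR_ge0.
  lra.
have f0 : nonneg_on Sigma f.
  move=> s sS; apply: le_trans (f1 s sS); rewrite subr_ge0.
  exact: powR_le_exp.
have y2 s : 0 <= y s `^ 2 by exact: powR_ge0.
have h0 : nonneg_on Sigma (sqr_ln_test b2).
  move=> s sS; have l0 : 0 <= ln (y s) by apply: le_trans (ln_height_ge1 sS).
  by rewrite /sqr_ln_test addr_ge0 // mulr_ge0.
apply: (foster_null S_gt0 hS hC (f := f) (h := sqr_ln_test b2) fA f0 h0 C'0).
- apply: coercive_far => c.
  apply: far_out_imp (far_outI (far_powR 2 ep0) (far_height (c + 1))) _.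
  move=> s sS [h1 h2]; apply: lt_le_trans (f1 s sS).
  have e2 : y s `^ 2 = y s `^ (2 - ep) * y s `^ ep by rewrite -powRDp ?y0 // subrK.
  have y_1 := y1 sS.
  have h3 : y s <= y s `^ (2 - ep).
    by rewrite -{1}[y s]powRr1 ?(ltW (y0 sS)) // powR_le_exp //; lra.
  have h4 : y s `^ (2 - ep) * 2 <= y s `^ 2 by rewrite e2 ler_wpM2l ?powR_ge0.
  lra.
- move=> de d0; apply: le_add_far => //; last exact: ltW.
  pose B := 1 + bmax b + bmax b'.
  have B0 : 0 <= B by rewrite !addr_ge0 ?bmax_ge0.
  apply: far_out_imp (far_ln (B / de)) _ => s sS h.
  have l0 : 0 <= ln (y s) by apply: le_trans (ln_height_ge1 sS).
  apply: (@le_trans _ _ (B * y s `^ 2)).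
    have h1 := power_test_le 2 b sS.
    have h2 : - power_test (2 - ep) b' s <= bmax b' * y s `^ 2.
      have p0 : 0 <= y s `^ (2 - ep) by exact: powR_ge0.
      apply: (@le_trans _ _ (- (b' s.2 * y s `^ (2 - ep - 2)))).
        by rewrite /power_test; lra.
      rewrite -mulNr ler_pM ?powR_ge0 //.
      - by rewrite oppr_ge0.
      - by rewrite (le_trans (ler_norm _)) // normrN le_bmax.
      - by apply: powR_le_exp => //; lra.
    by rewrite /f /B [leRHS]mulrDl; lra.
  apply: (@le_trans _ _ (de * (y s `^ 2 * ln (y s)))).
    rewrite mulrCA mulrC ler_wpM2l //.
    by move: h; rewrite ler_pdivrMr // mulrC.
  by rewrite ler_wpM2l ?(ltW d0) // lerDl mulr_ge0.
- move=> s sS /(hA s sS) [[hd' h1] [h2 h3]].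
  have hd1 := hd s sS; have := hF2 _ _ _ sS h2.
  rewrite rate2 mul0r subr0 power2 mulr1 => h4.
  rewrite next_mean_drift //; last first.
    rewrite /dominated_next.
    rewrite (_ : (fun w => _) = (fun w => power_test 2 b (chain X eta
      (start_time X eta s).+1 w)
      + -1 * power_test (2 - ep) b' (chain X eta (start_time X eta s).+1 w))).
      by apply: dominatedD => //; exact: dominatedZ.
    by apply/funext => w; rewrite mulN1r.
  rewrite lee_fin (driftB hC hmom sS hd1 hd').
  have E0 : 0 < y s `^ (- ep) by rewrite powR_gt0 ?y0.
  have e2 : 2 - ep - 2 = - ep by ring.
  move: h1 h3 h4 (powR_rates sS); rewrite e2.
  set E := y s `^ (- ep) in E0 *; set c := power_rate (2 - ep) => h1 h3 h4 h5.
  have h6 : - (C * (2 * (E * E))) <= Dr s (power_test 2 b).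
    rewrite lerNl; apply: le_trans (ler_norm _) _; rewrite normrN.
    by apply: le_trans h4 _; rewrite ler_wpM2l.
  have h7 : Dr s (power_test (2 - ep) b') <= c / 2 * E.
    by move: h1; rewrite ler_norml => /andP[_ h1]; lra.
  have h8 : 2 * C * E <= - c / 2.
    move: h3; rewrite ler_pdivlMr // => h3; apply: le_trans h3.
    rewrite mulrC ler_wpM2l ?(ltW E0) //; lra.
  have h9 : C * (2 * (E * E)) <= - c / 2 * E.
    rewrite (_ : C * (2 * (E * E)) = 2 * C * E * E); last by ring.
    by rewrite ler_wpM2r // ltW.
  lra.
- move=> s sS /(hA s sS) [_ [h2 _]].
  by rewrite next_mean_drift ?lee_fin ?lerD2l ?hh //; exact: hdh.
Qed.

End Boundary.

End Lyapunov.

(** * The classification *)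

Section LittleOn.
Context {R : realType} {S : finType}.
Variable Sigma : set (R * S).
Hypothesis hS : half_strip Sigma.

Lemma little_on_of_littleo (i : S) (f g g' : R -> R) :
  littleo_line Sigma i f g ->
  (forall x, 1 <= x -> `|g x| <= `|g' x|) -> little_on Sigma i f g'.
Proof.
move=> /littleo_lineP hf gg eps e0; have [x0 hx] := hf _ e0.
exists (Num.max x0 1) => x sx; rewrite ge_max => /andP[xx x1].
by apply: le_trans (hx x sx xx) _; rewrite ler_wpM2l ?gg // ltW.
Qed.

End LittleOn.

Theorem theorem3p2p2 (R : realType) (S : finType) (Sigma : set (R * S))
  (disp : measure_display) (T : measurableType disp) (P : probability T R)
  (X : nat -> {RV P >-> R}) (eta : nat -> T -> S)
  (p Cp : R)
  (q : S -> S -> R -> R) (mu sigma2 : S -> R -> R) (muj : S -> S -> R -> R)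
  (qlim gamma dlim : S -> S -> R) (pi_ d e t2 : S -> R) :
  (0 < #|S|)%N ->
  half_strip Sigma ->
  homogeneous_irreducible_chain X eta Sigma ->
  (forall i j, is_condP X eta (fun n => [set w | eta n.+1 w = j]) i (q i j)) ->
  (forall i, is_condE X eta (incr X) i (mu i)) ->
  (forall i, is_condE X eta (fun n w => incr X n w ^+ 2) i (sigma2 i)) ->
  (forall i j, is_condE X eta
     (fun n w => incr X n w * (eta n.+1 w == j)%:R) i (muj i j)) ->
  2 < p ->
  (forall (n : nat) (x : R) (i : S), Sigma (x, i) ->
     (0 < P (at_state X eta n (x, i)))%E ->
     (condE P (fun w => (`|incr X n w| `^ p)%:E) (at_state X eta n (x, i))
        <= Cp%:E)%E) ->
  (forall i j, littleo_line Sigma i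
     (fun x => q i j x - (qlim i j + gamma i j / x)) (fun x => x^-1)) ->
  stochastic qlim ->
  irreducible_matrix qlim ->
  stationary_distribution qlim pi_ ->
  (forall i, 0 <= t2 i) ->
  (exists i, t2 i != 0) ->
  (forall i, littleo_line Sigma i
     (fun x => mu i x - (d i + e i / x)) (fun x => x^-1)) ->
  (forall i, littleo_line Sigma i (fun x => sigma2 i x - t2 i) (fun=> 1)) ->
  (forall i j, littleo_line Sigma i
     (fun x => muj i j x - dlim i j) (fun=> 1)) ->
  \sum_i pi_ i * d i = 0 ->
  let solution (a : S -> R) :=
    forall i, d i + \sum_j (a j - a i) * qlim i j = 0 in
  let U (a : S -> R) := \sum_i (2 * e i + 2 * \sum_j a j * gamma i j) * pi_ i in
  let V (a : S -> R) := \sum_i (t2 i + 2 * \sum_j a j * dlim i j) * pi_ i in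
  [/\ exists a, solution a,
      forall a b, solution a -> solution b ->
        exists c : R, forall i, b i = a i + c
    & forall a, solution a ->
      [/\ V a < U a -> transient X eta Sigma,
          `|U a| < V a -> null_recurrent X eta Sigma,
          U a < - V a -> positive_recurrent X eta Sigma
        & forall delta2 delta3 : R,
            0 < delta2 < 1 -> 0 < delta3 < 1 ->
            (forall i j, littleo_line Sigma i
               (fun x => q i j x - (qlim i j + gamma i j / x))
               (fun x => x `^ (- 1 - delta3))) ->
            (forall i, littleo_line Sigma i
               (fun x => mu i x - (d i + e i / x))
               (fun x => x `^ (- 1 - delta2))) ->
            (forall i, littleo_line Sigma i
               (fun x => sigma2 i x - t2 i) (fun x => x `^ (- delta2))) ->
            (forall i j, littleo_line Sigma i
               (fun x => muj i j x - dlim i j) (fun x => x `^ (- delta2))) ->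
            (* excludes only the degenerate case U = V = 0 *)
            0 < V a ->
            `|U a| = V a -> null_recurrent X eta Sigma]].
Proof.
move=> S_gt0 hS hC hq hmu hsigma hmuj p_gt2 hmom as_q q_stoch q_irr pi_stat
  _ _ as_mu as_sigma as_muj pid solution U V.
split.
- have [|a ha] := poisson_solvable q_stoch q_irr pi_stat (k := fun i => - d i).
    by under eq_bigr do rewrite mulrN; rewrite sumrN pid oppr0.
  by exists a => i; rewrite ha subrr.
- move=> a b ha hb; have /card_gt0P [i0 _] := S_gt0.
  exists (b i0 - a i0) => i.
  have /= h := harmonic_const q_stoch q_irr (b := fun j => b j - a j) _ i i0.
  rewrite [RHS]addrC -h; first by rewrite subrK.
  move=> k; transitivity (\sum_j (b j - b k) * qlim k j -
    \sum_j (a j - a k) * qlim k j).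
    by rewrite -sumrB; apply: eq_bigr => j _; ring.
  by have := ha k; have := hb k; lra.
move=> a ha.
(* heights are at least [expR 1], so that their logarithm is at least [1] *)
pose K0 := expR 1 + \sum_i `|a i|.
have aK i : expR 1 <= a i + K0.
  have : - a i <= \sum_i `|a i|.
    by rewrite (bigD1 i) //= -normrN (le_trans (ler_norm _)) // lerDl sumr_ge0.
  by rewrite /K0; lra.
have aK1 i : 1 <= a i + K0.
  by apply: le_trans (aK i); rewrite -[leLHS]expR0 ler_expR.
have UE : U a = \sum_i pi_ i * drift_coef gamma e a i by rewrite sum_drift_coef.
have VE : V a = \sum_i pi_ i * var_coef qlim dlim d t2 a i.
  by rewrite (sum_var_coef dlim t2 q_stoch ha pi_stat).
have close0 : forall eps, 0 < eps -> far_out Sigma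
    (moments_close q mu sigma2 muj qlim gamma dlim d e t2 a K0 0 eps).
  have r1 (x : R) : 1 <= x -> `|x^-1| <= `|rate1 0 x|.
    by move=> x1; rewrite /rate1 subr0 powR_inv1 // (le_trans _ x1).
  have r0 (x : R) : 1 <= x -> `|1 : R| <= `|rate0 0 x|.
    by move=> x1; rewrite /rate0 oppr0 powRr0.
  apply: moments_close_far => //; first by rewrite lexx ltr01.
  + by move=> i j; exact: (little_on_of_littleo (as_q i j) r1).
  + by move=> i; exact: (little_on_of_littleo (as_mu i) r1).
  + by move=> i; exact: (little_on_of_littleo (as_sigma i) r0).
  + by move=> i j; exact: (little_on_of_littleo (as_muj i j) r0).
have rec : U a < V a -> recurrent X eta Sigma.
  rewrite UE VE => h.
  exact: (drift_recurrent S_gt0 hS hC p_gt2 hmom hq hmu hsigma hmuj aK q_stoch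
    q_irr pi_stat close0 h).
have null : - V a < U a -> recurrent X eta Sigma -> null_recurrent X eta Sigma.
  rewrite UE VE => h hr.
  exact: (drift_null S_gt0 hS hC p_gt2 hmom hq hmu hsigma hmuj aK q_stoch
    q_irr pi_stat close0 h hr).
split.
- rewrite UE VE => h.
  exact: (drift_transient S_gt0 hS hC p_gt2 hmom hq hmu hsigma hmuj aK q_stoch
    q_irr pi_stat close0 h).
- by rewrite ltr_norml => /andP[h1 h2]; apply: null => //; exact: rec.
- rewrite UE VE => h.
  exact: (drift_positive S_gt0 hS hC p_gt2 hmom hq hmu hsigma hmuj aK q_stoch
    q_irr pi_stat close0 h).
move=> delta2 delta3 /andP[d20 d21] /andP[d30 d31] bs_q bs_mu bs_sigma bs_muj V0 UV.
pose delta := Num.min delta2 delta3.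
have delta0 : 0 < delta by rewrite /delta lt_min d20.
have delta1 : delta < 1 by rewrite /delta gt_min d21.
have dd2 : delta <= delta2 by rewrite /delta ge_min lexx.
have dd3 : delta <= delta3 by rewrite /delta ge_min lexx orbT.
have closed : far_out Sigma
    (moments_close q mu sigma2 muj qlim gamma dlim d e t2 a K0 delta 1).
  have r1 de (x : R) : delta <= de -> 1 <= x -> `|x `^ (- 1 - de)| <= `|rate1 delta x|.
    move=> dd x1; rewrite /rate1 !ger0_norm ?powR_ge0 // le_powR_exp //; lra.
  have r0 de (x : R) : delta <= de -> 1 <= x -> `|x `^ (- de)| <= `|rate0 delta x|.
    move=> dd x1; rewrite /rate0 !ger0_norm ?powR_ge0 // le_powR_exp //; lra.
  apply: moments_close_far => //; first by rewrite (ltW delta0) delta1.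
  + by move=> i j; apply: little_on_of_littleo (bs_q i j) _ => x; exact: r1.
  + by move=> i; apply: little_on_of_littleo (bs_mu i) _ => x; exact: r1.
  + by move=> i; apply: little_on_of_littleo (bs_sigma i) _ => x; exact: r0.
  + by move=> i j; apply: little_on_of_littleo (bs_muj i j) _ => x; exact: r0.
have [U0|U0] := leP 0 (U a).
  have UVe : U a = V a by rewrite -UV ger0_norm.
  apply: null; first by lra.
  rewrite UE VE in UVe; rewrite VE in V0.
  exact: (boundary_recurrent S_gt0 hS hC p_gt2 hmom hq hmu hsigma hmuj aK q_stoch
    q_irr pi_stat close0 delta0 closed V0 UVe).
have UVe : U a = - V a by rewrite -UV ltr0_norm // opprK.
have hr : recurrent X eta Sigma by apply: rec; lra.
rewrite UE VE in UVe; rewrite VE in V0.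
exact: (boundary_null S_gt0 hS hC p_gt2 hmom hq hmu hsigma hmuj aK q_stoch
    q_irr pi_stat close0 delta0 closed V0 UVe hr).
Qed.
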